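(* Let $m=1$, $\gamma\in(0,\infty)$, $\alpha\in(0,1]$, and set $s(\gamma)=\tfrac12(1-\tfrac\alpha\gamma)^+$. For every admissible curve $\Gamma$ with Hölder exponent $\alpha$ and every $s>s(\gamma)$, $\lim_{t\to0^+}P^1_\gamma f(\Gamma(x,t),t)=f(x)$ for a.e. $x\in\mathbb{R}$, for all $f\in H^s(\mathbb{R})$. Conversely, there exists an admissible curve $\Gamma$ with Hölder exponent $\alpha$ such that for every $s<s(\gamma)$ there is $f\in H^s(\mathbb{R})$ for which this a.e. convergence fails.
   Context: For $m>0$, $\gamma>0$, $f\in H^s(\mathbb{R})$, $\Gamma:\mathbb{R}\times[-1,1]\to\mathbb{R}$ and $t\in[0,1]$, define $$P^m_\gamma f(\Gamma(x,t),t)=\frac1{2\pi}\int_{\mathbb{R}}e^{i(\Gamma(x,t)\xi+t|\xi|^m)}e^{-t^\gamma|\xi|^m}\hat f(\xi)\,d\xi,$$ where $\hat f(\xi)=\int e^{-ix\xi}f(x)\,dx$. An admissible curve with Hölder exponent $\alpha\in(0,1]$ is a continuous $\Gamma:\mathbb{R}\times[-1,1]\to\mathbb{R}$ with $\Gamma(x,0)=x$, bilipschitz in $x$: $C_1|x-x'|\le|\Gamma(x,t)-\Gamma(x',t)|\le C_2|x-x'|$ for all $t\in[-1,1]$, $x,x'\in\mathbb{R}$, and $\alpha$-Hölder in $t$: $|\Gamma(x,t)-\Gamma(x,t')|\le C_3|t-t'|^\alpha$ for all $x\in\mathbb{R}$, $t,t'\in[-1,1]$, with constants $C_1,C_2,C_3>0$.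 $a^+=\max\{a,0\}$. *)

(* Defs.v *)
(* Complex numbers are represented by pairs of
   real parts (real part, imaginary part) of real-valued functions. *)
From HB Require Import structures.
From mathcomp Require Import all_boot all_order all_algebra.
From mathcomp Require Import all_classical all_reals all_analysis.
Set Implicit Arguments. Unset Strict Implicit. Unset Printing Implicit Defensive.
Import Order.TTheory GRing.Theory Num.Theory.
Import numFieldNormedType.Exports.
Local Open Scope classical_set_scope.
Local Open Scope ring_scope.

Section Defs.
Variable R : realType.
Local Notation mu := (@lebesgue_measure R).

Definition admissible (alpha : R) (Gam : R -> R -> R) : Prop :=
  {within [set p : R * R | -1 <= p.2 <= 1], continuous (fun p => Gam p.1 p.2)}
  /\ (forall x, Gam x 0 = x)
  /\ (exists C1 C2 C3 : R, 0 < C1 /\ 0 < C2 /\ 0 < C3 /\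
       (forall t x x', -1 <= t <= 1 ->
          C1 * `|x - x'| <= `|Gam x t - Gam x' t| /\
          `|Gam x t - Gam x' t| <= C2 * `|x - x'|) /\
       (forall x t t', -1 <= t <= 1 -> -1 <= t' <= 1 ->
          `|Gam x t - Gam x t'| <= C3 * (`|t - t'| `^ alpha))).

Definition test_function (phi : R -> R) : Prop :=
  (forall n x, derivable (derive1n n phi) x 1) /\
  (exists M : R, forall x, M < `|x| -> phi x = 0).

Definition loc_integrable (f : R -> R) : Prop :=
  measurable_fun setT f /\
  forall M : R, mu.-integrable `[-M, M] (EFin \o f).

(* g = gr + i gi is (a representative of) the Fourier transform
   \hat f(xi) = \int e^{-i x xi} f(x) dx of the function f = fr + i fi,
   in the sense of distributions: for every test function phi,
   \int f phi = (1/2pi) \int g(xi) \check phi(xi) dxi, where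
   \check phi(xi) = \int e^{i x xi} phi(x) dx. *)
Definition check_re (phi : R -> R) (xi : R) : R :=
  Rintegral mu setT (fun x => phi x * cos (x * xi)).
Definition check_im (phi : R -> R) (xi : R) : R :=
  Rintegral mu setT (fun x => phi x * sin (x * xi)).

Definition fourier_pair (fr fi gr gi : R -> R) : Prop :=
  loc_integrable fr /\ loc_integrable fi /\
  forall phi, test_function phi ->
    let cr := check_re phi in let ci := check_im phi in
    mu.-integrable setT (EFin \o (fun xi => gr xi * cr xi - gi xi * ci xi)) /\
    mu.-integrable setT (EFin \o (fun xi => gr xi * ci xi + gi xi * cr xi)) /\
    Rintegral mu setT (fun x => fr x * phi x) =
      (2 * pi)^-1 * Rintegral mu setT (fun xi => gr xi * cr xi - gi xi * ci xi) /\
    Rintegral mu setT (fun x => fi x * phi x) =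
      (2 * pi)^-1 * Rintegral mu setT (fun xi => gr xi * ci xi + gi xi * cr xi).

(* g is the Fourier transform of an element of H^s(R):
   \int (1 + xi^2)^s |g(xi)|^2 dxi < oo. *)
Definition Hs_hat (s : R) (gr gi : R -> R) : Prop :=
  measurable_fun setT gr /\ measurable_fun setT gi /\
  (\int[mu]_xi (((1 + xi ^+ 2) `^ s) * (gr xi ^+ 2 + gi xi ^+ 2))%:E < +oo)%E.

(* P^m_gamma f (y, t) = (1/2pi) \int e^{i(y xi + t|xi|^m)} e^{-t^gamma |xi|^m} g(xi) dxi,
   real and imaginary parts, where g = \hat f. *)
Definition P_re (m gamma : R) (gr gi : R -> R) (y t : R) : R :=
  (2 * pi)^-1 * Rintegral mu setT (fun xi =>
    expR (- (t `^ gamma * `|xi| `^ m)) *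
    (gr xi * cos (y * xi + t * `|xi| `^ m) - gi xi * sin (y * xi + t * `|xi| `^ m))).
Definition P_im (m gamma : R) (gr gi : R -> R) (y t : R) : R :=
  (2 * pi)^-1 * Rintegral mu setT (fun xi =>
    expR (- (t `^ gamma * `|xi| `^ m)) *
    (gr xi * sin (y * xi + t * `|xi| `^ m) + gi xi * cos (y * xi + t * `|xi| `^ m))).

Definition ae_conv (m gamma : R) (Gam : R -> R -> R) (fr fi gr gi : R -> R) : Prop :=
  {ae mu, forall x,
     (P_re m gamma gr gi (Gam x t) t @[t --> 0^'+] --> fr x) /\
     (P_im m gamma gr gi (Gam x t) t @[t --> 0^'+] --> fi x)}.

End Defs.

(* Main.v *)
(* Convergence. Only the real part matters, since the imaginary part for [gr + i gi] is the
   real part for [gi - i gr]. Pick [tau] with [1 - 2s < tau < 1] and [tau <= alpha / gamma], put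
   [b = 1 / (1 - tau)], and cut the frequency line at [+-j^b], so that a block at frequency [w]
   has length about [w^tau]. On such a block the multiplier [e^(-y|z|) cos(rho z)], with
   [y = t^gamma] and [|rho| <= C t^alpha <= C y^tau], has bounded total variation, so Abel
   summation bounds the block contribution at [(x, t)] by a function [D_j x] independent of
   [t]: an average of [|int_a^c g(z) e^(ixz) dz|] over the cut points [c] of the block.
   A Bessel inequality (weight [1 + cos(x/L)], kernel bounded by [L / (1 + L^2 v^2)], Schur
   test) gives [sum_j int_I D_j < oo] for [s > (1 - tau) / 2], hence [sum_j D_j x < oo] almost
   everywhere, and Tannery's theorem yields a limit as [t -> 0]. Testing against bump
   functions identifies this limit with [f].

   Divergence. Along [Gam x t = x + |t|^alpha - t] the dispersion is cancelled on positive
   frequencies: the phase is [X z] with [X = x + t^alpha]. Let [g] be a lacunary sum of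
   combs, the [i]-th one having mass [A^i] spread over [K_i] unit intervals with left ends the
   multiples of [H_i = B^i] in [(L_i, 2 L_i]], [L_i = H_i K_i]. For every [x] there is a small
   [t] with [t^gamma L_j] bounded above and below for which [X H_j] is a multiple of
   [2 pi]; the [j]-th comb then contributes about [A^j], the lower ones are negligible by the
   growth of [A^i], the higher ones by the damping. Choosing [K_i] of order
   [H_i^(gamma / alpha - 1)] when this exponent is nonnegative, and [K_i = 1] otherwise, puts
   [g] in [H^s] for all [s] below the critical index once [B] is large. *)
Require Import Defs.
From HB Require Import structures.
From mathcomp Require Import all_boot all_order all_algebra.
From mathcomp Require Import all_classical all_reals all_analysis.
From mathcomp Require Import measurable_realfun ess_sup_inf.
From mathcomp Require Import ring lra.
Set Implicit Arguments. Unset Strict Implicit. Unset Printing Implicit Defensive.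
Import Order.TTheory GRing.Theory Num.Theory.
Import numFieldNormedType.Exports.
Local Open Scope classical_set_scope.
Local Open Scope ring_scope.

(** * Real integrals and Fubini for bounded kernels *)

Section Basics.
Variable R : realType.
Local Notation RT := (measurableTypeR R).
Local Notation mu := (@lebesgue_measure R).
Local Notation integ A f := (mu.-integrable A (EFin \o f)).

(** The curve is only Hölder in [t], so nothing can be differentiated along it, and the supremum
    over [t] has to be removed before orthogonality is used; hence majorants depending on [x] alone.
    The block length [w^tau] comes from the damping: it confines matters to [y w <= 1], where
    [|rho| w^tau <= C (y w)^tau] stays bounded. The price is the number of blocks: the
    arithmetic-geometric inequality with weight [j^(2bs)] leaves the series of [j^(-2bs)], finite
    when [2bs > 1], that is [2s > 1 - tau]. Orthogonality is used inside each block only; no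
    estimate couples two blocks. On the diverging side the scales are forced. Resonance at spacing
    [H] takes [t^alpha] of order [1/H], and the damping then leaves frequencies up to [t^(-gamma)],
    of order [L = H^p] with [p = gamma / alpha]: there is room for [K = L / H = H^(p-1)] teeth.
    Spreading a mass [m] over them costs [L^(2s) m^2 / K] in the squared norm, a power of [H] with
    exponent [2ps - p + 1], negative exactly when [2s < 1 - alpha / gamma]. *)

Lemma integrable_measurable (A : set RT) (f : RT -> R) :
  integ A f -> measurable_fun A f.
Proof. by case/integrableP => /measurable_EFinP. Qed.

Lemma integrable_mul_bounded (A : set RT) (f h : RT -> R) (C : R) :
  measurable A -> integ A f -> measurable_fun A h ->
  (forall x, A x -> `|h x| <= C) -> integ A (fun x => f x * h x).
Proof.
move=> mA fi mh hC.
have mf : measurable_fun A f by exact: integrable_measurable.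
apply: (@le_integrable _ _ _ _ _ mA _ _ _ _ (integrableZl mA C fi)).
- by apply/measurable_EFinP; exact: measurable_funM.
- move=> x Ax /=; rewrite lee_fin !normrM mulrC.
  by apply: ler_wpM2r => //; apply: le_trans (hC _ Ax) (ler_norm _).
Qed.

Lemma integrable_scale (A : set RT) (f : RT -> R) (c : R) :
  measurable A -> integ A f -> integ A (fun x => c * f x).
Proof.
by move=> mA fi; apply: eq_integrable (integrableZl mA c fi) => // x _.
Qed.

Lemma integrable_add (A : set RT) (f g : RT -> R) :
  measurable A -> integ A f -> integ A g -> integ A (fun x => f x + g x).
Proof.
by move=> mA fi gi; apply: eq_integrable (integrableD mA fi gi) => // x _.
Qed.

Lemma integrable_sub (A : set RT) (f g : RT -> R) :
  measurable A -> integ A f -> integ A g -> integ A (fun x => f x - g x).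
Proof.
by move=> mA fi gi; apply: eq_integrable (integrableB mA fi gi) => // x _.
Qed.

Lemma eq_integrable_real (A : set RT) (f g : RT -> R) :
  measurable A -> (forall x, A x -> f x = g x) -> integ A f -> integ A g.
Proof.
move=> mA fg; apply: eq_integrable => // x; rewrite inE => Ax /=.
by rewrite fg.
Qed.

Lemma integrable_normr (A : set RT) (f : RT -> R) :
  integ A f -> integ A (fun x => `|f x|).
Proof. exact: integrable_norm. Qed.

(** No integrability is assumed: the real integral is [fine] of a difference of two Tonelli
    integrals, each of them measurable. *)
Lemma measurable_fun_Rintegral d (T : measurableType d) (F : T * RT -> R) :
  measurable_fun setT F ->
  measurable_fun setT (fun x => Rintegral mu setT (fun y => F (x, y))).
Proof.
move=> mF; have mEF : measurable_fun setT (EFin \o F) by exact/measurable_EFinP.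
have mp := @measurable_fun_fubini_tonelli_F _ _ T _ R mu _
  (measurable_funepos mEF) (funepos_ge0 (EFin \o F)).
have mn := @measurable_fun_fubini_tonelli_F _ _ T _ R mu _
  (measurable_funeneg mEF) (funeneg_ge0 (EFin \o F)).
have -> : (fun x => Rintegral mu setT (fun y => F (x, y))) =
  fine \o ((fun x => \int[mu]_y (EFin \o F)^\+ (x, y)) \-
           (fun x => \int[mu]_y (EFin \o F)^\- (x, y)))%E.
  apply/funext => x /=; rewrite /Rintegral; congr fine.
  rewrite integralE; congr (_ - _)%E.
    by apply: eq_integral => y _; rewrite !funeposE.
  by apply: eq_integral => y _; rewrite !funenegE.
apply: measurableT_comp; first exact: fine_measurable.
exact: emeasurable_funB.
Qed.

(** A bounded kernel keeps [p(x) q(y) k(x, y)] absolutely integrable on the product, with norm at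
    most [C] times the two L^1 norms. The first conclusion is kept because it allows the lemma to be
    iterated with the inner integral absorbed into [p]. *)
Lemma fubini_kernel (A B : set RT) (p q : RT -> R) (k : RT -> RT -> R) (C : R) :
  measurable A -> measurable B -> integ A p -> integ B q ->
  measurable_fun setT (fun z : RT * RT => k z.1 z.2) ->
  (forall x y, `|k x y| <= C) ->
  integ A (fun x => p x * Rintegral mu B (fun y => q y * k x y)) /\
      Rintegral mu A (fun x => p x * Rintegral mu B (fun y => q y * k x y)) =
      Rintegral mu B (fun y => q y * Rintegral mu A (fun x => p x * k x y)).
Proof.
move=> mA mB ip iq mk kC.
pose pA := p \_ A; pose qB := q \_ B.
have ipA : integ setT pA by rewrite /pA -restrict_EFin; exact: (integrable_mkcond _ mA).1 ip.
have iqB : integ setT qB by rewrite /qB -restrict_EFin; exact: (integrable_mkcond _ mB).1 iq.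
have mpA : measurable_fun setT pA by exact: integrable_measurable.
have mqB : measurable_fun setT qB by exact: integrable_measurable.
pose f (z : RT * RT) := (pA z.1 * qB z.2 * k z.1 z.2)%:E.
have mf : measurable_fun setT f.
  apply/measurable_EFinP; apply: measurable_funM => //; apply: measurable_funM.
  - exact: measurableT_comp.
  - exact: measurableT_comp.
have mk1 x : measurable_fun setT (k x).
  by apply: (measurableT_comp mk (pair1_measurable x)).
have mk2 y : measurable_fun setT (k ^~ y).
  by apply: (measurableT_comp mk (pair2_measurable y)).
have iqk x : integ setT (fun y => qB y * k x y).
  by apply: (@integrable_mul_bounded _ _ _ C).
have ipk y : integ setT (fun x => pA x * k x y).
  by apply: (@integrable_mul_bounded _ _ _ C).
have qBE x : Rintegral mu B (fun y => q y * k x y) =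
    Rintegral mu setT (fun y => qB y * k x y).
  rewrite Rintegral_mkcond; apply: eq_Rintegral => y _.
  by rewrite /qB /patch; case: ifP => // _; rewrite mul0r.
have pAE y : Rintegral mu A (fun x => p x * k x y) =
    Rintegral mu setT (fun x => pA x * k x y).
  rewrite Rintegral_mkcond; apply: eq_Rintegral => x _.
  by rewrite /pA /patch; case: ifP => // _; rewrite mul0r.
have C0 : 0 <= C by apply: le_trans (kC 0 0).
have intf : (mu \x mu)%E.-integrable setT f.
  apply/(integrable12ltyP mu mu mf).
  pose K := fine (\int[mu]_y `|qB y|%:E)%E.
  have KE : (\int[mu]_y `|qB y|%:E)%E = K%:E.
    rewrite /K fineK//; apply: integrable_fin_num => //.
    exact: (integrable_norm iqB).
  apply: (@le_lt_trans _ _ (\int[mu]_x ((C * K)%:E * `|pA x|%:E))%E).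
    apply: ge0_le_integral => //.
    - by move=> x _; apply: integral_ge0 => y _.
    - apply: (measurable_fun_fubini_tonelli_F (abse \o f)) => //=.
      exact: measurableT_comp.
    - apply: measurable_funeM; apply/measurable_EFinP.
      exact: measurableT_comp.
    - move=> x _.
      have -> : ((C * K)%:E * `|pA x|%:E)%E =
          ((C * `|pA x|)%:E * \int[mu]_y `|qB y|%:E)%E.
        by rewrite KE -!EFinM; congr EFin; ring.
      rewrite -ge0_integralZl//; last 2 first.
      + by apply/measurable_EFinP; exact: measurableT_comp.
      + by rewrite lee_fin mulr_ge0.
      apply: ge0_le_integral => //.
      + apply/measurable_EFinP; apply: measurableT_comp => //.
        apply: measurable_funM; last exact: mk1.
        by apply: (measurable_funM (f := fun _ => pA x) (g := qB)).
      + apply: measurable_funeM; apply/measurable_EFinP; exact: measurableT_comp.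
      + move=> y _; rewrite /f /= lee_fin !normrM.
        rewrite [leRHS](_ : _ = `|pA x| * `|qB y| * C); last by ring.
        by apply: ler_wpM2l; rewrite // mulr_ge0.
  rewrite ge0_integralZl//; last 2 first.
  - by apply/measurable_EFinP; exact: measurableT_comp.
  - by rewrite lee_fin mulr_ge0// /K fine_ge0// integral_ge0.
  rewrite lte_mul_pinfty//.
    by rewrite lee_fin mulr_ge0// /K fine_ge0// integral_ge0.
  by case/integrableP: ipA.
have FE x : fubini_F mu f x = (pA x * Rintegral mu setT (fun y => qB y * k x y))%:E.
  rewrite /fubini_F /f /=.
  under eq_integral do rewrite -mulrA EFinM.
  rewrite integralZl//; last exact: iqk.
  by rewrite EFinM /Rintegral fineK// integrable_fin_num//; exact: iqk.
have GE y : fubini_G mu f y = (qB y * Rintegral mu setT (fun x => pA x * k x y))%:E.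
  rewrite /fubini_G /f /=.
  under eq_integral do rewrite (mulrC (pA _)) -mulrA EFinM.
  rewrite integralZl//; last exact: ipk.
  by rewrite EFinM /Rintegral fineK// integrable_fin_num//; exact: ipk.
have iF := integrable_fubini_F intf;
have FAE : (fun x => p x * Rintegral mu B (fun y => q y * k x y)) \_ A =
  (fun x => pA x * Rintegral mu setT (fun y => qB y * k x y)).
  apply/funext => x; rewrite /pA /patch; case: ifP => _; last by rewrite mul0r.
  by rewrite qBE.
have GBE : (fun y => q y * Rintegral mu A (fun x => p x * k x y)) \_ B =
  (fun y => qB y * Rintegral mu setT (fun x => pA x * k x y)).
  apply/funext => y; rewrite /qB /patch; case: ifP => _; last by rewrite mul0r.
  by rewrite pAE.
split.
- apply/integrable_mkcond => //; rewrite restrict_EFin FAE.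
  by apply: eq_integrable iF => // x _; rewrite FE.
- rewrite Rintegral_mkcond FAE [RHS]Rintegral_mkcond GBE /Rintegral.
  under eq_integral do rewrite -FE.
  under [in RHS]eq_integral do rewrite -GE.
  by rewrite integral12_prod_meas1// integral21_prod_meas1.
Qed.

End Basics.

(** * Abel summation *)

Section Calculus.
Variable R : realType.
Local Notation RT := (measurableTypeR R).
Local Notation mu := (@lebesgue_measure R).
Local Notation integ A f := (mu.-integrable A (EFin \o f)).
Implicit Types (f g m : R -> R) (x a b c : R).

Lemma is_derive_mul f g x a b : is_derive x 1 f a -> is_derive x 1 g b ->
  is_derive x 1 (fun y => f y * g y) (a * g x + f x * b).
Proof.
move=> fa gb; have := is_deriveM fa gb => /is_derive_eq; apply.
by rewrite /GRing.scale /= addrC (mulrC (g x)).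
Qed.

Lemma is_derive_add f g x a b : is_derive x 1 f a -> is_derive x 1 g b ->
  is_derive x 1 (fun y => f y + g y) (a + b).
Proof. by move=> fa gb; exact: is_deriveD. Qed.

Lemma is_derive_opp f x a : is_derive x 1 f a ->
  is_derive x 1 (fun y => - f y) (- a).
Proof. by move=> fa; exact: is_deriveN. Qed.

Lemma is_derive_comp f g x a b : is_derive (g x) 1 f a -> is_derive x 1 g b ->
  is_derive x 1 (fun y => f (g y)) (a * b).
Proof. exact: is_derive1_comp. Qed.

Lemma is_derive_affine x c a : is_derive x 1 (fun y => y * c + a) c.
Proof.
have H := is_derive_add (is_derive_mul (is_derive_id x 1) (is_derive_cst c x 1))
  (is_derive_cst a x 1).
by apply: (is_derive_eq H); rewrite mulr0 !addr0 mul1r.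
Qed.

Lemma is_derive_cos_affine x c a :
  is_derive x 1 (fun y => cos (y * c + a)) (- sin (x * c + a) * c).
Proof. exact: (is_derive_comp (is_derive_cos _) (is_derive_affine x c a)). Qed.

Lemma is_derive_sin_affine x c a :
  is_derive x 1 (fun y => sin (y * c + a)) (cos (x * c + a) * c).
Proof. exact: (is_derive_comp (is_derive_sin _) (is_derive_affine x c a)). Qed.

Lemma is_derive_expR_affine x c a :
  is_derive x 1 (fun y => expR (y * c + a)) (expR (x * c + a) * c).
Proof. exact: (is_derive_comp (is_derive_expR _) (is_derive_affine x c a)). Qed.

Lemma is_derive_continuous f (df : R -> R) :
  (forall x, is_derive x 1 f (df x)) -> continuous f.
Proof.
move=> fdf x; apply: differentiable_continuous; apply/derivable1_diffP.
exact: (@ex_derive _ _ _ _ _ _ _ (fdf x)).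
Qed.

Lemma continuous_mul f g :
  continuous f -> continuous g -> continuous (fun x => f x * g x).
Proof. by move=> cf cg x; apply: continuousM; [exact: cf|exact: cg]. Qed.

Lemma continuous_add f g :
  continuous f -> continuous g -> continuous (fun x => f x + g x).
Proof. by move=> cf cg x; apply: continuousD; [exact: cf|exact: cg]. Qed.

Lemma continuous_sub f g :
  continuous f -> continuous g -> continuous (fun x => f x - g x).
Proof. by move=> cf cg x; apply: continuousB; [exact: cf|exact: cg]. Qed.

Lemma continuous_const (c : R) : continuous (fun _ : R => c).
Proof. exact: cst_continuous. Qed.

Lemma continuous_inv f :
  (forall x, f x != 0) -> continuous f -> continuous (fun x => (f x)^-1).
Proof. by move=> f0 cf x; apply: cvgV; [exact: f0|exact: cf]. Qed.

Lemma continuous_affine c a : continuous (fun x : R => x * c + a).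
Proof. exact: is_derive_continuous (fun x => is_derive_affine x c a). Qed.

Lemma continuous_inv1sqr c a : continuous (fun x : R => (1 + (x * c + a) ^+ 2)^-1).
Proof.
apply: continuous_inv.
  by move=> x; have := sqr_ge0 (x * c + a); move=> H; apply/eqP; lra.
apply: continuous_add; first exact: continuous_const.
by apply: continuous_mul; exact: continuous_affine.
Qed.

Lemma integrable_continuous_itv f a b : continuous f -> integ `[a, b] f.
Proof.
move=> cf; apply: continuous_compact_integrable; first exact: segment_compact.
exact: continuous_subspaceT.
Qed.

Lemma Rintegral_FTC2 (F f : R -> R) a b : a <= b ->
  (forall x, is_derive x 1 F (f x)) -> continuous f ->
  Rintegral mu `[a, b] f = F b - F a.
Proof.
move=> ab dF cf; move: ab; rewrite le_eqVlt => /predU1P[->|ab].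
  by rewrite set_itv1 Rintegral_set1 subrr.
rewrite /Rintegral (@continuous_FTC2 _ f F) //.
- exact: continuous_subspaceT.
- have cF := is_derive_continuous dF; split.
  + by move=> x _; exact: (@ex_derive _ _ _ _ _ _ _ (dF x)).
  + exact/cvg_at_right_filter/cF.
  + exact/cvg_at_left_filter/cF.
- move=> x _; rewrite derive1E; exact: derive_val.
Qed.

Lemma Rintegral_cst_itv a b c : a <= b -> Rintegral mu `[a, b] (fun=> c) = c * (b - a).
Proof.
move=> ab; have E : lebesgue_measure (`[a, b]%classic : set R) = (b - a)%:E.
  rewrite lebesgue_measure_itv/= lte_fin; case: ltP => [//|ba].
  by rewrite (@le_anti _ _ a b) ?ab ?ba// subrr.
rewrite Rintegral_cst; last exact: measurable_itv.
by congr (_ * _); rewrite (_ : b - a = fine (b - a)%:E)// -E.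
Qed.

Lemma le_Rintegral_subset (A B : set RT) (f : RT -> R) :
  measurable A -> measurable B -> A `<=` B -> integ B f ->
  (forall x, B x -> 0 <= f x) -> Rintegral mu A f <= Rintegral mu B f.
Proof.
move=> mA mB AB fi f0; rewrite /Rintegral fine_le//.
- by apply: integrable_fin_num => //; exact: integrableS fi.
- exact: integrable_fin_num.
- by apply: ge0_subset_integral => //; case/integrableP: fi.
Qed.

Lemma integrable_mul_continuous (h : RT -> R) m a b : integ `[a, b] h ->
  continuous m -> integ `[a, b] (fun x => h x * m x).
Proof.
move=> hi cm; have [M [_ HM]] : bounded_set (m @` `[a, b]).
  apply: compact_bounded; apply: continuous_compact; last exact: segment_compact.
  exact: continuous_subspaceT.
apply: (integrable_mul_bounded (C := M + 1)) => //.
- by apply: measurable_funTS; exact: continuous_measurable_fun.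
- by move=> x xE; apply: (HM (M + 1)); rewrite ?ltrDl//; exists x.
Qed.

Lemma measurable_ler_indicator :
  measurable_fun setT (fun z : RT * RT => if z.1 <= z.2 then 1 else 0 : R).
Proof.
apply: measurable_fun_ifT => //; apply: measurable_fun_ler.
- exact: measurable_fst.
- exact: measurable_snd.
Qed.

Lemma measurable_ger_indicator :
  measurable_fun setT (fun z : RT * RT => if z.2 <= z.1 then 1 else 0 : R).
Proof.
apply: measurable_fun_ifT => //; apply: measurable_fun_ler.
- exact: measurable_snd.
- exact: measurable_fst.
Qed.

Lemma ler_indicator_bound (x y : R) : `|if x <= y then 1 else 0 : R| <= 1.
Proof. by case: ifP; rewrite ?normr1 ?normr0. Qed.

(* Abel summation: [h] is only integrable, so this is Fubini on the triangle. *)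
Lemma abel_bound (h : RT -> R) (m dm : R -> R) a b (A A' : R) :
  a <= b -> integ `[a, b] h -> (forall x, is_derive x 1 m (dm x)) -> continuous dm ->
  `|m b| <= A -> (forall y, y \in `[a, b] -> `|dm y| <= A') ->
  `|Rintegral mu `[a, b] (fun x => h x * m x)| <=
  A * `|Rintegral mu `[a, b] h| +
  A' * Rintegral mu `[a, b]
    (fun y => `|Rintegral mu `[a, b] (fun x => h x * if x <= y then 1 else 0)|).
Proof.
move=> ab hi dmm cdm mbA dmA.
have mE : measurable (`[a, b]%classic : set RT) by exact: measurable_itv.
have dmi : integ `[a, b] dm by exact: integrable_continuous_itv.
have mi : integ `[a, b] (fun x => h x * m x).
  exact/integrable_mul_continuous/(is_derive_continuous dmm).
pose k (x y : RT) : R := if x <= y then 1 else 0.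
have [_ fub] := fubini_kernel mE mE hi dmi measurable_ler_indicator ler_indicator_bound.
have [iH _] := fubini_kernel (k := fun y x => k x y) mE mE
  (integrable_continuous_itv a b (@cst_continuous R R 1)) hi
  measurable_ger_indicator (fun y x => ler_indicator_bound x y).
have inner x : x \in `[a, b] ->
    Rintegral mu `[a, b] (fun y => dm y * k x y) = m b - m x.
  move=> xE; have [ax xb] : a <= x /\ x <= b by move: xE; rewrite in_itv/= => /andP[].
  rewrite -(Rintegral_FTC2 xb dmm cdm).
  transitivity (Rintegral mu `[a, b] (dm \_ `[x, b])).
    apply: eq_Rintegral => y; rewrite inE /= in_itv /= => /andP[ay yb].
    rewrite /k; case: ifPn => xy.
      by rewrite mem_set ?mulr1//= in_itv/= xy.
    by rewrite memNset ?mulr0//= in_itv/= (negbTE xy).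
  rewrite -Rintegral_mkcondr; congr (Rintegral _ _ _).
  apply/seteqP; split => y /=; rewrite !in_itv/=; first by case.
  by move=> /andP[xy yb]; rewrite xy yb (le_trans ax xy).
pose H y := Rintegral mu `[a, b] (fun x => h x * k x y).
have iH1 : integ `[a, b] H.
  by apply: eq_integrable iH => // y _; rewrite /= mul1r.
have idH : integ `[a, b] (fun y => dm y * H y).
  have -> : (fun y => dm y * H y) = (fun y => H y * dm y).
    by apply/funext => y; rewrite mulrC.
  exact: integrable_mul_continuous.
(* Here [m x] has been replaced by [m b] minus the integral of [dm] over [[x, b]]; Fubini turns the
   second part into [dm] against the truncated integrals [H]. *)
have -> : Rintegral mu `[a, b] (fun x => h x * m x) =
    m b * Rintegral mu `[a, b] h - Rintegral mu `[a, b] (fun y => dm y * H y).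
  rewrite -fub -RintegralZl//.
  rewrite -RintegralB//; last 2 first.
  - exact: integrable_scale.
  - apply: (eq_integrable_real (f := fun x => m b * h x - h x * m x)) => //.
      by move=> x xE; rewrite inner//; ring.
    by apply: integrable_sub => //; exact: integrable_scale.
  apply: eq_Rintegral => x; rewrite inE => xE; rewrite inner//; ring.
apply: le_trans (ler_normB _ _) _; rewrite normrM; apply: lerD; first exact: ler_wpM2r.
apply: le_trans (le_normr_Rintegral _ _) _ => //.
rewrite -RintegralZl//; last exact: integrable_normr iH1.
apply: le_Rintegral => //.
- exact: integrable_normr idH.
- apply: integrable_scale => //; exact: integrable_normr iH1.
- by move=> y yE; rewrite normrM; apply: ler_wpM2r => //; exact: dmA.
Qed.

End Calculus.

(** * A Bessel inequality *)

Section Bessel.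
Variable R : realType.
Local Notation RT := (measurableTypeR R).
Local Notation mu := (@lebesgue_measure R).
Local Notation integ A f := (mu.-integrable A (EFin \o f)).
Implicit Types (x a b c L v phi : R).

(** The summand 0 gives the argument the affine shape of the derivative lemmas. *)
Definition raised_cosine L x : R := 1 + cos (x * L^-1 + 0).

Lemma raised_cosine_ge0 L x : 0 <= raised_cosine L x.
Proof. by have := cos_max (x * L^-1 + 0); rewrite /raised_cosine ler_norml; lra. Qed.

Lemma continuous_cos_affine v phi : continuous (fun x : R => cos (x * v + phi)).
Proof. exact: is_derive_continuous (fun x => is_derive_cos_affine x v phi). Qed.

Lemma continuous_sin_affine v phi : continuous (fun x : R => sin (x * v + phi)).
Proof. exact: is_derive_continuous (fun x => is_derive_sin_affine x v phi). Qed.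

Lemma continuous_raised_cosine L : continuous (raised_cosine L).
Proof.
by move=> x; apply: continuousD; [exact: cst_continuous|exact: continuous_cos_affine].
Qed.

(* Two integrations by parts: the weight vanishes to second order at the ends. *)
Lemma raised_cosine_transform_bound L v phi : 1 <= L ->
  `|Rintegral mu `[- (pi * L), pi * L] (fun x => raised_cosine L x * cos (x * v + phi))|
  <= 6 * pi * L * (1 + v ^+ 2)^-1.
Proof.
move=> L1; have L0 : 0 < L by lra.
have pi0 : 0 < pi :> R by exact: pi_gt0.
have piL : - (pi * L) <= pi * L by have := mulr_gt0 pi0 L0; lra.
set I := Rintegral _ _ _.
have mE : measurable (`[- (pi * L), pi * L]%classic : set RT) by exact: measurable_itv.
have cW : continuous (fun x => raised_cosine L x * cos (x * v + phi)).
  by move=> x; apply: continuousM; [exact: continuous_raised_cosine|exact: continuous_cos_affine].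
have cC : continuous (fun x => cos (x * L^-1 + 0) * cos (x * v + phi)).
  by move=> x; apply: continuousM; exact: continuous_cos_affine.
have iW := integrable_continuous_itv (- (pi * L)) (pi * L) cW.
have iC := integrable_continuous_itv (- (pi * L)) (pi * L) cC.
have I1 : `|I| <= 4 * pi * L.
  apply: le_trans (le_normr_Rintegral mE iW) _.
  apply: (@le_trans _ _ (Rintegral mu `[- (pi * L), pi * L] (fun=> 2))); last first.
    by rewrite Rintegral_cst_itv//; lra.
  apply: le_Rintegral => //; first exact: integrable_normr iW.
  - exact: integrable_continuous_itv (@cst_continuous _ _ _).
  - move=> x _; rewrite normrM (ger0_norm (raised_cosine_ge0 _ _)).
    rewrite -[2]mulr1; apply: ler_pM; rewrite ?raised_cosine_ge0 ?cos_max//.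
    by have := cos_max (x * L^-1 + 0); rewrite /raised_cosine ler_norml; lra.
(* With [W] the weight, [F = v W sin + W' cos]: the cross terms cancel and [F' = (v^2 W + W'') cos].
   Since [W] and [W'] vanish at both ends, [v^2 I] is the integral of
   [L^(-2) cos(x/L) cos(xv + phi)]. The constant 6 of the statement is 4 from the trivial bound [I1]
   plus 2 from this one. *)
pose F x := v * (raised_cosine L x * sin (x * v + phi)) +
  (- sin (x * L^-1 + 0) * L^-1) * cos (x * v + phi).
pose f x := (v ^+ 2 * raised_cosine L x - L^-1 ^+ 2 * cos (x * L^-1 + 0)) * cos (x * v + phi).
have dF x : is_derive x 1 F (f x).
  have dW := is_derive_add (is_derive_cst (1 : R) x 1) (is_derive_cos_affine x L^-1 0).
  have dS := is_derive_sin_affine x v phi.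
  have dC := is_derive_cos_affine x v phi.
  have dS' := is_derive_mul (is_derive_opp (is_derive_sin_affine x L^-1 0)) (is_derive_cst L^-1 x 1).
  have := is_derive_add (is_derive_mul (is_derive_cst v x 1) (is_derive_mul dW dS))
    (is_derive_mul dS' dC).
  move/is_derive_eq; apply; rewrite /f /raised_cosine /cst /=; ring.
have cf : continuous f.
  apply: continuous_mul; last exact: continuous_cos_affine.
  apply: continuous_sub; apply: continuous_mul; try exact: continuous_const.
  - exact: continuous_raised_cosine.
  - exact: continuous_cos_affine.
have Fend x : x = pi * L \/ x = - (pi * L) -> F x = 0.
  have LL : pi * L * L^-1 = pi by rewrite mulfK// gt_eqF.
  rewrite /F /raised_cosine; case=> ->; rewrite ?(mulNr (pi * L)) LL addr0.
    by rewrite cospi sinpi; ring.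
  by rewrite cosN sinN cospi sinpi; ring.
have := Rintegral_FTC2 piL dF cf.
rewrite (Fend (pi * L)) ?(Fend (- (pi * L))) ?subrr; [|by right|by left].
have -> : Rintegral mu `[- (pi * L), pi * L] f = v ^+ 2 * I -
    L^-1 ^+ 2 * Rintegral mu `[- (pi * L), pi * L] (fun x => cos (x * L^-1 + 0) * cos (x * v + phi)).
  rewrite -!RintegralZl// -RintegralB//; try exact: integrable_scale.
  by apply: eq_Rintegral => x _; rewrite /f; ring.
set J := Rintegral _ _ _ => /eqP; rewrite subr_eq0 => /eqP vI.
have J1 : `|J| <= 2 * pi * L.
  apply: le_trans (le_normr_Rintegral mE iC) _.
  apply: (@le_trans _ _ (Rintegral mu `[- (pi * L), pi * L] (fun=> 1))); last first.
    by rewrite Rintegral_cst_itv//; lra.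
  apply: le_Rintegral => //; first exact: integrable_normr iC.
  - exact: integrable_continuous_itv (@cst_continuous _ _ _).
  - move=> x _; rewrite normrM -[1]mulr1; apply: ler_pM; rewrite ?cos_max//.
have vI2 : v ^+ 2 * `|I| <= 2 * pi * L.
  rewrite -(ger0_norm (sqr_ge0 v)) -normrM vI normrM.
  have Li : `|L^-1 ^+ 2| <= 1.
    by rewrite ger0_norm ?sqr_ge0// exprn_ile1 ?invr_ge0 ?invf_le1 ?(ltW L0).
  by apply: le_trans J1; rewrite -[leRHS]mul1r; apply: ler_wpM2r.
have v1 : 0 < 1 + v ^+ 2 by have := sqr_ge0 v; lra.
rewrite ler_pdivlMr// mulrC mulrDl mul1r; lra.
Qed.

Lemma Rintegral_inv1sqr_le a b c (e : R) : a <= b -> e = 1 \/ e = -1 ->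
  Rintegral mu `[a, b] (fun y => (1 + (y * e + c) ^+ 2)^-1) <= pi.
Proof.
move=> ab ee; have e0 : e != 0 by case: ee => ->; rewrite ?oppr_eq0 oner_eq0.
have e2 : e * e = 1 by case: ee => ->; rewrite ?mulrNN mulr1.
pose F y := e * atan (y * e + c).
have dF (y : R) : is_derive y 1 F ((1 + (y * e + c) ^+ 2)^-1).
  have := is_derive_mul (is_derive_cst e y 1)
    (is_derive_comp (is_derive1_atan _) (is_derive_affine y e c)).
  by move/is_derive_eq; apply; rewrite mul0r add0r mulrCA e2 mulr1.
rewrite (Rintegral_FTC2 ab dF).
  rewrite /F -mulrBr; apply: le_trans (ler_norm _) _; rewrite normrM.
  have -> : `|e| = 1 by case: ee => ->; rewrite ?normrN normr1.
  rewrite mul1r ler_norml.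
  have := atan_gtNpi2 (b * e + c); have := atan_ltpi2 (b * e + c).
  have := atan_gtNpi2 (a * e + c); have := atan_ltpi2 (a * e + c); lra.
exact: continuous_inv1sqr.
Qed.

Lemma integrable_sqr (A : set RT) (g : RT -> R) : measurable A -> (mu A < +oo)%E ->
  measurable_fun A g -> integ A (fun x => g x ^+ 2) -> integ A g.
Proof.
move=> mA fA mg ig.
have i1 : integ A (fun=> 1).
  apply: measurable_bounded_integrable => //.
  by exists 1; split => // M M1 x _ /=; rewrite normr1 ltW.
apply: (le_integrable mA _ _ (integrable_add mA i1 ig)); first exact/measurable_EFinP.
move=> x _ /=; rewrite lee_fin -[`|g x|]mulr1.
rewrite (ger0_norm (_ : 0 <= 1 + g x ^+ 2)) ?addr_ge0 ?sqr_ge0//.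
rewrite mulr1 -(real_normK (num_real (g x))); have := normr_ge0 (g x).
set z := `|g x| => z0; have := sqr_ge0 (z - 1); nra.
Qed.

Lemma mu_itv_lty a b : (mu `[a, b] < +oo)%E.
Proof.
have : (lebesgue_measure (`[a, b]%classic : set R) < +oo)%E.
  by rewrite lebesgue_measure_itv /=; case: ifP => // _; rewrite -EFinD ltry.
by [].
Qed.

Lemma measurable_cos_phase phi :
  measurable_fun setT (fun z : RT * RT => cos (z.1 * z.2 + phi)).
Proof.
apply: (measurableT_comp (f := cos : R -> R)).
  exact: continuous_measurable_fun (@continuous_cos R).
apply: measurable_funD => //; apply: measurable_funM.
- exact: measurable_fst.
- exact: measurable_snd.
Qed.

Lemma measurable_cos_phase_swap phi :
  measurable_fun setT (fun z : RT * RT => cos (z.2 * z.1 + phi)).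
Proof.
have -> : (fun z : RT * RT => cos (z.2 * z.1 + phi)) = (fun z => cos (z.1 * z.2 + phi)).
  by apply/funext => z; rewrite mulrC.
exact: measurable_cos_phase.
Qed.

Definition cos_transform (g : RT -> R) a b phi x : R :=
  Rintegral mu `[a, b] (fun y => g y * cos (x * y + phi)).

Lemma cos_mul_cos a b : cos a * cos b = 2^-1 * (cos (a - b) + cos (a + b)).
Proof. by rewrite cosB cosD; field. Qed.

(** By [|g z g y| <= (g z ^ 2 + g y ^ 2) / 2] and the symmetry of [K], both halves reduce to the row
    integrals of [K]. The set has finite measure and [K] is bounded, which supplies the
    integrability that Fubini asks for. *)
Lemma schur_bound (E : set RT) (g : RT -> R) (K kap : RT -> RT -> R) (C B : R) :
  measurable E -> integ E (fun=> 1) -> integ E g -> integ E (fun y => g y ^+ 2) ->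
  (forall z y, K z y = K y z) -> (forall z y, `|K z y| <= C) ->
  (forall z y, 0 <= K z y) -> measurable_fun setT (fun z : RT * RT => K z.1 z.2) ->
  (forall z, Rintegral mu E (K z) <= B) ->
  (forall z y, `|kap z y| <= K z y) ->
  (forall z, integ E (fun y => g y * kap z y)) ->
  integ E (fun z => g z * Rintegral mu E (fun y => g y * kap z y)) ->
  Rintegral mu E (fun z => g z * Rintegral mu E (fun y => g y * kap z y)) <=
  B * Rintegral mu E (fun y => g y ^+ 2).
Proof.
move=> mE i1 ig ig2 Ksym KC K0 mK IK kapK igk igH.
have mK1 z : measurable_fun E (K z).
  by apply: measurable_funTS; apply: (measurableT_comp mK (pair1_measurable z)).
pose S z := Rintegral mu E (fun y => g y ^+ 2 * K z y).
have iS : integ E S.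
  have [H _] := fubini_kernel mE mE i1 ig2 mK KC.
  by apply: (eq_integrable_real mE _ H) => z _; rewrite mul1r.
have ig2K z : integ E (fun y => g y ^+ 2 * K z y).
  exact: (integrable_mul_bounded mE ig2 (mK1 z) (fun y _ => KC z y)).
have iK z : integ E (K z).
  apply: (eq_integrable_real mE _ (integrable_mul_bounded mE i1 (mK1 z) (fun y _ => KC z y))).
  by move=> y _; rewrite mul1r.
have igK z : integ E (fun y => `|g y| * K z y).
  exact: (integrable_mul_bounded mE (integrable_normr ig) (mK1 z) (fun y _ => KC z y)).
have SE : Rintegral mu E S <= B * Rintegral mu E (fun y => g y ^+ 2).
  have [_ fubS] := fubini_kernel mE mE i1 ig2 mK KC.
  have -> : Rintegral mu E S = Rintegral mu E (fun y => g y ^+ 2 * Rintegral mu E (K y)).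
    transitivity (Rintegral mu E (fun z => 1 * S z)).
      by apply: eq_Rintegral => z _; rewrite mul1r.
    rewrite fubS; apply: eq_Rintegral => y _; congr (_ * _).
    by apply: eq_Rintegral => z _; rewrite mul1r Ksym.
  rewrite -(RintegralZl _ mE ig2).
  apply: (le_Rintegral mE).
  - have [iK1 _] := fubini_kernel mE mE ig2 i1 mK KC.
    apply: (eq_integrable_real mE _ iK1) => y _; congr (_ * _).
    by apply: eq_Rintegral => z _; rewrite mul1r.
  - exact: integrable_scale.
  - by move=> y _; rewrite mulrC; apply: ler_wpM2r; [exact: sqr_ge0|exact: IK].
apply: le_trans (ler_norm _) _; apply: le_trans (le_normr_Rintegral mE igH) _.
pose G z := 2^-1 * B * g z ^+ 2 + 2^-1 * S z.
apply: (@le_trans _ _ (Rintegral mu E G)).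
  apply: (le_Rintegral mE (integrable_normr igH)).
    by apply: (integrable_add mE); apply: (integrable_scale _ mE).
  move=> z _; rewrite normrM.
  apply: (@le_trans _ _ (`|g z| * Rintegral mu E (fun y => `|g y| * K z y))).
    apply: ler_wpM2l => //.
    apply: le_trans (le_normr_Rintegral mE (igk z)) _.
    apply: (le_Rintegral mE (integrable_normr (igk z)) (igK z)) => y _.
    by rewrite normrM; apply: ler_wpM2l.
  rewrite -(RintegralZl _ mE (igK z)).
  have i2 : integ E (fun y => 2^-1 * g z ^+ 2 * K z y) by exact: integrable_scale.
  have i3 : integ E (fun y => 2^-1 * (g y ^+ 2 * K z y)) by exact: integrable_scale.
  apply: (@le_trans _ _ (Rintegral mu E (fun y => 2^-1 * g z ^+ 2 * K z y + 2^-1 * (g y ^+ 2 * K z y)))).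
    apply: (le_Rintegral mE (integrable_scale _ mE (igK z)) (integrable_add mE i2 i3)).
    move=> y _; rewrite mulrA [leRHS](_ : _ = 2^-1 * (g z ^+ 2 + g y ^+ 2) * K z y); last by ring.
    apply: ler_wpM2r => //.
    rewrite -(real_normK (num_real (g z))) -(real_normK (num_real (g y))).
    move: (`|g z|) (`|g y|) => u w; clear.
    by have := sqr_ge0 (u - w); nra.
  rewrite (RintegralD mE i2 i3) (RintegralZl _ mE (iK z)) (RintegralZl _ mE (ig2K z)) /G.
  apply: lerD => //; rewrite mulrAC; apply: ler_wpM2r; first exact: sqr_ge0.
  by apply: ler_wpM2l => //; rewrite invr_ge0.
have i4 := integrable_scale (2^-1 * B) mE ig2.
have i5 := integrable_scale 2^-1 mE iS.
rewrite /G (RintegralD mE i4 i5) (RintegralZl _ mE ig2) (RintegralZl _ mE iS).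
move: SE; set I1 := Rintegral _ _ S; set I2 := Rintegral _ _ _; clear; lra.
Qed.

(** A product of cosines is half the sum of the cosines of the difference and of the sum of the
    angles; the two terms bound the corresponding transforms of the weight, and 3 is half of the
    constant 6. *)
Definition bessel_kernel L (z y : RT) : R :=
  3 * pi * L * ((1 + (y * -1 + z) ^+ 2)^-1 + (1 + (y * 1 + z) ^+ 2)^-1).

Lemma inv1sqr_itv v : 0 <= (1 + v ^+ 2)^-1 <= 1.
Proof.
have v0 := sqr_ge0 v; rewrite invr_ge0 invf_le1; last by lra.
by apply/andP; split; lra.
Qed.

Lemma bessel_kernel_ge0 L z y : 0 <= L -> 0 <= bessel_kernel L z y.
Proof.
move=> L0; have pi0 : 0 < pi :> R by exact: pi_gt0.
apply: mulr_ge0; first by rewrite mulr_ge0//; lra.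
by have := inv1sqr_itv (y * -1 + z); have := inv1sqr_itv (y * 1 + z); lra.
Qed.

Lemma bessel_kernel_sym L z y : bessel_kernel L z y = bessel_kernel L y z.
Proof. by rewrite /bessel_kernel; congr (_ * (_^-1 + _^-1)); ring. Qed.

Lemma bessel_kernel_le L z y : 0 <= L -> `|bessel_kernel L z y| <= 6 * pi * L.
Proof.
move=> L0; have pi0 : 0 < pi :> R by exact: pi_gt0.
rewrite ger0_norm ?bessel_kernel_ge0// /bessel_kernel.
have := inv1sqr_itv (y * -1 + z); have := inv1sqr_itv (y * 1 + z).
move: (_^-1) (_^-1) => u w /andP[u0 u1] /andP[w0 w1].
have -> : 6 * pi * L = 3 * pi * L * 2 by ring.
by apply: ler_wpM2l; [rewrite mulr_ge0//; lra|lra].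
Qed.

Lemma measurable_bessel_kernel L :
  measurable_fun setT (fun z : RT * RT => bessel_kernel L z.1 z.2).
Proof.
have mi (e : R) : measurable_fun setT (fun z : RT * RT => (1 + (z.2 * e + z.1) ^+ 2)^-1 : R).
  apply: (measurableT_comp (f := (fun u : R => (1 + u ^+ 2)^-1))).
    apply: continuous_measurable_fun.
    have -> : (fun u : R => (1 + u ^+ 2)^-1) = (fun u => (1 + (u * 1 + 0) ^+ 2)^-1).
      by apply/funext => u; rewrite mulr1 addr0.
    exact: continuous_inv1sqr.
  apply: measurable_funD; last exact: measurable_fst.
  by apply: measurable_funM => //; exact: measurable_snd.
by apply: measurable_funM => //; apply: measurable_funD; exact: mi.
Qed.

Lemma Rintegral_bessel_kernel L z a b : 0 <= L -> a <= b ->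
  Rintegral mu `[a, b] (bessel_kernel L z) <= 6 * pi ^+ 2 * L.
Proof.
move=> L0 ab; have pi0 : 0 < pi :> R by exact: pi_gt0.
have mE : measurable (`[a, b]%classic : set RT) by exact: measurable_itv.
have ii e := integrable_continuous_itv a b (@continuous_inv1sqr R e z).
rewrite /bessel_kernel (RintegralZl _ mE (integrable_add mE (ii _) (ii _))).
rewrite (RintegralD mE (ii _) (ii _)).
have -> : 6 * pi ^+ 2 * L = 3 * pi * L * (pi + pi) by ring.
apply: ler_wpM2l; first by rewrite mulr_ge0//; lra.
by apply: lerD; apply: (Rintegral_inv1sqr_le _ ab); [right|left].
Qed.

Lemma raised_cosine_product_bound L z y phi : 1 <= L ->
  `|Rintegral mu `[- (pi * L), pi * L]
     (fun x => raised_cosine L x * cos (x * z + phi) * cos (x * y + phi))| <=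
  bessel_kernel L z y.
Proof.
move=> L1; pose D := `[- (pi * L), pi * L]%classic : set RT.
have mD : measurable D by exact: measurable_itv.
have c1 (v p : R) : integ D (fun x => raised_cosine L x * cos (x * v + p)).
  apply: integrable_continuous_itv; apply: continuous_mul.
  - exact: continuous_raised_cosine.
  - exact: continuous_cos_affine.
set I1 := Rintegral mu D (fun x => raised_cosine L x * cos (x * (y * -1 + z) + 0)).
set I2 := Rintegral mu D (fun x => raised_cosine L x * cos (x * (y * 1 + z) + 2 * phi)).
have -> : Rintegral mu D
    (fun x => raised_cosine L x * cos (x * z + phi) * cos (x * y + phi)) = 2^-1 * (I1 + I2).
  rewrite -(RintegralD mD (c1 _ _) (c1 _ _)) -RintegralZl//; last exact: integrable_add.
  apply: eq_Rintegral => x _.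
  have -> : x * (y * -1 + z) + 0 = (x * z + phi) - (x * y + phi) by ring.
  have -> : x * (y * 1 + z) + 2 * phi = (x * z + phi) + (x * y + phi) by ring.
  by rewrite -mulrA cos_mul_cos mulrCA mulrDr.
have := raised_cosine_transform_bound (y * -1 + z) 0 L1.
have := raised_cosine_transform_bound (y * 1 + z) (2 * phi) L1.
rewrite -/I1 -/I2 /bessel_kernel normrM (ger0_norm (_ : 0 <= 2^-1)) ?invr_ge0//.
have := ler_normD I1 I2; move: (`|I1 + I2|) (`|I1|) (`|I2|) => u v w.
move: (_^-1) (_^-1) => p q; clear; nra.
Qed.

(** Expanding the square by Fubini gives a quadratic form in [g] whose kernel is the weighted
    integral of a product of two cosines, to which the Schur test applies. The constant does not
    depend on [[a, b]], so the same bound serves blocks of all lengths and positions. *)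
Lemma bessel_raised_cosine (g : RT -> R) a b L phi : 1 <= L -> a <= b ->
  measurable_fun `[a, b] g -> integ `[a, b] (fun y => g y ^+ 2) ->
  let D := `[- (pi * L), pi * L]%classic : set RT in
  integ D (fun x => raised_cosine L x * cos_transform g a b phi x ^+ 2) /\
  Rintegral mu D (fun x => raised_cosine L x * cos_transform g a b phi x ^+ 2) <=
  6 * pi ^+ 2 * L * Rintegral mu `[a, b] (fun y => g y ^+ 2).
Proof.
move=> L1 ab mg ig2 D; set T := cos_transform g a b phi; set W := raised_cosine L.
pose E := `[a, b]%classic : set RT.
have mD : measurable D by exact: measurable_itv.
have mE : measurable E by exact: measurable_itv.
have ig : integ E g := integrable_sqr mE (mu_itv_lty a b) mg ig2.
have L0 : 0 <= L by apply: le_trans L1.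
have mk := measurable_cos_phase phi; have mk' := measurable_cos_phase_swap phi.
have kC (x y : RT) : `|cos (x * y + phi)| <= 1 by exact: cos_max.
have kC' (x y : RT) : `|cos (y * x + phi)| <= 1 by exact: cos_max.
have iW : integ D W by apply: integrable_continuous_itv; exact: continuous_raised_cosine.
have [iWT _] := fubini_kernel mD mE iW ig mk kC.
have [iWTT fub1] := fubini_kernel mD mE iWT ig mk kC.
have [igH _] := fubini_kernel mE mD ig iWT mk' kC'.
pose Wk z x := W x * cos (x * z + phi).
have iWk z : integ D (Wk z).
  apply: integrable_continuous_itv; apply: continuous_mul.
  - exact: continuous_raised_cosine.
  - exact: continuous_cos_affine.
pose kap z y := Rintegral mu D (fun x => Wk z x * cos (x * y + phi)).
have igk z := (fubini_kernel mE mD ig (iWk z) mk' kC').1.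
have HE z : Rintegral mu D (fun x => W x * T x * cos (x * z + phi)) =
      Rintegral mu E (fun y => g y * kap z y).
  rewrite -((fubini_kernel mD mE (iWk z) ig mk kC).2).
  by apply: eq_Rintegral => x _; rewrite /Wk /T /cos_transform mulrAC.
have WTTE : (fun x => W x * T x ^+ 2) = (fun x => W x * T x * T x).
  by apply/funext => x; rewrite expr2 mulrA.
rewrite WTTE; split; first exact: iWTT.
have -> : Rintegral mu D (fun x => W x * T x * T x) =
    Rintegral mu E (fun z => g z * Rintegral mu E (fun y => g y * kap z y)).
  rewrite [LHS]fub1; apply: eq_Rintegral => z _; congr (_ * _); exact: HE.
apply: (schur_bound mE (integrable_continuous_itv a b (@continuous_const R 1)) ig ig2
  (bessel_kernel_sym L) (fun z y => bessel_kernel_le z y L0)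
  (fun z y => bessel_kernel_ge0 z y L0) (measurable_bessel_kernel L)
  (fun z => Rintegral_bessel_kernel z L0 ab)
  (fun z y => raised_cosine_product_bound z y phi L1) igk).
apply: (eq_integrable_real mE _ igH) => z _; congr (_ * _); exact: HE.
Qed.

End Bessel.

(** * Majorants on frequency blocks *)

Section Majorant.
Variable R : realType.
Local Notation RT := (measurableTypeR R).
Local Notation mu := (@lebesgue_measure R).
Local Notation integ A f := (mu.-integrable A (EFin \o f)).
Implicit Types (x y a b c phi M : R) (g gr gi : RT -> R).

(** Truncation by a factor instead of a shorter interval: the domain of integration stays fixed and
    the integrand is jointly measurable in [z] and [y]. *)
Definition lower_part g y : RT -> R := fun z => g z * if z <= y then 1 else 0.

Lemma lower_part_sqr g y z :
  lower_part g y z ^+ 2 = g z ^+ 2 * if z <= y then 1 else 0.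
Proof. by rewrite /lower_part; case: ifP; rewrite ?mulr1 ?mulr0// expr0n. Qed.

Lemma lower_part_sqr_le g y z : lower_part g y z ^+ 2 <= g z ^+ 2.
Proof. by rewrite lower_part_sqr; case: ifP; rewrite ?mulr1 ?mulr0 ?sqr_ge0. Qed.

Lemma measurable_ler_l y : measurable_fun setT (fun z : RT => if z <= y then 1 else 0 : R).
Proof. exact: (measurableT_comp (@measurable_ler_indicator R) (pair2_measurable y)). Qed.

Lemma measurable_cos_l x phi : measurable_fun setT (fun z : RT => cos (x * z + phi)).
Proof. exact: (measurableT_comp (measurable_cos_phase phi) (pair1_measurable x)). Qed.

Lemma integrable_lower_part (A : set RT) g y : measurable A ->
  integ A g -> integ A (lower_part g y).
Proof.
move=> mA ig; apply: (integrable_mul_bounded (C := 1)) => //.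
- exact: measurable_funTS (measurable_ler_l y).
- by move=> x _; exact: ler_indicator_bound.
Qed.

Lemma integrable_mul_cos (A : set RT) g x phi : measurable A ->
  integ A g -> integ A (fun z => g z * cos (x * z + phi)).
Proof.
move=> mA ig; apply: (integrable_mul_bounded (C := 1)) => //.
- exact: measurable_funTS (measurable_cos_l x phi).
- by move=> z _; exact: cos_max.
Qed.

Lemma cos_transform_le g a b phi x : integ `[a, b] g ->
  `|cos_transform g a b phi x| <= Rintegral mu `[a, b] (fun z => `|g z|).
Proof.
move=> ig; have mE : measurable (`[a, b]%classic : set RT) by exact: measurable_itv.
have igc := integrable_mul_cos x phi mE ig.
apply: le_trans (le_normr_Rintegral mE igc) _.
apply: le_Rintegral => //; [exact: integrable_normr igc|exact: integrable_normr|].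
by move=> z _; rewrite normrM -[leRHS]mulr1; apply: ler_wpM2l => //; exact: cos_max.
Qed.

Lemma measurable_lower_cos_transform g a b phi : integ `[a, b] g ->
  measurable_fun setT (fun z : RT * RT => cos_transform (lower_part g z.2) a b phi z.1).
Proof.
move=> ig; pose E := `[a, b]%classic : set RT.
have mE : measurable E by exact: measurable_itv.
pose F (z : (RT * RT) * RT) : R :=
  (g \_ E) z.2 * (if z.2 <= z.1.2 then 1 else 0) * cos (z.1.1 * z.2 + phi).
have mF : measurable_fun setT F.
  apply: measurable_funM; first apply: measurable_funM.
  - apply: (measurableT_comp (f := g \_ E)) => //.
    exact: ((measurable_restrictT _ mE).1 (integrable_measurable ig)).
  - apply: measurable_fun_ifT => //; apply: measurable_fun_ler => //.
    by apply: (measurableT_comp measurable_snd); exact: measurable_fst.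
  - apply: (measurableT_comp (f := cos : R -> R)).
      exact: continuous_measurable_fun (@continuous_cos R).
    apply: measurable_funD => //; apply: measurable_funM => //.
    by apply: (measurableT_comp measurable_fst); exact: measurable_fst.
have := measurable_fun_Rintegral mF.
apply: eq_measurable_fun => z _; rewrite /cos_transform [RHS]Rintegral_mkcond.
apply: eq_Rintegral => t _; rewrite /F /patch /lower_part /=.
by case: ifP => // _; rewrite !mul0r.
Qed.

Lemma measurable_cos_transform g a b phi : integ `[a, b] g ->
  measurable_fun setT (cos_transform g a b phi : RT -> R).
Proof.
move=> ig; have := measurable_lower_cos_transform phi ig.
move=> /measurableT_comp /(_ (pair2_measurable b)).
apply: eq_measurable_fun => x _; rewrite /cos_transform.
apply: eq_Rintegral => z; rewrite inE /= in_itv/= => /andP[_ zb].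
by rewrite /lower_part zb mulr1.
Qed.

(** The Bessel constant for [L = M + 1]. With this [L], every [x] in [[-M, M]] has
    [|x / L| < 1 <= pi / 2], where the weight is at least 1. *)
Definition bessel_const M : R := 6 * pi ^+ 2 * (M + 1).

Lemma bessel_const_ge0 M : 0 < M -> 0 <= bessel_const M.
Proof.
rewrite /bessel_const => M0; apply: mulr_ge0; last by lra.
by apply: mulr_ge0; [lra|exact: sqr_ge0].
Qed.

(** Pointwise [|T| <= (lam^-1 + lam T^2) / 2], then Bessel. The parameter [lam] is left free: it
    will be the Sobolev weight of the block, and this takes the place of a Cauchy-Schwarz inequality
    over the blocks. *)
Lemma cos_transform_L1 g a b phi M (lam : R) : 0 < M -> 0 < lam -> a <= b ->
  measurable_fun `[a, b] g -> integ `[a, b] (fun z => g z ^+ 2) ->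
  Rintegral mu `[- M, M] (fun x => `|cos_transform g a b phi x|) <=
  bessel_const M * (lam^-1 + lam * Rintegral mu `[a, b] (fun z => g z ^+ 2)).
Proof.
move=> M0 lam0 ab mg ig2; have L1 : 1 <= M + 1 by lra.
have ig : integ `[a, b] g := integrable_sqr (measurable_itv _) (mu_itv_lty a b) mg ig2.
have [] := bessel_raised_cosine phi L1 ab mg ig2.
set D := (X in integ X _); set T := cos_transform g a b phi.
set W := raised_cosine (M + 1) => iWT WTle.
have pi2 : 2 <= pi :> R by exact: pi_ge2.
have mD : measurable D by exact: measurable_itv.
have mI : measurable (`[- M, M]%classic : set RT) by exact: measurable_itv.
have ID : (`[- M, M]%classic : set RT) `<=` D.
  by move=> x; rewrite /D /= !in_itv/= => /andP[Mx xM]; apply/andP; split; nra.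
have iWT' : integ `[- M, M] (fun x => W x * T x ^+ 2) by exact: integrableS iWT.
set G := Rintegral mu `[a, b] _ in WTle *.
have il : integ `[- M, M] (fun=> 2^-1 * lam^-1 : R).
  exact: integrable_continuous_itv (@continuous_const _ _).
have iT : integ `[- M, M] T.
  apply: measurable_bounded_integrable => //; first exact: mu_itv_lty.
    exact: measurable_funTS (measurable_cos_transform _ ig).
  exists (Rintegral mu `[a, b] (fun z => `|g z|)); split; first exact: num_real.
  move=> K KG x _ /=.
  exact: le_trans (cos_transform_le _ _ ig) (ltW KG).
apply: (@le_trans _ _ (Rintegral mu `[- M, M]
    (fun x => 2^-1 * lam^-1 + (2^-1 * lam) * (W x * T x ^+ 2)))).
  apply: le_Rintegral => //; first exact: integrable_normr.
    by apply: integrable_add => //; exact: integrable_scale.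
  move=> x; rewrite /= in_itv/= => /andP[Mx xM].
  have W1 : 1 <= W x.
    rewrite /W /raised_cosine lerDl addr0; apply: cos_ge0_pihalf.
    have M1 : 0 < M + 1 by lra.
    apply/andP; split; first by rewrite ler_pdivlMr//; nra.
    by rewrite ler_pdivrMr//; nra.
  apply: (@le_trans _ _ (2^-1 * lam^-1 + 2^-1 * lam * (T x ^+ 2))).
    have ll : lam * lam^-1 = 1 by rewrite divff// gt_eqF.
    have li : 0 < lam^-1 by rewrite invr_gt0.
    rewrite -(real_normK (num_real (T x))); have := normr_ge0 (T x).
    set z := `|T x| => z0.
    have := mulr_ge0 (ltW li) (sqr_ge0 (lam * z - 1)).
    have -> : lam^-1 * (lam * z - 1) ^+ 2 = (lam * lam^-1) * (lam * z ^+ 2) - 2 * (lam * lam^-1) * z + lam^-1.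
      by ring.
    by rewrite ll; lra.
  rewrite lerD2l; apply: ler_wpM2l; first by rewrite mulr_ge0 ?invr_ge0 ?ltW.
  by rewrite -[leLHS]mul1r; apply: ler_wpM2r => //; exact: sqr_ge0.
rewrite RintegralD//; last exact: integrable_scale.
rewrite (RintegralZl _ mI iWT').
have -> : Rintegral mu `[- M, M] (fun=> 2^-1 * lam^-1) = 2^-1 * lam^-1 * (M - - M).
  by apply: Rintegral_cst_itv; lra.
have S : Rintegral mu `[- M, M] (fun x => W x * T x ^+ 2) <= 6 * pi ^+ 2 * (M + 1) * G.
  apply: le_trans WTle; apply: le_Rintegral_subset => //.
  by move=> x _; rewrite mulr_ge0 ?sqr_ge0 ?raised_cosine_ge0.
have G0 : 0 <= G by apply: Rintegral_ge0 => z _; exact: sqr_ge0.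
move: S G0; set I1 := Rintegral _ _ _; clear - M0 lam0 pi2 => S G0.
have li : 0 < lam^-1 by rewrite invr_gt0.
have P : 1 <= pi ^+ 2 :> R by nra.
have -> : 2^-1 * lam^-1 * (M - - M) = M * lam^-1 by field; rewrite gt_eqF.
rewrite /bessel_const mulrDr; apply: lerD.
  by apply: ler_wpM2r; [exact: ltW|nra].
have Q : 0 <= 6 * pi ^+ 2 * (M + 1) * G.
  by rewrite mulr_ge0// mulr_ge0//; [rewrite mulr_ge0 ?sqr_ge0|lra].
move: S Q; move: (6 * pi ^+ 2 * (M + 1)) => c S Q; nra.
Qed.

(** What [abel_bound] leaves when the multiplier is at most [A] at [b] and has derivative at most
    [A / (b - a)], after division by [A]; no other information on the multiplier survives. *)
Definition block_majorant g a b phi x : R := `|cos_transform g a b phi x| +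
  (b - a)^-1 * Rintegral mu `[a, b] (fun y => `|cos_transform (lower_part g y) a b phi x|).

Lemma block_majorant_ge0 g a b phi x : a < b -> 0 <= block_majorant g a b phi x.
Proof.
move=> ab; rewrite addr_ge0// mulr_ge0//; first by rewrite invr_ge0 subr_ge0 ltW.
exact: Rintegral_ge0.
Qed.

Lemma block_majorant_bound g a b phi x (m dm : R -> R) (A : R) : a < b ->
  integ `[a, b] g -> (forall x, is_derive x 1 m (dm x)) -> continuous dm ->
  `|m b| <= A -> (forall y, y \in `[a, b] -> `|dm y| <= A / (b - a)) ->
  `|Rintegral mu `[a, b] (fun z => g z * cos (x * z + phi) * m z)| <=
  A * block_majorant g a b phi x.
Proof.
move=> ab ig dmm cdm mA dmA.
have mE : measurable (`[a, b]%classic : set RT) by exact: measurable_itv.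
have := abel_bound (ltW ab) (integrable_mul_cos x phi mE ig) dmm cdm mA dmA.
move=> /le_trans; apply; rewrite /block_majorant mulrDr mulrA lerD2l.
apply: ler_wpM2l.
  by rewrite divr_ge0//; [exact: le_trans (normr_ge0 _) mA|lra].
rewrite le_eqVlt; apply/orP; left; apply/eqP; apply: eq_Rintegral => y _.
congr (`|_|); apply: eq_Rintegral => z _; rewrite /lower_part; ring.
Qed.

Lemma average_split (c : R) a b : a < b -> 2 * c = c + (b - a)^-1 * (c * (b - a)).
Proof. by move=> ab; field; rewrite subr_eq0 gt_eqF. Qed.

(** Truncation does not increase [g^2], so each truncated transform obeys the same L^1 bound as the
    full one; the average over the cut point keeps it, whence only a factor 2. *)
Lemma block_majorant_L1 g a b phi M (lam : R) : 0 < M -> 0 < lam -> a < b ->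
  measurable_fun `[a, b] g -> integ `[a, b] (fun z => g z ^+ 2) ->
  integ `[- M, M] (block_majorant g a b phi) /\
  Rintegral mu `[- M, M] (block_majorant g a b phi) <=
  2 * bessel_const M * (lam^-1 + lam * Rintegral mu `[a, b] (fun z => g z ^+ 2)).
Proof.
move=> M0 lam0 ab mg ig2.
pose E := `[a, b]%classic : set RT; pose D := `[- M, M]%classic : set RT.
have mE : measurable E by exact: measurable_itv.
have mD : measurable D by exact: measurable_itv.
have ig : integ E g := integrable_sqr mE (mu_itv_lty a b) mg ig2.
set G := Rintegral mu E _; set B := bessel_const M * (lam^-1 + lam * G).
have iT : integ D (cos_transform g a b phi).
  apply: measurable_bounded_integrable => //; first exact: mu_itv_lty.
    exact: measurable_funTS (measurable_cos_transform _ ig).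
  exists (Rintegral mu E (fun z => `|g z|)); split; first exact: num_real.
  move=> K KG x _ /=.
  exact: le_trans (cos_transform_le _ _ ig) (ltW KG).
pose k (x y : RT) : R := `|cos_transform (lower_part g y) a b phi x|.
have mk : measurable_fun setT (fun z : RT * RT => k z.1 z.2).
  by apply: measurableT_comp => //; exact: measurable_lower_cos_transform.
have mk' : measurable_fun setT (fun z : RT * RT => k z.2 z.1).
  exact: measurableT_comp mk (@measurable_swap _ _ _ _).
have ilp y : integ E (lower_part g y) by exact: integrable_lower_part.
have kC (x y : RT) : `|k x y| <= Rintegral mu E (fun z => `|g z|).
  rewrite normr_id; apply: le_trans (cos_transform_le _ _ (ilp y)) _.
  apply: le_Rintegral => //; [exact: integrable_normr|exact: integrable_normr|].
  move=> z _; rewrite normrM -[leRHS]mulr1; apply: ler_wpM2l => //.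
  exact: ler_indicator_bound.
have iD : integ D (fun=> 1) by exact: integrable_continuous_itv (@continuous_const _ _).
have iE : integ E (fun=> 1) by exact: integrable_continuous_itv (@continuous_const _ _).
have [i1 fub] := fubini_kernel mD mE iD iE mk kC.
have [i2 _] := fubini_kernel mE mD iE iD mk' (fun y x => kC x y).
have i1' : integ D (fun x => Rintegral mu E (k x)).
  apply: (eq_integrable_real mD _ i1) => x _; rewrite mul1r.
  by apply: eq_Rintegral => y _; rewrite mul1r.
have i2' : integ E (fun y => Rintegral mu D (k ^~ y)).
  apply: (eq_integrable_real mE _ i2) => x _; rewrite mul1r.
  by apply: eq_Rintegral => y _; rewrite mul1r.
have kB y : Rintegral mu D (k ^~ y) <= B.
  have mlp := integrable_measurable (ilp y).
  have ilp2 : integ E (fun z => lower_part g y z ^+ 2).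
    by apply: (eq_integrable_real mE _ (integrable_lower_part y mE ig2)) => z _; rewrite lower_part_sqr.
  apply: le_trans (cos_transform_L1 phi M0 lam0 (ltW ab) mlp ilp2) _.
  rewrite /B; apply: ler_wpM2l; first exact: bessel_const_ge0.
  rewrite lerD2l; apply: ler_wpM2l; first exact: ltW.
  apply: (le_Rintegral mE ilp2 ig2) => z _.
  exact: lower_part_sqr_le.
have gB : Rintegral mu D (fun x => `|cos_transform g a b phi x|) <= B.
  exact: cos_transform_L1 (ltW ab) mg ig2.
have iT' := integrable_normr iT; have iK := integrable_scale (b - a)^-1 mD i1'.
split; first exact: (integrable_add mD iT' iK).
have -> : 2 * bessel_const M * (lam^-1 + lam * G) = 2 * B by rewrite -mulrA.
clearbody B; clear - ab mE iT' i1' iK gB kB fub i2' mD.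
rewrite /block_majorant (RintegralD mD iT' iK) (RintegralZl _ mD i1').
rewrite (average_split B ab); apply: (lerD gB).
have ba : 0 <= (b - a)^-1 by rewrite invr_ge0 subr_ge0 ltW.
apply: (ler_wpM2l ba).
have -> : Rintegral mu D (fun x => Rintegral mu E (k x)) =
    Rintegral mu E (fun y => Rintegral mu D (k ^~ y)).
  transitivity (Rintegral mu D (fun x => 1 * Rintegral mu E (fun y => 1 * k x y))).
    apply: eq_Rintegral => x _; rewrite mul1r.
    by apply: eq_Rintegral => y _; rewrite mul1r.
  rewrite fub; apply: eq_Rintegral => x _; rewrite mul1r.
  by apply: eq_Rintegral => y _; rewrite mul1r.
apply: (@le_trans _ _ (Rintegral mu E (fun=> B))); last first.
  by rewrite (Rintegral_cst_itv B (ltW ab)).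
apply: (le_Rintegral mE i2' (integrable_continuous_itv a b (@continuous_const R B))).
by move=> y _; exact: kB.
Qed.

End Majorant.

(** * Oscillatory integrals over one frequency interval *)

Section Pieces.
Variable R : realType.
Local Notation RT := (measurableTypeR R).
Local Notation mu := (@lebesgue_measure R).
Local Notation integ A f := (mu.-integrable A (EFin \o f)).
Implicit Types (x y a b c d phi M rho : R) (g gr gi : RT -> R).

Lemma cos_lipschitz a b : `|cos a - cos b| <= `|a - b|.
Proof.
wlog ab : a b / b <= a.
  by move=> H; have [/H//|/ltW /H] := leP b a; rewrite distrC (distrC a).
have [->|ab'] := eqVneq b a; first by rewrite !subrr.
have lab : b < a by rewrite lt_neqAle ab' ab.
have [c _ ->] := MVT lab (fun x _ => is_derive_cos x)
  (continuous_subspaceT (@continuous_cos R)).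
rewrite normrM normrN -[leRHS]mul1r; apply: ler_wpM2r => //; exact: sin_max.
Qed.

Lemma sin_lipschitz a b : `|sin a - sin b| <= `|a - b|.
Proof.
rewrite -!cosBpihalf; apply: le_trans (cos_lipschitz _ _) _.
by rewrite (_ : a - _ - _ = a - b)//; ring.
Qed.

(** The integrand of [P_re] for [m = 1], with the damping [y = t^gamma] and the position [Y] on the
    curve as independent parameters. At [y = t = 0] and [Y = x] it is the integrand of the plain
    inverse transform. *)
Definition osc gr gi (y Y t : R) : RT -> R := fun z =>
  expR (- (y * `|z|)) * (gr z * cos (Y * z + t * `|z|) - gi z * sin (Y * z + t * `|z|)).

(** The sign of [s] absorbs the absolute value of the frequency, so that one smooth formula serves
    both half-lines. *)
Definition damped (s rho phi : R) (z : R) : R :=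
  expR (z * - s + 0) * cos (z * rho + phi).

Lemma is_derive_damped s rho phi (z : R) : is_derive z 1 (damped s rho phi)
  (expR (z * - s + 0) * - s * cos (z * rho + phi) +
   expR (z * - s + 0) * (- sin (z * rho + phi) * rho)).
Proof.
exact: (is_derive_mul (is_derive_expR_affine z (- s) 0) (is_derive_cos_affine z rho phi)).
Qed.

Lemma continuous_damped s rho phi : continuous (damped s rho phi).
Proof. exact: is_derive_continuous (is_derive_damped s rho phi). Qed.

Lemma continuous_derive_damped s rho phi : continuous (fun z : R =>
  expR (z * - s + 0) * - s * cos (z * rho + phi) +
   expR (z * - s + 0) * (- sin (z * rho + phi) * rho)).
Proof.
have ce : continuous (fun z : R => expR (z * - s + 0)).
  exact: is_derive_continuous (fun z : R => is_derive_expR_affine z (- s) 0).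
apply: continuous_add; apply: continuous_mul.
- by apply: continuous_mul => //; exact: continuous_const.
- exact: continuous_cos_affine.
- exact: ce.
- apply: continuous_mul; last exact: continuous_const.
  move=> z; apply: continuousN; exact: continuous_sin_affine.
Qed.

(** The factor dominates both the multiplier, which is at most [e], and [b - a] times its
    derivative, which is at most [e (|s| + |rho|) (b - a)]. *)
Lemma damped_block_bound g a b phi psi x s rho (e : R) : a < b -> integ `[a, b] g ->
  (forall z, z \in `[a, b] -> expR (z * - s + 0) <= e) ->
  `|Rintegral mu `[a, b] (fun z => g z * cos (x * z + phi) * damped s rho psi z)| <=
  e * (1 + (`|s| + `|rho|) * (b - a)) * block_majorant g a b phi x.
Proof.
move=> ab ig se; have ba : 0 < b - a by rewrite subr_gt0.
have e0 : 0 <= e.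
  by apply: le_trans (se b _); [exact: expR_ge0|rewrite in_itv/= lexx ltW].
have P : 0 <= (`|s| + `|rho|) * (b - a) by apply: mulr_ge0; [exact: addr_ge0|exact: ltW].
have T := (@block_majorant_bound R g a b phi x (damped s rho psi) _ (e * (1 + (`|s| + `|rho|) * (b - a))) ab ig (is_derive_damped s rho psi)
  (@continuous_derive_damped s rho psi)).
apply: T.
- rewrite /damped normrM (ger0_norm (expR_ge0 _)).
  apply: (@le_trans _ _ (e * 1)); last by apply: ler_wpM2l => //; rewrite lerDl.
  apply: ler_pM; [exact: expR_ge0|exact: normr_ge0| |exact: cos_max].
  by apply: se; rewrite in_itv/= lexx ltW.
- move=> z /se zs; rewrite ler_pdivlMr//.
  apply: (@le_trans _ _ (e * (`|s| + `|rho|) * (b - a))); last first.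
    by rewrite -mulrA; apply: ler_wpM2l => //; rewrite lerDr.
  apply: ler_wpM2r; first exact: ltW.
  rewrite -mulrA -mulrDr normrM (ger0_norm (expR_ge0 _)).
  apply: ler_pM => //.
  apply: le_trans (ler_normD _ _) _; rewrite !normrM !normrN.
  apply: lerD; first by rewrite -[leRHS]mulr1; apply: ler_wpM2l => //; exact: cos_max.
  by rewrite -[leRHS]mul1r; apply: ler_wpM2r => //; exact: sin_max.
Qed.

(** Addition formulas split the cosine and the sine of [x z + rho z] into four products; the shift
    by [- pi / 2] writes the sines of [x z] as cosines. *)
Definition piece_majorant gr gi a b x : R :=
  block_majorant gr a b 0 x + block_majorant gr a b (- (pi / 2)) x +
  (block_majorant gi a b (- (pi / 2)) x + block_majorant gi a b 0 x).

(** [sg] is the sign of the frequencies in [[a, b]] and [d] a lower bound for their size. On a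
    half-line the dispersion [t |z|] is linear, so the displacement of the curve and the time enter
    only through [rho = Y - x + t sg]. *)
Lemma piece_bound gr gi a b x y Y t (sg d : R) : a < b ->
  integ `[a, b] gr -> integ `[a, b] gi -> 0 <= y -> `|sg| = 1 ->
  (forall z, z \in `[a, b] -> d <= z * sg /\ `|z| = z * sg) ->
  `|Rintegral mu `[a, b] (osc gr gi y Y t)| <=
  expR (- (y * d)) * (1 + (y + `|Y - x + t * sg|) * (b - a)) *
  piece_majorant gr gi a b x.
Proof.
move=> ab ir ii y0 sg1 zd.
have mE : measurable (`[a, b]%classic : set RT) by exact: measurable_itv.
pose rho := Y - x + t * sg; pose s := y * sg.
have sy : `|s| = y by rewrite normrM sg1 mulr1 ger0_norm.
have se z : z \in `[a, b] -> expR (z * - s + 0) <= expR (- (y * d)).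
  move=> /zd[dz _]; rewrite ler_expR addr0 mulrN lerN2 /s mulrCA.
  exact: ler_wpM2l.
pose T g phi psi z := g z * cos (x * z + phi) * damped s rho psi z.
have iT g phi psi : integ `[a, b] g -> integ `[a, b] (T g phi psi).
  move=> ig; apply: integrable_mul_continuous; last exact: continuous_damped.
  exact: integrable_mul_cos.
have B g phi psi : integ `[a, b] g -> `|Rintegral mu `[a, b] (T g phi psi)| <=
    expR (- (y * d)) * (1 + (y + `|rho|) * (b - a)) * block_majorant g a b phi x.
  by move=> ig; rewrite -[X in X + `|rho|]sy; apply: damped_block_bound.
have h1 := iT gr 0 0 ir; have h2 := iT gr (- (pi / 2)) (- (pi / 2)) ir.
have h3 := iT gi (- (pi / 2)) 0 ii; have h4 := iT gi 0 (- (pi / 2)) ii.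
have -> : Rintegral mu `[a, b] (osc gr gi y Y t) =
    (Rintegral mu `[a, b] (T gr 0 0) - Rintegral mu `[a, b] (T gr (- (pi / 2)) (- (pi / 2)))) -
    (Rintegral mu `[a, b] (T gi (- (pi / 2)) 0) + Rintegral mu `[a, b] (T gi 0 (- (pi / 2)))).
  rewrite -(RintegralB mE h1 h2) -(RintegralD mE h3 h4).
  rewrite -(RintegralB mE (integrable_sub mE h1 h2) (integrable_add mE h3 h4)).
  apply: eq_Rintegral => z; rewrite inE => /zd[_ zsg].
  rewrite /osc /T /damped zsg.
  have -> : Y * z + t * (z * sg) = x * z + z * rho by rewrite /rho; ring.
  have -> : - (y * (z * sg)) = z * - s + 0 by rewrite /s; ring.
  rewrite !addr0 !cosBpihalf cosD sinD.
  move: (cos _) (sin _) (cos (z * rho)) (sin (z * rho)) (expR _) => c1 s1 c2 s2 ex.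
  ring.
have := B _ 0 0 ir; have := B _ (- (pi / 2)) (- (pi / 2)) ir.
have := B _ (- (pi / 2)) 0 ii; have := B _ 0 (- (pi / 2)) ii.
move: (Rintegral _ _ _) (Rintegral _ _ _) (Rintegral _ _ _) (Rintegral _ _ _) => u1 u2 u3 u4.
rewrite /piece_majorant; move: (expR _ * _) => A.
move: (block_majorant gr a b 0 x) (block_majorant gr a b (- (pi / 2)) x).
move: (block_majorant gi a b 0 x) (block_majorant gi a b (- (pi / 2)) x).
clear => b1 b2 b3 b4 A1 A2 A3 A4.
rewrite !mulrDr; apply: le_trans (ler_normB _ _) _.
apply: lerD.
  by apply: le_trans (ler_normB _ _) _; exact: lerD.
by apply: le_trans (ler_normD _ _) _; exact: lerD.
Qed.

Lemma measurable_osc_phase (Y t : R) :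
  measurable_fun setT (fun z : RT => Y * z + t * `|z| : R).
Proof.
have mabs : measurable_fun setT (fun z : RT => `|z| : R).
  exact: continuous_measurable_fun (@norm_continuous R R).
by apply: measurable_funD; apply: measurable_funM.
Qed.

Lemma measurable_cos_osc (Y t : R) :
  measurable_fun setT (fun z : RT => cos (Y * z + t * `|z|)).
Proof.
apply: (measurableT_comp (f := cos : R -> R)) (measurable_osc_phase Y t).
exact: continuous_measurable_fun (@continuous_cos R).
Qed.

Lemma measurable_sin_osc (Y t : R) :
  measurable_fun setT (fun z : RT => sin (Y * z + t * `|z|)).
Proof.
apply: (measurableT_comp (f := sin : R -> R)) (measurable_osc_phase Y t).
exact: continuous_measurable_fun (@continuous_sin R).
Qed.

Lemma measurable_expRN_norm y : measurable_fun setT (fun z : RT => expR (- (y * `|z|))).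
Proof.
apply: (measurableT_comp (f := expR : R -> R)).
  exact: continuous_measurable_fun (@continuous_expR R).
rewrite (_ : (fun _ => _) = (fun z : RT => 0 * z + - y * `|z| : R)).
  exact: measurable_osc_phase.
by apply/funext => z; rewrite mulNr mul0r add0r.
Qed.

Lemma integrable_osc (E : set RT) gr gi y Y t : measurable E -> 0 <= y ->
  integ E gr -> integ E gi -> integ E (osc gr gi y Y t).
Proof.
move=> mE y0 ir ii.
have me := measurable_funTS (D := E) (measurable_expRN_norm y).
have mc := measurable_funTS (D := E) (measurable_cos_osc Y t).
have ms := measurable_funTS (D := E) (measurable_sin_osc Y t).
have i1 := integrable_mul_bounded mE ir mc (fun z _ => cos_max _).
have i2 := integrable_mul_bounded mE ii ms (fun z _ => sin_max _).
have e1 z : E z -> `|expR (- (y * `|z|))| <= 1.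
  by move=> _; rewrite ger0_norm ?expR_ge0// expR_le1 oppr_le0 mulr_ge0.
have := integrable_mul_bounded mE (integrable_sub mE i1 i2) me e1.
by apply: (eq_integrable_real mE) => z _; rewrite mulrC.
Qed.

(** For bounded frequencies the damping, the displacement and the time perturb the integrand by at
    most [(y + |Y - x| + t) |z|] times the data; this provides the termwise limits for Tannery's
    theorem. *)
Lemma piece_limit_bound gr gi a b x y Y t c : integ `[a, b] gr -> integ `[a, b] gi ->
  0 <= y -> 0 <= t -> (forall z, z \in `[a, b] -> `|z| <= c) ->
  `|Rintegral mu `[a, b] (osc gr gi y Y t) - Rintegral mu `[a, b] (osc gr gi 0 x 0)| <=
  (y + `|Y - x| + t) * c * Rintegral mu `[a, b] (fun z => `|gr z| + `|gi z|).
Proof.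
move=> ir ii y0 t0 zc.
have mE : measurable (`[a, b]%classic : set RT) by exact: measurable_itv.
have i1 := integrable_osc Y t mE y0 ir ii.
have i2 := integrable_osc x 0 mE (lexx 0) ir ii.
have i3 := integrable_add mE (integrable_normr ir) (integrable_normr ii).
rewrite -(RintegralB mE i1 i2) -(RintegralZl _ mE i3).
have i4 := integrable_sub mE i1 i2.
apply: le_trans (le_normr_Rintegral mE i4) _.
apply: (le_Rintegral mE (integrable_normr i4) (integrable_scale _ mE i3)) => z /zc {}zc.
rewrite /osc; cbv beta; rewrite !mul0r oppr0 expR0 mul1r addr0; clear - y0 t0 zc.
set th := Y * z + _; set e := expR _.
have e01 : 0 <= 1 - e <= y * `|z|.
  have := expR_ge1Dx (- (y * `|z|)).
  have : e <= 1 by rewrite expR_le1 oppr_le0 mulr_ge0.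
  by rewrite -/e => h1 h2; apply/andP; split; lra.
have thb : `|th - x * z| <= (`|Y - x| + t) * `|z|.
  rewrite (_ : th - x * z = (Y - x) * z + t * `|z|); last by rewrite /th; ring.
  apply: le_trans (ler_normD _ _) _.
  by rewrite !normrM normr_id (ger0_norm t0) mulrDl.
have gen (u v : R) : `|u - v| <= `|th - x * z| -> `|u| <= 1 ->
    `|e * u - v| <= (y + `|Y - x| + t) * c.
  move=> uv u1; rewrite (_ : e * u - v = (u - v) - (1 - e) * u); last by ring.
  apply: le_trans (ler_normB _ _) _; rewrite normrM.
  have E1 : `|1 - e| * `|u| <= y * `|z|.
    case/andP: e01 => h1 h2; rewrite (ger0_norm h1) -[leRHS]mulr1; exact: ler_pM.
  apply: le_trans (lerD (le_trans uv thb) E1) _.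
  rewrite -mulrDl (_ : `|Y - x| + t + y = y + `|Y - x| + t); last by ring.
  by apply: ler_wpM2l => //; rewrite !addr_ge0.
have := gen _ _ (cos_lipschitz th (x * z)) (cos_max _).
have := gen _ _ (sin_lipschitz th (x * z)) (sin_max _).
set S := e * sin th - _; set C := e * cos th - _ => S1 C1.
rewrite (_ : _ - _ = gr z * C - gi z * S); last by rewrite /C /S; ring.
apply: le_trans (ler_normB _ _) _; rewrite !normrM mulrDr.
by apply: lerD; rewrite mulrC; apply: ler_wpM2r.
Qed.

End Pieces.

(** * Inequalities for real powers *)

Section Powers.
Variable R : realType.
Implicit Types (x y a b c p q w : R).

Lemma onem_expRN_le x : 1 - expR (- x) <= x.
Proof. by have := expR_ge1Dx (- x); lra. Qed.

(** Comparison of a series with an integral, in telescoping form. With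
    [u = ln(j+2) - ln(j+1) >= 1 / (j+2)] it reduces to [expR (q u) >= 1 + q u]. *)
Lemma powR_step_le (j : nat) q : 0 < q ->
  (j.+2%:R : R) `^ (- (q + 1)) <= q^-1 * (j.+1%:R `^ (- q) - j.+2%:R `^ (- q)).
Proof.
move=> q0; set u := ln (j.+2%:R : R) - ln j.+1%:R.
have j1 : 0 < (j.+1%:R : R) by rewrite ltr0n.
have j2 : 0 < (j.+2%:R : R) by rewrite ltr0n.
have uv : (j.+2%:R : R)^-1 <= u.
  have -> : u = - ln (1 + - (j.+2%:R : R)^-1).
    rewrite /u -opprB -ln_div ?posrE//; congr (- ln _).
    have -> : (j.+2%:R : R) = j.+1%:R + 1 by rewrite natr1.
    by move: (j.+1%:R) j1 => v v0; field; rewrite gt_eqF//; lra.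
  rewrite -[leLHS]opprK lerN2; apply: le_ln1Dx.
  by rewrite ltrN2 invf_lt1// ltr1n.
have -> : (j.+2%:R : R) `^ (- (q + 1)) = j.+2%:R `^ (- q) * j.+2%:R^-1.
  rewrite opprD powRD; last by rewrite (gt_eqF j2) implybT.
  by rewrite (powRN _ 1) powRr1// ltW.
have -> : (j.+1%:R : R) `^ (- q) = j.+2%:R `^ (- q) * expR (q * u).
  by rewrite /powR !gt_eqF// -expRD; congr expR; rewrite /u; ring.
rewrite -[X in _ - X]mulr1 -mulrBr mulrCA; apply: ler_wpM2l; first exact: powR_ge0.
rewrite mulrC ler_pdivlMr// mulrC.
have := expR_ge1Dx (q * u); have : q * j.+2%:R^-1 <= q * u by apply: ler_wpM2l => //; exact: ltW.
by move: (q / _) (q * u) (expR _) => v1 v2 v3; lra.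
Qed.

Lemma sum_powR_le (p : R) (n : nat) : 1 < p ->
  \sum_(j < n) (j.+1%:R : R) `^ (- p) <= 1 + (p - 1)^-1.
Proof.
move=> p1; have q0 : 0 < p - 1 by lra.
suff H : \sum_(j < n.+1) (j.+1%:R : R) `^ (- p) <=
    1 + (p - 1)^-1 - (p - 1)^-1 * n.+1%:R `^ (- (p - 1)).
  apply: le_trans (le_trans _ H) _.
    by rewrite big_ord_recr/= lerDl powR_ge0.
  by rewrite gerBl mulr_ge0 ?powR_ge0// invr_ge0 ltW.
elim: n => [|n IH].
  by rewrite big_ord_recr/= big_ord0 powR1 mulr1 add0r addrK.
rewrite big_ord_recr/=; have := powR_step_le n q0.
rewrite subrK; move: IH; move: (\sum_(_ < _) _) => S IH st; lra.
Qed.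

(** This is the length of a block: when [b = 1 / (1 - tau)] and [w = (j+1)^b] is its right end,
    [(j+1)^(b-1) = w^tau]. The factor 2 pays for [j + 2 <= 2 (j + 1)], and [j = 0] is apart because
    of the logarithm. *)
Lemma powR_succ_sub_le (j : nat) b : 1 <= b ->
  (j.+1%:R : R) `^ b - j%:R `^ b <= 2 * b * j.+1%:R `^ (b - 1).
Proof.
move=> b1; have b0 : 0 < b by lra.
case: j => [|j].
  by rewrite powR0 ?gt_eqF// !powR1 subr0; lra.
have j1 : 0 < (j.+1%:R : R) by rewrite ltr0n.
have j2 : 0 < (j.+2%:R : R) by rewrite ltr0n.
set u := ln (j.+2%:R : R) - ln j.+1%:R.
have uv : u <= (j.+1%:R : R)^-1.
  have -> : u = ln (1 + (j.+1%:R : R)^-1).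
    rewrite /u -ln_div ?posrE//; congr ln.
    have -> : (j.+2%:R : R) = j.+1%:R + 1 by rewrite natr1.
    by move: (j.+1%:R) j1 => v v0; field; rewrite gt_eqF//; lra.
  by apply: le_ln1Dx; apply: lt_trans (_ : 0 < _); rewrite ?invr_gt0//; lra.
have jj : (j.+1%:R : R)^-1 <= 2 * j.+2%:R^-1.
  rewrite ler_pdivlMr// mulrC ler_pdivrMr//.
  by rewrite -natrM ler_nat mul2n -addnn addSn ltnS leq_addl.
have -> : (j.+1%:R : R) `^ b = j.+2%:R `^ b * expR (- (b * u)).
  by rewrite /powR !gt_eqF// -expRD; congr expR; rewrite /u; ring.
have -> : (j.+2%:R : R) `^ (b - 1) = j.+2%:R `^ b * j.+2%:R^-1.
  rewrite powRD; last by rewrite (gt_eqF j2) implybT.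
  by rewrite (powRN _ 1) powRr1// ltW.
rewrite -[X in X - _]mulr1 -mulrBr mulrCA; apply: ler_wpM2l; first exact: powR_ge0.
apply: le_trans (onem_expRN_le _) _.
have : b * u <= b * (2 * j.+2%:R^-1) by apply: ler_wpM2l; [exact: ltW|exact: le_trans uv jj].
by rewrite [2 * b]mulrC -mulrA.
Qed.

Lemma powR_le_1D y t : 0 <= y -> 0 <= t -> t <= 1 -> y `^ t <= 1 + y.
Proof.
move=> y0 t0 t1; have [y1|y1] := leP 1 y.
  by apply: le_trans (ler1_powR y1 t1) _; lra.
have [->|yn] := eqVneq y 0; first by rewrite /powR eqxx; case: (t == 0); rewrite ?addr0 /= ?ler01 ?lexx.
apply: (@le_trans _ _ 1); last by lra.
by rewrite -(powRr0 y); apply: ger_powR => //; rewrite lt_neqAle eq_sym yn y0 ltW.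
Qed.

End Powers.

(** * Uniform bound for the block factors and Tannery's theorem *)

Section Series.
Variable R : realType.
Local Notation RT := (measurableTypeR R).
Local Notation mu := (@lebesgue_measure R).
Local Notation integ A f := (mu.-integrable A (EFin \o f)).

(** The block has length at most [2 b w^tau], so [rho] times it is at most
    [2 b C0 (y w)^tau <= 2 b C0 (1 + y w)], and the exponential absorbs the growth in [y w]. The
    hypothesis on [rho] is matched to the block length through the common exponent [tau]. *)
Lemma block_factor_bound (tau b y rho C0 : R) (j : nat) : 0 < tau -> tau < 1 ->
  0 <= y -> y <= 1 -> 0 <= rho -> rho <= C0 * y `^ tau -> 0 <= C0 ->
  b = (1 - tau)^-1 ->
  expR (- (y * j%:R `^ b)) * (1 + rho * (j.+1%:R `^ b - j%:R `^ b)) <=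
  1 + C0 * (2 * b) * (expR 1 * (1 + 2 `^ b)).
Proof.
move=> tau0 tau1 y0 y1 rho0 rhoC C00 bE.
have t1 : 0 < 1 - tau by lra.
have b0 : 0 < b by rewrite bE invr_gt0.
have bt : b * (1 - tau) = 1 by rewrite bE mulVf// gt_eqF.
have b1 : 1 <= b by rewrite bE invf_ge1//; lra.
clear bE.
set w := (j.+1%:R : R) `^ b; set v := j%:R `^ b.
have w0 : 0 <= w by exact: powR_ge0.
have v0 : 0 <= v by exact: powR_ge0.
have c0 : 0 < (2 : R) `^ b by exact: powR_gt0.
have wE : (j.+1%:R : R) `^ (b - 1) = w `^ tau.
  by rewrite /w -powRrM; congr (_ `^ _); lra.
have lenw : w - v <= 2 * b * w `^ tau by rewrite -wE; exact: powR_succ_sub_le.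
(* The damping is known at the left end [v], the length at the right end [w]. The added 1 covers the
   first block, where [v = 0]; since [y <= 1] it costs the factor [expR 1] in [E1]. *)
have vw : w / 2 `^ b <= v + 1.
  rewrite ler_pdivrMr//; rewrite /v /w; case: j {w v w0 v0 wE lenw} => [|j].
    rewrite powR0 ?gt_eqF// add0r mul1r.
    by apply: ge0_ler_powR; rewrite ?nnegrE ?ltW//; lra.
  apply: (@le_trans _ _ ((j.+1%:R * 2) `^ b)).
    apply: ge0_ler_powR; [exact: ltW|by rewrite nnegrE ler0n|by rewrite nnegrE mulr_ge0|].
    by rewrite -natrM ler_nat muln2 -addnn addSn ltnS leq_addl.
  by rewrite powRM// mulrDl lerDl mul1r ltW.
have E1 : expR (- (y * v)) <= expR 1 * expR (- (y * w / 2 `^ b)).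
  rewrite -expRD ler_expR; have : y * (w / 2 `^ b) <= y * (v + 1) by exact: ler_wpM2l.
  by rewrite mulrA; move: (y * w / _) => q; lra.
have yw : y `^ tau * w `^ tau <= 1 + y * w.
  by rewrite -powRM//; apply: powR_le_1D => //; [exact: mulr_ge0|exact: ltW|exact: ltW].
(* Writing [c = 2^b] and [q = y w]: [(1 + c) expR (q / c) >= (1 + c) (1 + q / c) >= 1 + q]. *)
have E2 : (1 + y * w) * expR (- (y * w / 2 `^ b)) <= 1 + 2 `^ b.
  set q := y * w; have q0 : 0 <= q by exact: mulr_ge0.
  rewrite expRN ler_pdivrMr ?expR_gt0//.
  have := expR_ge1Dx (q / 2 `^ b) => /(ler_wpM2l (_ : 0 <= 1 + 2 `^ b)) H.
  apply: le_trans (H _); last by lra.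
  rewrite mulrDr mulr1 mulrDl mul1r mulrCA divff ?gt_eqF// mulr1.
  have : 0 <= q / 2 `^ b by rewrite divr_ge0// ltW.
  lra.
rewrite mulrDr mulr1; apply: lerD.
  by rewrite expR_le1 oppr_le0 mulr_ge0.
apply: (@le_trans _ _ (expR (- (y * v)) * (C0 * (2 * b) * (1 + y * w)))).
  apply: ler_wpM2l; first exact: expR_ge0.
  apply: (@le_trans _ _ (C0 * y `^ tau * (2 * b * w `^ tau))).
    apply: ler_pM => //; rewrite subr_ge0; apply: ge0_ler_powR; [exact: ltW|by rewrite nnegrE ler0n|by rewrite nnegrE ler0n|].
    by rewrite ler_nat.
  rewrite (_ : C0 * _ * _ = C0 * (2 * b) * (y `^ tau * w `^ tau)); last by ring.
  by apply: ler_wpM2l => //; rewrite mulr_ge0// mulr_ge0// ltW.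
rewrite mulrCA; apply: ler_wpM2l; first by rewrite mulr_ge0// mulr_ge0// ltW.
rewrite mulrC; apply: (@le_trans _ _ ((1 + y * w) * (expR 1 * expR (- (y * w / 2 `^ b))))).
  by apply: ler_wpM2l => //; rewrite addr_ge0// mulr_ge0.
by rewrite mulrCA; apply: ler_wpM2l => //; exact: expR_ge0.
Qed.

(** The domination passes to the termwise limits [f j]; that conclusion later bounds the partial
    sums at [t = 0], uniformly in the number of blocks. *)
Lemma tannery (U : nat -> R -> R) (f D : nat -> R) (u : R -> R) :
  (forall j t, 0 < t <= 1 -> `|U j t| <= D j) ->
  (forall j, U j t @[t --> 0^'+] --> f j) -> cvgn (series D) ->
  (forall t, 0 < t <= 1 -> series (U ^~ t) n @[n --> \oo] --> u t) ->
  [/\ cvgn (series f), (forall j, `|f j| <= D j) &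
      u t @[t --> 0^'+] --> limn (series f)].
Proof.
move=> UD Uf cD Uu.
have fD j : `|f j| <= D j.
  have cn : `|U j t| @[t --> 0^'+] --> `|f j| by apply: cvg_norm; exact: Uf.
  apply: (cvgr_to_le cn).
  near=> t; apply: UD; apply/andP; split; first by near: t; exact: nbhs_right_gt.
  by near: t; exact: nbhs_right_le.
have D0 j : 0 <= D j by apply: le_trans (fD j).
have cf : cvgn (series f).
  apply: normed_cvg; apply: (series_le_cvg _ _ _ cD) => //= j.
split => //; apply/cvgrPdist_le => e e0.
have e3 : 0 < e / 3 by rewrite divr_gt0.
have /cvgrPdist_le /(_ _ e3) [N _ HN] := cD.
have tail (g : nat -> R) n : (forall j, `|g j| <= D j) -> (N <= n)%N ->
    `|series g n - series g N| <= e / 3.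
  move=> gD Nn; have := HN N (leqnn N); rewrite /= => HNN.
  apply: (@le_trans _ _ (series D n - series D N)).
    rewrite !sub_series_geq//; apply: le_trans (ler_norm_sum _ _ _) _.
    exact: ler_sum.
  apply: le_trans HNN; apply: le_trans (ler_norm _); apply: lerB => //.
  apply: nondecreasing_cvgn_le => //; exact: nondecreasing_series.
have tl (g : nat -> R) l : (forall j, `|g j| <= D j) ->
    series g n @[n --> \oo] --> l -> `|l - series g N| <= e / 3.
  move=> gD gl.
  have cn : `|series g n - series g N| @[n --> \oo] --> `|l - series g N|.
    by apply: cvg_norm; apply: cvgB => //; exact: cvg_cst.
  apply: (cvgr_to_le cn).
  by near=> n; apply: tail => //; near: n; exact: nbhs_infty_ge.
have H1 : `|limn (series f) - series f N| <= e / 3 by exact: tl.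
have cN : series (U ^~ t) N @[t --> 0^'+] --> series f N.
  rewrite /series /=; elim: N {HN tail tl H1} => [|N IH].
    rewrite big_geq// (_ : (fun t => _) = fun=> 0); first exact: cvg_cst.
    by apply/funext => t; rewrite big_geq.
  rewrite big_nat_recr//= (_ : (fun t => _) = (fun t => \sum_(0 <= k < N) U k t + U N t)).
    exact: cvgD.
  by apply/funext => t; rewrite big_nat_recr.
have /cvgrPdist_le /(_ _ e3) cN3 := cN.
near=> t.
have t01 : 0 < t <= 1.
  apply/andP; split; first by near: t; exact: nbhs_right_gt.
  by near: t; exact: nbhs_right_le.
have H2 : `|u t - series (U ^~ t) N| <= e / 3.
  by apply: tl; [move=> j; exact: UD|exact: Uu].
have H3 : `|series f N - series (U ^~ t) N| <= e / 3 by near: t.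
rewrite (_ : _ - u t = (limn (series f) - series f N) +
   ((series f N - series (U ^~ t) N) - (u t - series (U ^~ t) N))); last by ring.
apply: le_trans (ler_normD _ _) _.
have := ler_normB (series f N - series (U ^~ t) N) (u t - series (U ^~ t) N).
lra.
Unshelve. all: by end_near. Qed.

End Series.

(** * Series of block integrals and almost everywhere summability *)

Section Summation.
Variable R : realType.
Local Notation RT := (measurableTypeR R).
Local Notation mu := (@lebesgue_measure R).
Local Notation integ A f := (mu.-integrable A (EFin \o f)).

Lemma Rintegral_itv_split (f : RT -> R) (a c b : R) : a <= c -> c <= b ->
  integ `[a, b] f ->
  Rintegral mu `[a, b] f = Rintegral mu `[a, c] f + Rintegral mu `[c, b] f.
Proof.
move=> ac cb fi; have := @Rintegral_itvB R f (BLeft a) (BRight b) c fi.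
rewrite !bnd_simp Rintegral_itv_obnd_cbnd; last first.
  apply: (integrableS _ _ _ fi); try exact: measurable_itv.
  by apply: subset_itvr; rewrite bnd_simp.
by move=> <-//; rewrite addrC subrK.
Qed.

Lemma sum_Rintegral_sym (f : RT -> R) (b : nat -> R) (n : nat) :
  b 0%N = 0 -> (forall j, b j <= b j.+1) -> (forall x y, integ `[x, y] f) ->
  \sum_(0 <= j < n) (Rintegral mu `[b j, b j.+1] f + Rintegral mu `[- b j.+1, - b j] f) =
  Rintegral mu `[- b n, b n] f.
Proof.
move=> b0 bm fi; elim: n => [|n IH].
  by rewrite big_geq// b0 oppr0 set_itv1 Rintegral_set1.
have bn0 : 0 <= b n by rewrite -b0; elim: n {IH} => // n /le_trans; apply.
have bnn := bm n; have h1 : - b n.+1 <= - b n by rewrite lerN2.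
have h2 : - b n <= b n by lra.
rewrite big_nat_recr//= IH (Rintegral_itv_split h1 (le_trans h2 bnn) (fi _ _)).
by rewrite (Rintegral_itv_split h2 bnn (fi _ _)); ring.
Qed.

Lemma cvg_Rintegral_sym (h : RT -> R) (b : nat -> R) : integ setT h ->
  b n @[n --> \oo] --> +oo ->
  Rintegral mu `[- b n, b n] h @[n --> \oo] --> Rintegral mu setT h.
Proof.
move=> hi bo; have mh := integrable_measurable hi.
pose E n : set RT := `[- b n, b n]%classic.
have mE n : measurable (E n) by exact: measurable_itv.
have [] := @dominated_convergence _ _ _ mu setT measurableT
  (fun n => EFin \o (h \_ (E n))) (EFin \o h) (fun x => `|(h x)%:E|)%E.
- move=> n; apply/measurable_EFinP.
  exact: ((measurable_restrictT _ (mE n)).1 (measurable_funTS mh)).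
- exact/measurable_EFinP.
- apply/aeW => x _; apply: cvg_near_cst; near=> n.
  rewrite /= patchE mem_set// /E /= in_itv/= -ler_norml.
  near: n; move/cvgryPge : bo; exact.
- exact: integrable_abse hi.
- by apply/aeW => x n _; rewrite /= lee_fin patchE; case: ifP => // _; rewrite normr0.
move=> _ _ cv.
have -> : Rintegral mu setT h = fine (\int[mu]_x (EFin \o h) x)%E by [].
have -> : (fun n => Rintegral mu `[- b n, b n] h) =
    fine \o (fun n => \int[mu]_x (EFin \o (h \_ (E n))) x)%E.
  by apply/funext => n; rewrite /= Rintegral_mkcond.
apply: fine_cvg; rewrite fineK; first exact: cv.
exact: integrable_fin_num.
Unshelve. all: by end_near. Qed.

Lemma integrable_expRN_norm (c : R) : 0 < c -> integ setT (fun x => expR (- (c * `|x|))).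
Proof.
move=> c0.
have ce : continuous (fun x : R => expR (- (c * `|x|))).
  move=> x; apply: (@continuous_comp _ _ _ (fun x : R => - (c * `|x|)) expR); last exact: continuous_expR.
  apply: continuousN; apply: continuousM; first exact: cst_continuous.
  exact: norm_continuous.
have me : measurable_fun setT (fun x : RT => expR (- (c * `|x|))).
  exact: continuous_measurable_fun.
apply/integrableP; split; first exact/measurable_EFinP.
under eq_integral do rewrite /= ger0_norm ?expR_ge0//.
rewrite ge0_symfun_integralT//.
have -> : [set x : R | 0 <= x] = `[0, +oo[%classic.
  by apply/seteqP; split => x /=; rewrite in_itv/= andbT.
rewrite (@ge0_continuous_FTC2y _ _ (fun x => - c^-1 * expR (x * - c + 0)) 0 0).
- by rewrite -EFinB -EFinM ltry.
- by move=> x _; exact: expR_ge0.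
- exact: continuous_subspaceT.
- have H0 : expR (- x) @[x --> +oo] --> (0 : R) by exact: cvgr_expR.
  have H1 : x * c @[x --> +oo] --> (+oo : set_system R).
    by apply: gt0_cvgMly => //; exact: cvg_id.
  have H2 : expR (x * - c + 0) @[x --> +oo] --> (0 : R).
    rewrite (_ : (fun x => _) = (fun x => expR (- (x * c)))).
      exact: (cvg_comp _ _ H1 H0).
    by apply/funext => x; rewrite addr0 mulrN.
  have K : - c^-1 * expR (x * - c + 0) @[x --> +oo] --> (- c^-1 * 0 : R).
    by apply: cvgM; [exact: cvg_cst|exact: H2].
  by move: K; rewrite mulr0.
- move=> x _; exact: (@ex_derive _ _ _ _ _ _ _
    (is_derive_mul (is_derive_cst (- c^-1) x 1) (is_derive_expR_affine x (- c) 0))).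
- apply: cvg_at_right_filter; apply: cvgM; first exact: cvg_cst.
  exact: is_derive_continuous (fun x => is_derive_expR_affine x (- c) 0) 0.
- move=> x; rewrite in_itv/= andbT => x0; rewrite derive1E.
  have H := is_derive_mul (is_derive_cst (- c^-1) x 1) (is_derive_expR_affine x (- c) 0).
  rewrite (@derive_val _ _ _ _ _ _ _ H) mul0r add0r addr0 (gtr0_norm x0) /cst.
  rewrite (_ : x * - c = - (c * x)); last by ring.
  by rewrite mulrCA mulrNN mulVf ?mulr1// gt_eqF.
- by move=> x /=; rewrite normrN.
Qed.

(** Monotone convergence. [DD] is the sum of the series, sent to 0 by [fine] where it is infinite;
    it is returned as an integrable majorant of all partial sums, for dominated convergence. *)
Lemma ae_summable (I : set RT) (F : nat -> RT -> R) (K : R) : measurable I ->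
  (forall j, integ I (F j)) -> (forall j x, 0 <= F j x) ->
  (forall n, \sum_(0 <= j < n) Rintegral mu I (F j) <= K) ->
  exists2 DD : RT -> R, integ I DD &
    {ae mu, forall x, I x -> cvgn (series (F ^~ x)) /\
       forall n, series (F ^~ x) n <= DD x}.
Proof.
move=> mI iF F0 FK.
have mF n : measurable_fun I (fun x => (F n x)%:E).
  by apply/measurable_EFinP; exact: integrable_measurable.
pose S x := (\sum_(0 <= j <oo) (F j x)%:E)%E.
have S0 x : (0 <= S x)%E by apply: nneseries_ge0 => n _ _; rewrite lee_fin.
have mS : measurable_fun I S by apply: ge0_emeasurable_sum => // n x _ _; rewrite lee_fin.
have iS : mu.-integrable I S.
  apply/integrableP; split => //; apply: (@le_lt_trans _ _ K%:E); last exact: ltry.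
  under eq_integral do rewrite gee0_abs//.
  rewrite integral_nneseries//; last by move=> n x _; rewrite lee_fin.
  apply: lime_le; first by apply: is_cvg_nneseries => n _ _; apply: integral_ge0 => x _; rewrite lee_fin.
  near=> n; rewrite (eq_bigr (fun j => (Rintegral mu I (F j))%:E)).
    by rewrite sumEFin lee_fin.
  move=> j _; rewrite /Rintegral fineK//.
  exact: (integrable_fin_num mI (iF j)).
have Sfin := integrable_ae mI iS.
exists (fine \o S).
  apply/integrableP; split.
    by apply/measurable_EFinP; apply: measurableT_comp.
  case/integrableP: iS => _; apply: le_lt_trans; apply: ge0_le_integral => //.
  - by apply: measurableT_comp => //; apply/measurable_EFinP; apply: measurableT_comp.
  - exact: measurableT_comp.
  - move=> x _; rewrite !gee0_abs// ?lee_fin ?fine_ge0//.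
    change ((fine (S x))%:E <= S x)%E; have := S0 x.
    by case: (S x) => [r| |] //= _; exact: leey.
move: Sfin; apply: filterS => x /= fin Ix.
have SE := fineK (fin Ix).
have ub n : series (F ^~ x) n <= fine (S x).
  rewrite -lee_fin SE /series /= -sumEFin; apply: nneseries_lim_ge => j _ _.
  by rewrite lee_fin.
split => //; apply: nondecreasing_is_cvgn.
  by apply: nondecreasing_series => j _ _.
by exists (fine (S x)) => _ [n _ <-].
Unshelve. all: by end_near. Qed.

Lemma piece_majorant_ge0 gr gi (a b x : R) : a < b -> 0 <= piece_majorant gr gi a b x.
Proof.
by move=> ab; rewrite /piece_majorant; apply: addr_ge0; apply: addr_ge0;
  exact: block_majorant_ge0.
Qed.

Lemma four_sum_bound (u v c l lam p q r w : R) :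
  p <= 2 * c * (l + lam * u) -> q <= 2 * c * (l + lam * u) ->
  r <= 2 * c * (l + lam * v) -> w <= 2 * c * (l + lam * v) ->
  p + q + (r + w) <= 2 * c * (4 * l + 2 * (lam * (u + v))).
Proof. by lra. Qed.

Lemma piece_majorant_L1 (gr gi : RT -> R) (a b M lam : R) : 0 < M -> 0 < lam -> a < b ->
  measurable_fun `[a, b] gr -> measurable_fun `[a, b] gi ->
  integ `[a, b] (fun z => gr z ^+ 2) -> integ `[a, b] (fun z => gi z ^+ 2) ->
  integ `[- M, M] (piece_majorant gr gi a b) /\
  Rintegral mu `[- M, M] (piece_majorant gr gi a b) <=
  2 * bessel_const M * (4 * lam^-1 +
    2 * (lam * Rintegral mu `[a, b] (fun z => gr z ^+ 2 + gi z ^+ 2))).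
Proof.
move=> M0 l0 ab mr mi ir2 ii2.
have mI : measurable (`[- M, M]%classic : set RT) by exact: measurable_itv.
have mE : measurable (`[a, b]%classic : set RT) by exact: measurable_itv.
have [i1 b1] := block_majorant_L1 0 M0 l0 ab mr ir2.
have [i2 b2] := block_majorant_L1 (- (pi / 2)) M0 l0 ab mr ir2.
have [i3 b3] := block_majorant_L1 0 M0 l0 ab mi ii2.
have [i4 b4] := block_majorant_L1 (- (pi / 2)) M0 l0 ab mi ii2.
have i12 := integrable_add mI i1 i2; have i43 := integrable_add mI i4 i3.
split; first exact: (integrable_add mI i12 i43).
rewrite /piece_majorant (RintegralD mI i12 i43) (RintegralD mI i1 i2) (RintegralD mI i4 i3).
rewrite (RintegralD mE ir2 ii2).
exact: (four_sum_bound b1 b2 b4 b3).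
Qed.

End Summation.

(** * Bump functions *)

Section TestFunctions.
Variable R : realType.
Local Notation RT := (measurableTypeR R).
Local Notation mu := (@lebesgue_measure R).
Local Notation integ A f := (mu.-integrable A (EFin \o f)).
Implicit Types (x a b c d kap u : R) (f : R -> R).

(** The powers of [u^-1] make the family stable under differentiation, up to linear combinations;
    letting [kap] tend to 0 makes the value at each [u > 0] tend to 1 when [n = 0]. *)
Definition flat kap (n : nat) u : R :=
  if 0 < u then u^-1 ^+ n * expR (- (kap * u^-1)) else 0.

Lemma flat_ge0 kap n u : 0 <= flat kap n u.
Proof.
rewrite /flat; case: ifP => // u0; rewrite mulr_ge0 ?expR_ge0// exprn_ge0//.
by rewrite invr_ge0 ltW.
Qed.

(** The exponential beats [u^-(n+2)] through [expR x >= x^N / N!]. A quadratic bound is what makes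
    the difference quotient at 0 tend to 0. *)
Lemma flat_bound kap n : 0 < kap -> exists2 C, 0 < C & forall u, flat kap n u <= C * u ^+ 2.
Proof.
move=> k0; pose N := n.+2; pose C := N`!%:R / kap ^+ N.
have C0 : 0 < C by rewrite divr_gt0 ?exprn_gt0// ltr0n fact_gt0.
exists C => // u; rewrite /flat; case: ifP => [u0|_]; last by rewrite mulr_ge0 ?sqr_ge0// ltW.
have v0 : 0 < u^-1 by rewrite invr_gt0.
rewrite expRN -ler_pdivrMr ?exprn_gt0// ler_pdivrMr; last by rewrite exprn_gt0.
rewrite -mulrA [_^-1 * _]mulrC mulrA; rewrite ler_pdivrMr ?expR_gt0//.
have := expR_ge1Dxn n.+1 (ltW (mulr_gt0 k0 v0)) => /(le_trans _) E.
have {}E : (kap * u^-1) ^+ N / N`!%:R <= expR (kap * u^-1).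
  by apply: E; rewrite lerDr.
have : C * ((kap * u^-1) ^+ N / N`!%:R) <= C * expR (kap * u^-1).
  by apply: ler_wpM2l => //; exact: ltW.
have -> : C * ((kap * u^-1) ^+ N / N`!%:R) = u^-1 ^+ N.
  have aux (F K V : R) : F != 0 -> K != 0 -> F / K * (K * V / F) = V.
    by move=> F0 K0; field; apply/andP.
  rewrite exprMn; apply: aux; first by rewrite pnatr_eq0 -lt0n fact_gt0.
  by rewrite expf_neq0// gt_eqF.
have E2 : u^-1 ^+ n <= u ^+ 2 * u^-1 ^+ N.
  have uv : u * u^-1 = 1 by rewrite divff// gt_eqF.
  rewrite (_ : u ^+ 2 * u^-1 ^+ N = (u * u^-1) ^+ 2 * u^-1 ^+ n).
    by rewrite uv expr1n mul1r.
  by rewrite /N !exprS; ring.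
move=> E3; apply: le_trans E2 _; rewrite [leRHS](_ : _ = u ^+ 2 * (C * expR (kap * u^-1))).
  by apply: ler_wpM2l E3; exact: sqr_ge0.
by rewrite /C; ring.
Qed.

Lemma is_derive_expn f n u (df : R) : is_derive u 1 f df ->
  is_derive u 1 (fun z => f z ^+ n) (n%:R * f u ^+ n.-1 * df).
Proof.
move=> fdf; elim: n => [|n IH].
  by rewrite !mul0r; under eq_fun do rewrite expr0; exact: is_derive_cst.
under eq_fun do rewrite exprS.
have := is_derive_mul fdf IH; move/is_derive_eq; apply.
case: n {IH} => [|n]; first by rewrite /= !expr0; ring.
by rewrite /= exprS -[n.+2%:R]natr1; ring.
Qed.

Lemma is_derive_flat kap n u : 0 < kap ->
  is_derive u 1 (flat kap n) (kap * flat kap n.+2 u - n%:R * flat kap n.+1 u).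
Proof.
move=> k0; have [u0|u0|u0] := ltgtP u 0.
- rewrite /flat ltNge (ltW u0) /= !mulr0 subrr.
  have D0 := is_derive_cst (0 : R) u 1; apply: (near_eq_is_derive _ D0).
  by near=> z; rewrite ltNge ltW//; near: z; exact: lt_nbhsl.
- have un : u != 0 by rewrite gt_eqF.
  pose g z : R := z^-1 ^+ n * expR (- (kap * z^-1)).
  have dV : is_derive u 1 (fun z => z^-1) (- u^-1 ^+ 2).
    apply: DeriveDef; first exact: derivableV.
    by rewrite deriveV// derive_id /GRing.scale /= mulr1 exprVn.
  have dX : is_derive u 1 (fun z => z^-1 ^+ n) (n%:R * u^-1 ^+ n.-1 * - u^-1 ^+ 2).
    exact: is_derive_expn.
  have dE : is_derive u 1 (fun z => expR (- (kap * z^-1)))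
      (expR (- (kap * u^-1)) * (kap * u^-1 ^+ 2)).
    apply: (is_derive_comp (is_derive_expR _)).
    have := is_derive_opp (is_derive_mul (is_derive_cst kap u 1) dV).
    by move/is_derive_eq; apply; rewrite mul0r add0r mulrN opprK.
  apply: (@near_eq_is_derive _ _ _ g).
    by near=> z; rewrite /flat (_ : 0 < z)//; near: z; exact: lt_nbhsr.
  have := is_derive_mul dX dE; move/is_derive_eq; apply; rewrite /flat u0.
  case: n {g dX} => [|n]; first by rewrite /= !expr0 !exprS !expr0; ring.
  by rewrite [n.+1.-1]/= !exprS; ring.
- subst u; rewrite /flat ltxx !mulr0 subrr.
  have [C C0 HC] := flat_bound n k0.
  have H : h^-1 *: (flat kap n (h *: 1 + 0) - flat kap n 0) @[h --> 0^'] --> (0 : R).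
    apply/cvgr0Pnorm_le => e e0; near=> h.
    have hn : h != 0 by near: h; exact: nbhs_dnbhs_neq.
    rewrite /GRing.scale /= mulr1 addr0 {2}/flat ltxx subr0 normrM normfV.
    rewrite (ger0_norm (flat_ge0 _ _ _)).
    rewrite ler_pdivrMl ?normr_gt0//; apply: le_trans (HC h) _.
    rewrite -(real_normK (num_real h)) expr2 mulrA mulrC; apply: ler_wpM2l => //.
    rewrite -ler_pdivlMl// mulrC; near: h; apply: dnbhs0_le; exact: divr_gt0.
  apply: DeriveDef; last exact: cvg_lim H.
  by apply/cvg_ex; exists 0.
Unshelve. all: by end_near. Qed.

(** A class containing the bumps and stable under differentiation: the existence of derivatives of
    all orders becomes an induction, without any formula for them. *)
Inductive flat_algebra kap : (R -> R) -> Prop :=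
| flat_cst c : flat_algebra kap (fun=> c)
| flat_gen n c d : flat_algebra kap (fun x => flat kap n (x * c + d))
| flat_add f g : flat_algebra kap f -> flat_algebra kap g ->
    flat_algebra kap (fun x => f x + g x)
| flat_mul f g : flat_algebra kap f -> flat_algebra kap g ->
    flat_algebra kap (fun x => f x * g x).

Lemma flat_algebra_derive kap f : 0 < kap -> flat_algebra kap f ->
  exists2 df, flat_algebra kap df & forall x, is_derive x 1 f (df x).
Proof.
move=> k0; elim=> [c|n c d|{}f g _ [df Hdf df'] _ [dg Hdg dg']|{}f g Hf [df Hdf df'] Hg [dg Hdg dg']].
- by exists (fun=> 0); [exact: flat_cst|move=> x; exact: is_derive_cst].
- exists (fun x => (kap * flat kap n.+2 (x * c + d) + (- n%:R) * flat kap n.+1 (x * c + d)) * c).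
    by apply: flat_mul; [apply: flat_add; apply: flat_mul|]; try exact: flat_cst;
      exact: flat_gen.
  move=> x; have := @is_derive_comp R (flat kap n) (fun y => y * c + d) x _ _
    (is_derive_flat n (x * c + d) k0) (is_derive_affine x c d).
  by move/is_derive_eq; apply; rewrite mulNr.
- exists (fun x => df x + dg x); first exact: flat_add.
  by move=> x; exact: is_derive_add.
- exists (fun x => df x * g x + f x * dg x).
    by apply: flat_add; exact: flat_mul.
  by move=> x; exact: is_derive_mul.
Qed.

Lemma flat_algebra_smooth kap f : 0 < kap -> flat_algebra kap f ->
  forall n x, derivable (derive1n n f) x 1.
Proof.
move=> k0 Hf; have H n : flat_algebra kap (derive1n n f).
  elim: n => [//|n IH]; rewrite derive1nS.
  have [df Hdf dfE] := flat_algebra_derive k0 IH.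
  have -> : derive1 (derive1n n f) = df; last by [].
  by apply/funext => x; rewrite derive1E; exact: derive_val.
move=> n x; have [df _ dfE] := flat_algebra_derive k0 (H n).
exact: (@ex_derive _ _ _ _ _ _ _ (dfE x)).
Qed.

Definition bump a b kap x : R := flat kap 0 (x * 1 + - a) * flat kap 0 (x * -1 + b).

Lemma test_function_bump a b kap : 0 < kap -> test_function (bump a b kap).
Proof.
move=> k0; split.
  by apply: (flat_algebra_smooth k0); apply: flat_mul; exact: flat_gen.
exists (`|a| + `|b|) => x; rewrite /bump /flat; case: ifP => [ax|]; last by rewrite mul0r.
case: ifP => [xb|]; last by rewrite mulr0.
have := ler_norm (- a); have := ler_norm b; have := normr_ge0 a; have := normr_ge0 b.
move=> h1 h2 h3; rewrite normrN => h4 h5; exfalso; move: h5.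
by case: (lerP 0 x) => x0; [rewrite (ger0_norm x0)|rewrite (ltr0_norm x0)] => h5; lra.
Qed.

Lemma bump_out a b kap x : x \notin `]a, b[ -> bump a b kap x = 0.
Proof.
rewrite in_itv/= negb_and -!leNgt /bump /flat => /orP[xa|bx].
  by rewrite ltNge (_ : x * 1 + - a <= 0) ?mul0r//; lra.
by rewrite [X in _ * if X then _ else _]ltNge (_ : x * -1 + b <= 0) ?mulr0//; lra.
Qed.

Lemma flat0_itv kap u : 0 < kap -> 0 <= flat kap 0 u <= 1.
Proof.
move=> k0; rewrite flat_ge0 /flat; case: ifP => [u0|_] /=; last by rewrite ler01.
by rewrite expr0 mul1r expR_le1 oppr_le0 mulr_ge0 ?invr_ge0 ?ltW.
Qed.

Lemma bump_itv a b kap x : 0 < kap -> 0 <= bump a b kap x <= 1.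
Proof.
move=> k0; have /andP[h1 h2] := flat0_itv (x * 1 + - a) k0.
have /andP[h3 h4] := flat0_itv (x * -1 + b) k0.
by rewrite /bump mulr_ge0//= mulr_ile1.
Qed.

Lemma bump_cvg a b x : x \in `]a, b[ -> bump a b (n.+1%:R^-1) x @[n --> \oo] --> (1 : R).
Proof.
rewrite in_itv/= => /andP[ax xb].
have fl u : 0 < u -> flat (n.+1%:R^-1) 0 u @[n --> \oo] --> (1 : R).
  move=> u0; rewrite /flat u0; under eq_fun do rewrite expr0 mul1r.
  have H : - (n.+1%:R^-1 * u^-1) @[n --> \oo] --> (0 : R).
    have -> : (0 : R) = - (0 * u^-1) by rewrite mul0r oppr0.
    by apply: cvgN; apply: cvgM; [exact: cvg_harmonic|exact: cvg_cst].
  have K : expR (- (n.+1%:R^-1 * u^-1)) @[n --> \oo] --> expR (0 : R).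
    by apply: (cvg_comp _ _ H); exact: continuous_expR.
  by move: K; rewrite expR0.
have f1 : 0 < x * 1 + - a by lra.
have f2 : 0 < x * -1 + b by lra.
have K : bump a b (n.+1%:R^-1) x @[n --> \oo] --> (1 * 1 : R).
  by apply: cvgM; apply: fl.
by move: K; rewrite mulr1.
Qed.

Lemma continuous_bump a b kap : 0 < kap -> continuous (bump a b kap).
Proof.
move=> k0; have [df _ dfE] := flat_algebra_derive k0
  (flat_mul (flat_gen kap 0 1 (- a)) (flat_gen kap 0 (-1) b)).
exact: is_derive_continuous dfE.
Qed.

Lemma loc_integrable_itv (h : R -> R) a b : loc_integrable h -> integ `[a, b] h.
Proof.
move=> [_ /(_ (`|a| + `|b|))]; apply: integrableS => //; try exact: measurable_itv.
move=> x /=; rewrite !in_itv/= => /andP[ax xb].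
have := ler_norm (- a); have := ler_norm b; have := normr_ge0 a; have := normr_ge0 b.
by rewrite normrN => h1 h2 h3 h4; apply/andP; split; lra.
Qed.

(* The bumps [e^(-1/(k(x-a))) e^(-1/(k(b-x)))] increase to the indicator of [(a, b)]. *)
Lemma integral_itv_eq0 (h : R -> R) a b : loc_integrable h ->
  (forall phi, test_function phi -> Rintegral mu setT (fun x => h x * phi x) = 0) ->
  Rintegral mu `[a, b] h = 0.
Proof.
move=> lh h0; pose D := `]a, b[%classic : set RT.
have mD : measurable D by exact: measurable_itv.
have hab := loc_integrable_itv a b lh.
have hD : integ D h.
  apply: (integrableS _ mD _ hab); first exact: measurable_itv.
  by move=> x; rewrite /D /= !in_itv/= => /andP[/ltW -> /ltW ->].
pose k n : R := n.+1%:R^-1; have k0 n : 0 < k n by rewrite invr_gt0 ltr0n.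
pose f n x := h x * bump a b (k n) x.
have f0 n : Rintegral mu D (f n) = 0.
  rewrite -(h0 _ (test_function_bump a b (k0 n))) Rintegral_mkcond.
  apply: eq_Rintegral => x _; rewrite patchE; case: ifPn => // xD.
  by rewrite bump_out ?mulr0//; apply: contra xD => xD; rewrite inE.
have mh := integrable_measurable hD.
have mf n : measurable_fun D (f n).
  apply: measurable_funM => //; apply: measurable_funTS.
  exact: continuous_measurable_fun (@continuous_bump a b _ (k0 n)).
have [] := @dominated_convergence _ _ _ mu D mD (fun n => EFin \o f n) (EFin \o h)
  (fun x => `|(h x)%:E|)%E.
- by move=> n; exact/measurable_EFinP.
- exact/measurable_EFinP.
- apply/aeW => x Dx /=; apply/fine_cvgP; split; first by near=> n.
  rewrite -[h x in X in _ --> X]mulr1; apply: cvgMr; exact: bump_cvg.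
- exact: integrable_abse hD.
- apply/aeW => x n _; rewrite /= lee_fin normrM -[leRHS]mulr1; apply: ler_wpM2l => //.
  by have /andP[h1 h2] := bump_itv a b x (k0 n); rewrite ger0_norm.
move=> _ _ cv; have h0' : (\int[mu]_(x in D) (h x)%:E)%E = 0%E.
  have E0 n : (\int[mu]_(x in D) (f n x)%:E)%E = 0%E.
    rewrite -[LHS]fineK; first by congr EFin; exact: f0.
    apply: (integrable_fin_num mD).
    apply: (integrable_mul_bounded mD hD (C := 1)).
      apply: measurable_funTS.
      exact: continuous_measurable_fun (@continuous_bump a b _ (k0 n)).
    by move=> x _; have /andP[h1 h2] := bump_itv a b x (k0 n); rewrite ger0_norm.
  apply: (cvg_unique _ cv) => //; rewrite /= (_ : (fun n => _) = fun=> 0%E); first exact: cvg_cst.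
  by apply/funext => n; exact: E0.
have : Rintegral mu D h = 0 by rewrite /Rintegral h0'.
rewrite /D Rintegral_itv_bndo_bndc//.
rewrite Rintegral_itv_obnd_cbnd//; apply: integrableS hab; try exact: measurable_itv.
by apply: subset_itvr; rewrite bnd_simp.
Unshelve. all: by end_near. Qed.

(** The integral over every compact interval vanishes, so the primitive is constant, and by Lebesgue
    differentiation its derivative is [h] almost everywhere. Primitives start at the left ends [-n],
    whence the countable intersection. *)
Lemma ae_eq0_of_test_functions (h : R -> R) : loc_integrable h ->
  (forall phi, test_function phi -> Rintegral mu setT (fun x => h x * phi x) = 0) ->
  {ae mu, forall x, h x = 0}.
Proof.
move=> lh h0; have hloc : locally_integrable setT h.
  split; [exact: lh.1|exact: openT|move=> K _ cK; have [M [_ HM]] := compact_bounded cK].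
  have KM : K `<=` `[- (M + 1), M + 1].
    by move=> x /(HM (M + 1)); rewrite ltrDl ltr01 /= in_itv/= -ler_norml; exact.
  have /integrableP[mh ih] := loc_integrable_itv (- (M + 1)) (M + 1) lh.
  apply: le_lt_trans ih; apply: ge0_subset_integral => //.
  - exact: compact_measurable.
  - apply/measurable_EFinP; apply: measurableT_comp => //.
    by move/measurable_EFinP : mh.
have H (n : nat) : {ae mu, forall x, - n%:R < x -> h x = 0}.
  have := FTC1 (a := BLeft (- n%:R)) (fun y => loc_integrable_itv _ y lh) hloc.
  apply: filterS; first exact: (ae_filter_ringOfSetsType mu).
  move=> x /= H nx.
  have nx' : ((- n%:R)%:E < x%:E)%E by rewrite lte_fin.
  have [_ <-] := H nx'.
  rewrite (_ : (fun _ => _) = cst 0) ?derive1_cst//.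
  by apply/funext => y; exact: integral_itv_eq0.
have FF := ae_filter_ringOfSetsType mu.
apply: (@filterS _ _ FF _ _ _ (ae_foralln H)) => x Hx.
have [n nx] : exists n : nat, - x < n%:R by exists (Num.bound `|x|); apply: le_lt_trans (archi_boundP (normr_ge0 x)); rewrite -normrN ler_norm.
by apply: (Hx n); rewrite ltrNl.
Qed.

End TestFunctions.

(** * The decomposition into blocks *)

Section Convergence.
Variable R : realType.
Local Notation RT := (measurableTypeR R).
Local Notation mu := (@lebesgue_measure R).
Local Notation integ A f := (mu.-integrable A (EFin \o f)).
Implicit Types (s gamma alpha tau : R) (gr gi fr fi : R -> R).

Lemma one_le_powR (a b : R) : 1 <= a -> 0 <= b -> 1 <= a `^ b.
Proof. by move=> a1 b0; have := ler_powR a1 b0; rewrite powRr0. Qed.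

Definition node (b : R) (j : nat) : R := j%:R `^ b.

Lemma node0 b : 0 < b -> node b 0 = 0.
Proof. by move=> b0; rewrite /node powR0 ?gt_eqF. Qed.

Lemma node_ge0 b j : 0 <= node b j. Proof. exact: powR_ge0. Qed.

Lemma node_lt b j : 0 < b -> node b j < node b j.+1.
Proof. by move=> b0; apply: gt0_ltr_powR; rewrite ?nnegrE ?ler0n// ltr_nat. Qed.

Lemma node_cvgy b : 1 <= b -> node b n @[n --> \oo] --> +oo.
Proof.
move=> b1; apply/cvgryPge => A; near=> n.
have n1 : (1 <= n)%N by near: n; exact: nbhs_infty_ge.
apply: (@le_trans _ _ n%:R); last by apply: le1r_powR => //; rewrite ler1n.
by near: n; exact: nbhs_infty_ger.
Unshelve. all: by end_near. Qed.

Lemma sobolev_weight s gr gi : Hs_hat s gr gi ->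
  integ setT (fun x : RT => (1 + x ^+ 2) `^ s * (gr x ^+ 2 + gi x ^+ 2)).
Proof.
move=> [mr [mi fin]]; apply/integrableP; split.
  apply/measurable_EFinP; apply: measurable_funM.
    apply: (measurableT_comp (measurable_powR s)).
    apply: measurable_funD => //; apply: measurable_funX; exact: measurable_id.
  by apply: measurable_funD; apply: measurable_funX.
apply: le_lt_trans fin; rewrite le_eqVlt; apply/orP; left; apply/eqP.
apply: eq_integral => x _; rewrite gee0_abs// lee_fin mulr_ge0 ?powR_ge0//.
by rewrite addr_ge0 ?sqr_ge0.
Qed.

Lemma sobolev_sqr_integrable s gr gi : 0 <= s -> Hs_hat s gr gi ->
  integ setT (fun x : RT => gr x ^+ 2) /\ integ setT (fun x : RT => gi x ^+ 2).
Proof.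
move=> s0 H; have iw := sobolev_weight H; case: H => mr [mi _].
have w1 (x : R) : 1 <= (1 + x ^+ 2) `^ s.
  by apply: one_le_powR => //; rewrite lerDl sqr_ge0.
split; apply: (le_integrable measurableT _ _ iw).
- by apply/measurable_EFinP; apply: measurable_funX; exact: mr.
- move=> x _ /=; rewrite lee_fin !ger0_norm ?sqr_ge0 ?mulr_ge0 ?powR_ge0 ?addr_ge0 ?sqr_ge0//.
  rewrite -[leLHS]mul1r; apply: ler_pM; rewrite ?sqr_ge0//.
  by rewrite lerDl sqr_ge0.
- by apply/measurable_EFinP; apply: measurable_funX; exact: mi.
- move=> x _ /=; rewrite lee_fin !ger0_norm ?sqr_ge0 ?mulr_ge0 ?powR_ge0 ?addr_ge0 ?sqr_ge0//.
  rewrite -[leLHS]mul1r; apply: ler_pM; rewrite ?sqr_ge0//.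
  by rewrite lerDr sqr_ge0.
Qed.

(** The weight at the right end of a block is controlled by the weight at any of its points, since
    [(j+1)^b <= 2^b (|x| + 1)]; the 1 handles the block starting at 0. *)
Lemma node_weight s b (j : nat) (x : R) : 0 <= s -> 0 < b -> node b j <= `|x| ->
  (node b j.+1 ^+ 2) `^ s <= (2 * (2 `^ b) ^+ 2) `^ s * (1 + x ^+ 2) `^ s.
Proof.
move=> s0 b0 jx; have c0 : 0 < (2 : R) `^ b by exact: powR_gt0.
have x2 := sqr_ge0 x.
rewrite -powRM; [|by rewrite mulr_ge0 ?sqr_ge0|by rewrite addr_ge0].
apply: ge0_ler_powR => //; rewrite ?nnegrE ?sqr_ge0//.
  by rewrite mulr_ge0 ?addr_ge0// mulr_ge0 ?sqr_ge0.
have w : node b j.+1 <= 2 `^ b * (`|x| + 1).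
  rewrite /node in jx *; case: j jx => [|j] jx.
    rewrite powR1 -[leLHS]mulr1; apply: ler_pM => //; last by rewrite lerDr.
    by apply: one_le_powR; rewrite ?ler1n// ltW.
  apply: (@le_trans _ _ (2 `^ b * j.+1%:R `^ b)).
    rewrite -powRM//; apply: ge0_ler_powR; [exact: ltW|by rewrite nnegrE ler0n|by rewrite nnegrE mulr_ge0|].
    by rewrite -natrM ler_nat mul2n -addnn addSn ltnS leq_addl.
  apply: ler_wpM2l; first exact: ltW.
  by apply: le_trans jx _; rewrite lerDl.
apply: (@le_trans _ _ ((2 `^ b * (`|x| + 1)) ^+ 2)).
  by rewrite ler_pXn2r ?nnegrE ?node_ge0// mulr_ge0 ?(ltW c0)// addr_ge0.
rewrite exprMn [leRHS](_ : _ = (2 `^ b) ^+ 2 * (2 * (1 + x ^+ 2))); last by ring.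
apply: ler_wpM2l; first exact: sqr_ge0.
rewrite -(real_normK (num_real x)); move: (`|x|) => z; have := sqr_ge0 (z - 1); nra.
Qed.

(** Opposite blocks are taken together so that partial sums are integrals over symmetric
    intervals. *)
Definition block_pair gr gi b j (y Y t : R) : R :=
  Rintegral mu `[node b j, node b j.+1] (osc gr gi y Y t) +
  Rintegral mu `[- node b j.+1, - node b j] (osc gr gi y Y t).

Definition pair_majorant gr gi b j (x : R) : R :=
  piece_majorant gr gi (node b j) (node b j.+1) x +
  piece_majorant gr gi (- node b j.+1) (- node b j) x.

Lemma block_pair_bound gr gi b tau C0 j (x y Y t : R) :
  (forall u v, integ `[u, v] gr) -> (forall u v, integ `[u, v] gi) ->
  0 < tau -> tau < 1 -> b = (1 - tau)^-1 -> 0 <= y -> y <= 1 -> 0 <= t -> 0 <= C0 ->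
  y + (`|Y - x| + t) <= C0 * y `^ tau ->
  `|block_pair gr gi b j y Y t| <=
  (1 + C0 * (2 * b) * (expR 1 * (1 + 2 `^ b))) * pair_majorant gr gi b j x.
Proof.
move=> ir ii tau0 tau1 bE y0 y1 t0 C00 H.
have b0 : 0 < b by rewrite bE invr_gt0; lra.
have lt1 := node_lt j b0; have lt2 : - node b j.+1 < - node b j by rewrite ltrN2.
set e := 1 + _.
have gen (sg u v : R) : u < v -> v - u = node b j.+1 - node b j -> `|sg| = 1 ->
    (forall z, z \in `[u, v] -> node b j <= z * sg /\ `|z| = z * sg) ->
    `|Rintegral mu `[u, v] (osc gr gi y Y t)| <= e * piece_majorant gr gi u v x.
  move=> uv uvE sg1 zd.
  apply: le_trans (piece_bound x Y t uv (ir _ _) (ii _ _) y0 sg1 zd) _.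
  apply: ler_wpM2r; first exact: piece_majorant_ge0.
  rewrite uvE; apply: (block_factor_bound j tau0 tau1 y0 y1 _ _ C00 bE).
    by rewrite addr_ge0.
  apply: le_trans H; rewrite lerD2l; apply: le_trans (ler_normD _ _) _.
  by rewrite normrM sg1 mulr1 (ger0_norm t0).
rewrite /block_pair /pair_majorant mulrDr; apply: le_trans (ler_normD _ _) _.
apply: lerD.
  apply: (gen 1) => //; first by rewrite normr1.
  move=> z; rewrite in_itv/= mulr1 => /andP[h1 h2]; split => //.
  by rewrite ger0_norm// (le_trans _ h1)// node_ge0.
apply: (gen (-1)) => //; [by ring|by rewrite normrN normr1|].
move=> z; rewrite in_itv/= mulrN1 => /andP[h1 h2]; split; first by rewrite lerNr.
by rewrite ler0_norm// (le_trans h2)// oppr_le0 node_ge0.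
Qed.

Lemma block_pair_cvg gr gi b j (x : R) (y Y : R -> R) : 0 < b ->
  (forall u v, integ `[u, v] gr) -> (forall u v, integ `[u, v] gi) ->
  (forall t, 0 <= y t) -> y t @[t --> 0^'+] --> (0 : R) -> Y t @[t --> 0^'+] --> x ->
  block_pair gr gi b j (y t) (Y t) t @[t --> 0^'+] --> block_pair gr gi b j 0 x 0.
Proof.
move=> b0 ir ii y0 cy cY.
have zero : (y t + `|Y t - x| + t) @[t --> 0^'+] --> (0 : R).
  have Z : (y t + `|Y t - x| + t) @[t --> 0^'+] --> (0 + `|x - x| + 0 : R).
    apply: cvgD; last by apply: cvg_at_right_filter; exact: cvg_id.
    by apply: cvgD => //; apply: cvg_norm; apply: cvgB => //; exact: cvg_cst.
  by move: Z; rewrite subrr normr0 !addr0.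
have gen u v : (forall z, z \in `[u, v] -> `|z| <= node b j.+1) ->
    Rintegral mu `[u, v] (osc gr gi (y t) (Y t) t) @[t --> 0^'+] -->
    Rintegral mu `[u, v] (osc gr gi 0 x 0).
  move=> uvb; set K := node b j.+1 * Rintegral mu `[u, v] (fun z => `|gr z| + `|gi z|).
  have K0 : (y t + `|Y t - x| + t) * K @[t --> 0^'+] --> (0 : R).
    have Z : (y t + `|Y t - x| + t) * K @[t --> 0^'+] --> (0 * K : R).
      by apply: cvgM => //; exact: cvg_cst.
    by move: Z; rewrite mul0r.
  apply/cvgrPdist_le => eps eps0; move/cvgr0Pnorm_le : K0 => /(_ _ eps0) K0.
  near=> t; rewrite distrC; have t0 : 0 <= t by apply: ltW; near: t; exact: nbhs_right_gt.
  apply: le_trans (piece_limit_bound x (Y t) (ir _ _) (ii _ _) (y0 t) t0 uvb) _.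
  by rewrite -mulrA; apply: le_trans (ler_norm _) _; near: t.
apply: cvgD; apply: gen => z; rewrite in_itv/= => /andP[h1 h2].
  by rewrite (ger0_norm (le_trans (node_ge0 b j) h1)).
have z0 : z <= 0 by apply: le_trans h2 _; rewrite oppr_le0; exact: node_ge0.
by rewrite (ler0_norm z0) lerNl.
Unshelve. all: by end_near. Qed.

End Convergence.

(** * Summability of the majorants and limits at almost every point *)

Section AlmostEverywhere.
Variable R : realType.
Local Notation RT := (measurableTypeR R).
Local Notation mu := (@lebesgue_measure R).
Local Notation integ A f := (mu.-integrable A (EFin \o f)).
Implicit Types (s gamma alpha tau : R) (gr gi fr fi : R -> R).

(** The condition on [s] says exactly that [max(0, 1 - 2s) < min(1, alpha / gamma)]; in each of the
    four cases the witness is the midpoint of these two numbers. *)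
Lemma exists_tau s gamma alpha : 0 < gamma -> 0 < alpha ->
  2^-1 * Num.max 0 (1 - alpha / gamma) < s ->
  exists tau, [/\ 0 < tau, tau < 1, tau <= alpha / gamma & 1 - tau < 2 * s].
Proof.
move=> g0 a0; have q0 : 0 < alpha / gamma by exact: divr_gt0.
move: (alpha / gamma) q0 => q q0 H.
have h0 : 0 < s by apply: le_lt_trans H; rewrite mulr_ge0 ?invr_ge0// le_max lexx.
have h1 : 1 - q < 2 * s.
  have : 1 - q <= Num.max 0 (1 - q) by rewrite le_max lexx orbT.
  by move: (Num.max _ _) H => m H; lra.
have [q1|q1] := leP 1 q; have [s1|s1] := leP 0 (1 - 2 * s).
- by exists (1 - s); split; lra.
- by exists (2^-1); split; lra.
- by exists ((1 - 2 * s + q) / 2); split; lra.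
- by exists (q / 2); split; lra.
Qed.

(** The data are only square integrable. Since [e^2 <= e], the product of the damping with
    [|g| + |h|] is dominated by the damping, integrable for [y > 0], plus the squares. *)
Lemma osc_le (e c d g h : R) : 0 <= e -> e <= 1 -> `|c| <= 1 -> `|d| <= 1 ->
  `|e * (g * c - h * d)| <= e + (g ^+ 2 + h ^+ 2).
Proof.
move=> e0 e1 c1 d1; rewrite normrM (ger0_norm e0).
have H : `|g * c - h * d| <= `|g| + `|h|.
  apply: le_trans (ler_normB _ _) _; rewrite !normrM.
  by apply: lerD; rewrite -[leRHS]mulr1; apply: ler_wpM2l.
apply: le_trans (ler_wpM2l e0 H) _.
rewrite -(real_normK (num_real g)) -(real_normK (num_real h)).
move: (`|g|) (`|h|) => u v; have := sqr_ge0 (e - u); have := sqr_ge0 (e - v).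
have := sqr_ge0 u; have := sqr_ge0 v; have : e * e <= e * 1 by apply: ler_wpM2l.
by rewrite !expr2; lra.
Qed.

Lemma integrable_osc_T gr gi (y Y t : R) : 0 < y ->
  measurable_fun setT (gr : RT -> R) -> measurable_fun setT (gi : RT -> R) ->
  integ setT (fun x : RT => gr x ^+ 2) -> integ setT (fun x : RT => gi x ^+ 2) ->
  integ setT (osc gr gi y Y t).
Proof.
move=> y0 mr mi ir2 ii2.
have ie := integrable_expRN_norm y0.
have ib := integrable_add measurableT ie (integrable_add measurableT ir2 ii2).
apply: (le_integrable measurableT _ _ ib).
  apply/measurable_EFinP; apply: measurable_funM; first exact: measurable_expRN_norm.
  apply: measurable_funB; apply: measurable_funM => //.
  - exact: measurable_cos_osc.
  - exact: measurable_sin_osc.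
move=> z _ /=; rewrite lee_fin /osc; cbv beta.
rewrite [leRHS]ger0_norm; last by rewrite addr_ge0 ?addr_ge0 ?sqr_ge0 ?expR_ge0.
apply: osc_le; [exact: expR_ge0| |exact: cos_max|exact: sin_max].
by rewrite expR_le1 oppr_le0 mulr_ge0// ltW.
Qed.

Lemma powR_le_one (a c : R) : 0 <= a -> a <= 1 -> 0 <= c -> a `^ c <= 1.
Proof.
move=> a0 a1 c0; have := @ge0_ler_powR R c c0 a 1; rewrite powR1; apply => //.
by rewrite nnegrE.
Qed.

(** Take [lam j] to be the Sobolev weight at the right end of block [j]. Then the [lam^-1] terms
    form the series of [(j+1)^(-2bs)], convergent by [1 < b (2s)], while the [lam] terms add up to
    at most a constant times the squared Sobolev norm. *)
Lemma pair_majorant_summable s b gr gi (M : R) : 0 < M -> 0 <= s -> 0 < b ->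
  1 < b * (2 * s) -> Hs_hat s gr gi ->
  (forall j, integ `[- M, M] (pair_majorant gr gi b j)) /\
  exists K, forall n,
    \sum_(0 <= j < n) Rintegral mu `[- M, M] (pair_majorant gr gi b j) <= K.
Proof.
move=> M0 s0 b0 p1 H; have iG := sobolev_weight H.
have [ir2 ii2] := sobolev_sqr_integrable s0 H; case: H => mr [mi _].
have mI : measurable (`[- M, M]%classic : set RT) by exact: measurable_itv.
pose G (x : RT) : R := (1 + x ^+ 2) `^ s * (gr x ^+ 2 + gi x ^+ 2).
have G0 x : 0 <= G x by rewrite mulr_ge0 ?powR_ge0// addr_ge0 ?sqr_ge0.
have iSr u v : integ `[u, v] (fun x : RT => gr x ^+ 2).
  by apply: integrableS ir2 => //; exact: measurable_itv.
have iSi u v : integ `[u, v] (fun x : RT => gi x ^+ 2).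
  by apply: integrableS ii2 => //; exact: measurable_itv.
have iSG u v : integ `[u, v] G by apply: integrableS iG => //; exact: measurable_itv.
pose lam j := (node b j.+1 ^+ 2) `^ s.
have n1 j : 0 < node b j.+1 by apply: powR_gt0; rewrite ltr0n.
have lam0 j : 0 < lam j by apply: powR_gt0; rewrite exprn_gt0.
pose C' : R := (2 * (2 `^ b) ^+ 2) `^ s.
have C'0 : 0 <= C' by exact: powR_ge0.
have one j u v : u < v -> (forall z, z \in `[u, v] -> node b j <= `|z|) ->
    integ `[- M, M] (piece_majorant gr gi u v) /\
    Rintegral mu `[- M, M] (piece_majorant gr gi u v) <=
      2 * bessel_const M * (4 * (lam j)^-1 + 2 * (C' * Rintegral mu `[u, v] G)).
  move=> uv uvj; have mE : measurable (`[u, v]%classic : set RT) by exact: measurable_itv.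
  have mru : measurable_fun (`[u, v]%classic : set RT) (gr : RT -> R) := measurable_funTS mr.
  have miu : measurable_fun (`[u, v]%classic : set RT) (gi : RT -> R) := measurable_funTS mi.
  have [i1 i2] := piece_majorant_L1 M0 (lam0 j) uv mru miu (iSr u v) (iSi u v).
  split => //; apply: le_trans i2 _.
  apply: ler_wpM2l; first by rewrite mulr_ge0// bessel_const_ge0.
  rewrite lerD2l; apply: ler_wpM2l => //.
  have iq := integrable_add mE (iSr u v) (iSi u v).
  rewrite -(RintegralZl _ mE iq) -(RintegralZl _ mE (iSG u v)).
  apply: (le_Rintegral mE (integrable_scale _ mE iq) (integrable_scale _ mE (iSG u v))).
  move=> z zE; rewrite /G mulrA; apply: ler_wpM2r; first by rewrite addr_ge0 ?sqr_ge0.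
  by apply: node_weight => //; exact: uvj.
have two j : integ `[- M, M] (pair_majorant gr gi b j) /\
    Rintegral mu `[- M, M] (pair_majorant gr gi b j) <=
      2 * bessel_const M * (8 * j.+1%:R `^ (- (b * (2 * s))) + 2 * (C' *
       (Rintegral mu `[node b j, node b j.+1] G + Rintegral mu `[- node b j.+1, - node b j] G))).
  have l1 := node_lt j b0; have l2 : - node b j.+1 < - node b j by rewrite ltrN2.
  have A1 z : z \in `[node b j, node b j.+1] -> node b j <= `|z|.
    rewrite in_itv/= => /andP[h1 h2].
    by rewrite (ger0_norm (le_trans (node_ge0 b j) h1)).
  have A2 z : z \in `[- node b j.+1, - node b j] -> node b j <= `|z|.
    rewrite in_itv/= => /andP[h1 h2].
    have z0 : z <= 0 by apply: le_trans h2 _; rewrite oppr_le0; exact: node_ge0.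
    by rewrite (ler0_norm z0) lerNr.
  have [i1 b1] := one j _ _ l1 A1; have [i2 b2] := one j _ _ l2 A2.
  split; first exact: (integrable_add mI i1 i2).
  rewrite /pair_majorant (RintegralD mI i1 i2); apply: le_trans (lerD b1 b2) _.
  have -> : j.+1%:R `^ (- (b * (2 * s))) = (lam j)^-1.
    rewrite powRN /lam /node -(powR_mulrn 2) ?powR_ge0// -!powRrM.
    by congr (_ `^ _)^-1; ring.
  by rewrite le_eqVlt; apply/orP; left; apply/eqP; ring.
split; first by move=> j; exact: (two j).1.
exists (2 * bessel_const M * (8 * (1 + (b * (2 * s) - 1)^-1) + 2 * (C' * Rintegral mu setT G))) => n.
apply: le_trans (ler_sum _ (fun j _ => (two j).2)) _.
rewrite -mulr_sumr; apply: ler_wpM2l; first by rewrite mulr_ge0// bessel_const_ge0.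
rewrite big_split/= -!mulr_sumr; apply: lerD.
  by apply: ler_wpM2l => //; rewrite big_mkord; exact: sum_powR_le.
apply: ler_wpM2l => //; apply: ler_wpM2l => //.
rewrite sum_Rintegral_sym; [|exact: node0|by move=> j; exact/ltW/node_lt|exact: iSG].
by apply: le_Rintegral_subset => //; exact: measurable_itv.
Qed.

Lemma five_bound (y u d t e v w : R) :
  y <= w -> u <= w -> t <= u -> d <= e -> e <= v -> y + (d + t) <= v + 2 * w.
Proof. by lra. Qed.

(** Only the displacement bound at the single point [x] is used of the curve. The limit is also the
    limit of the partial inverse transforms [T n], which do not see the curve; this is how it will
    be identified. *)
Lemma tannery_at_point gr gi gamma alpha tau b (C3 : R) (Y : R -> R) (x : R) :
  0 < gamma -> 0 < tau -> tau < 1 -> tau <= alpha / gamma -> alpha <= 1 -> 0 < alpha ->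
  b = (1 - tau)^-1 -> 0 < C3 ->
  measurable_fun setT (gr : RT -> R) -> measurable_fun setT (gi : RT -> R) ->
  integ setT (fun x : RT => gr x ^+ 2) -> integ setT (fun x : RT => gi x ^+ 2) ->
  (forall t, 0 <= t <= 1 -> `|Y t - x| <= C3 * t `^ alpha) ->
  cvgn (series (fun j => pair_majorant gr gi b j x)) ->
  let C := 1 + (C3 + 2) * (2 * b) * (expR 1 * (1 + 2 `^ b)) in
  let T n := Rintegral mu `[- node b n, node b n] (osc gr gi 0 x 0) in
  (forall n, `|T n| <= C * series (fun j => pair_majorant gr gi b j x) n) /\
  exists2 l : R, T n @[n --> \oo] --> l &
    Rintegral mu setT (osc gr gi (t `^ gamma) (Y t) t) @[t --> 0^'+] --> l.
Proof.
move=> g0 tau0 tau1 tauq a1 a0 bE C30 mr mi ir2 ii2 HY cD C T.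
have b1 : 1 <= b by rewrite bE invf_ge1//; lra.
have b0 : 0 < b by exact: lt_le_trans b1.
have ir u v : integ `[u, v] gr.
  apply: (integrable_sqr (measurable_itv _) (mu_itv_lty u v) (measurable_funTS mr)).
  by apply: integrableS ir2 => //; exact: measurable_itv.
have ii u v : integ `[u, v] gi.
  apply: (integrable_sqr (measurable_itv _) (mu_itv_lty u v) (measurable_funTS mi)).
  by apply: integrableS ii2 => //; exact: measurable_itv.
have y01 t : 0 < t <= 1 -> 0 < t `^ gamma <= 1.
  move=> /andP[t0 t1]; rewrite powR_gt0//=.
  by apply: powR_le_one; rewrite // ltW.
have bound j t : 0 < t <= 1 ->
    `|block_pair gr gi b j (t `^ gamma) (Y t) t| <= C * pair_majorant gr gi b j x.
  move=> t01; have /andP[y0 y1] := y01 t t01; have /andP[t0 t1] := t01.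
  apply: (@block_pair_bound R gr gi b tau (C3 + 2)) => //; try exact: ltW.
    by rewrite addr_ge0// ltW.
  (* With [y = t^gamma <= 1], the damping [y], the displacement [C3 t^alpha] and the time [t] are
     each at most a constant times [y^tau]: here [tau <= alpha / gamma] and [alpha <= 1] enter. The
     constants 1, [C3] and 1 add up to [C3 + 2]. *)
  have h1 : t `^ gamma <= (t `^ gamma) `^ tau by apply: ger1_powR; rewrite ?y0 ?y1// ltW.
  have h2 : t `^ alpha <= (t `^ gamma) `^ tau.
    have -> : t `^ alpha = (t `^ gamma) `^ (alpha / gamma).
      by rewrite -powRrM mulrCA divff ?mulr1// gt_eqF.
    by apply: ger_powR => //; rewrite y0 y1.
  have h3 : t <= t `^ alpha by apply: ger1_powR; rewrite ?t0 ?t1.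
  have h4 := HY t; rewrite (ltW t0) t1 in h4; have {}h4 := h4 isT.
  have h5 : C3 * t `^ alpha <= C3 * (t `^ gamma) `^ tau by apply: ler_wpM2l h2; exact: ltW.
  by rewrite mulrDl; exact: (five_bound h1 h2 h3 h4 h5).
have cY : Y t @[t --> 0^'+] --> x.
  apply/cvgrPdist_le => e e0.
  have K : C3 * t `^ alpha @[t --> 0^'+] --> (0 : R).
    have Z : C3 * t `^ alpha @[t --> 0^'+] --> (C3 * 0 : R).
      by apply: cvgM; [exact: cvg_cst|exact: powR_cvg0].
    by move: Z; rewrite mulr0.
  move/cvgr0Pnorm_le : K => /(_ _ e0) K; near=> t; rewrite distrC.
  apply: le_trans (HY t _) _.
    apply/andP; split; last by near: t; exact: nbhs_right_le.
    by apply: ltW; near: t; exact: nbhs_right_gt.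
  by apply: le_trans (ler_norm _) _; near: t.
have serE y Y' t n : 0 <= y -> series (fun j => block_pair gr gi b j y Y' t) n =
    Rintegral mu `[- node b n, node b n] (osc gr gi y Y' t).
  move=> y0; rewrite /series /= sum_Rintegral_sym//; first exact: node0.
    by move=> j; exact/ltW/node_lt.
  by move=> u v; apply: integrable_osc => //; exact: measurable_itv.
have cD' : cvgn (series (fun j => C * pair_majorant gr gi b j x)).
  have -> : series (fun j => C * pair_majorant gr gi b j x) =
      (fun n => C * series (fun j => pair_majorant gr gi b j x) n).
    by apply/funext => n; rewrite /series /= -mulr_sumr.
  by apply: is_cvgMr.
have lim t : 0 < t <= 1 -> series (fun j => block_pair gr gi b j (t `^ gamma) (Y t) t) n @[n --> \oo] -->
    Rintegral mu setT (osc gr gi (t `^ gamma) (Y t) t).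
  move=> t01; have /andP[y0 y1] := y01 t t01.
  rewrite (_ : series _ = (fun n => Rintegral mu `[- node b n, node b n] (osc gr gi (t `^ gamma) (Y t) t))).
    by apply: cvg_Rintegral_sym; [exact: integrable_osc_T|exact: node_cvgy].
  by apply/funext => n; rewrite serE// ltW.
have bc j := @block_pair_cvg R gr gi b j x (fun t => t `^ gamma) Y b0 ir ii
  (fun t => powR_ge0 t gamma) (powR_cvg0 g0) cY.
have [cf fD fl] := tannery bound bc cD' lim.
split.
  move=> n; rewrite /T -serE// /series /= mulr_sumr.
  apply: le_trans (ler_norm_sum _ _ _) _; apply: ler_sum => j _; exact: fD.
exists (limn (series (fun j => block_pair gr gi b j 0 x 0))) => //.
rewrite (_ : T = series (fun j => block_pair gr gi b j 0 x 0)); first exact: cf.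
by apply/funext => n; rewrite serE.
Unshelve. all: by end_near. Qed.

End AlmostEverywhere.

(** * Identification of the limit *)

Section Identification.
Variable R : realType.
Local Notation RT := (measurableTypeR R).
Local Notation mu := (@lebesgue_measure R).
Local Notation integ A f := (mu.-integrable A (EFin \o f)).
Implicit Types (s gamma alpha tau : R) (gr gi fr fi : R -> R).

Lemma cvg_fine_limn_esup (u : nat -> R) (l : R) : u n @[n --> \oo] --> l ->
  fine (limn_esup (fun n => (u n)%:E)) = l.
Proof.
move=> ul; have ul' : (u n)%:E @[n --> \oo] --> l%:E by apply: cvg_EFin => //; exact: nearW.
by rewrite (is_cvg_limn_esupE (cvgP _ ul')) (cvg_lim _ ul').
Qed.

Lemma osc0E gr gi (x : R) (z : R) : osc gr gi 0 x 0 z =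
  gr z * cos (x * z + 0) - gi z * cos (x * z + - (pi / 2)).
Proof. by rewrite /osc; cbv beta; rewrite !mul0r oppr0 expR0 mul1r !addr0 cosBpihalf. Qed.

Lemma partial_inverseE gr gi (a b x : R) : integ `[a, b] gr -> integ `[a, b] gi ->
  Rintegral mu `[a, b] (osc gr gi 0 x 0) =
  cos_transform gr a b 0 x - cos_transform gi a b (- (pi / 2)) x.
Proof.
move=> ir ii; have mE : measurable (`[a, b]%classic : set RT) by exact: measurable_itv.
rewrite /cos_transform -(RintegralB mE (integrable_mul_cos x 0 mE ir)
  (integrable_mul_cos x (- (pi / 2)) mE ii)).
by apply: eq_Rintegral => z _; exact: osc0E.
Qed.

Lemma check_supported (phi : R -> R) (M : R) (psi : R -> R) :
  (forall x, M < `|x| -> phi x = 0) ->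
  Rintegral mu setT (fun x => psi x * phi x) = Rintegral mu `[- M, M] (fun x => psi x * phi x).
Proof.
move=> phi0; rewrite [RHS]Rintegral_mkcond; apply: eq_Rintegral => x _.
rewrite patchE; case: ifPn => // xM; rewrite phi0 ?mulr0//.
by rewrite ltNge; apply: contra xM => xM; rewrite inE /= in_itv/= -ler_norml.
Qed.

Lemma test_function_continuous (phi : R -> R) : test_function phi -> continuous phi.
Proof.
move=> [d _] x; apply: differentiable_continuous; apply/derivable1_diffP.
exact: (d 0%N x).
Qed.

(** Testing a partial inverse transform amounts to truncating the frequency integral that appears in
    [fourier_pair], so the two can be compared as the truncation is removed. *)
Lemma pairing_partial_inverse gr gi (a b M : R) (phi : R -> R) :
  integ `[a, b] gr -> integ `[a, b] gi -> continuous phi ->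
  (forall x, M < `|x| -> phi x = 0) ->
  Rintegral mu `[- M, M] (fun x => Rintegral mu `[a, b] (osc gr gi 0 x 0) * phi x) =
  Rintegral mu `[a, b] (fun z => gr z * check_re phi z - gi z * check_im phi z).
Proof.
move=> ir ii cphi phi0; pose I := `[- M, M]%classic : set RT.
pose E := `[a, b]%classic : set RT.
have mE : measurable E by exact: measurable_itv.
have mI : measurable I by exact: measurable_itv.
have iphi : integ I phi by exact: integrable_continuous_itv.
have kC p (x y : RT) : `|cos (x * y + p)| <= 1 by exact: cos_max.
have kC' p (x y : RT) : `|cos (y * x + p)| <= 1 by exact: cos_max.
have [i1 f1] := fubini_kernel mI mE iphi ir (measurable_cos_phase 0) (kC 0).
have [i2 f2] := fubini_kernel mI mE iphi ii (measurable_cos_phase (- (pi / 2))) (kC _).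
have [j1 _] := fubini_kernel mE mI ir iphi (measurable_cos_phase_swap 0) (kC' 0).
have [j2 _] := fubini_kernel mE mI ii iphi (measurable_cos_phase_swap (- (pi / 2))) (kC' _).
have crE z : check_re phi z = Rintegral mu I (fun x => phi x * cos (x * z + 0)).
  transitivity (Rintegral mu setT (fun x => cos (x * z) * phi x)).
    by apply: eq_Rintegral => x _; rewrite mulrC.
  rewrite (check_supported _ phi0); apply: eq_Rintegral => x _.
  by rewrite addr0 mulrC.
have ciE z : check_im phi z = Rintegral mu I (fun x => phi x * cos (x * z + - (pi / 2))).
  transitivity (Rintegral mu setT (fun x => sin (x * z) * phi x)).
    by apply: eq_Rintegral => x _; rewrite mulrC.
  rewrite (check_supported _ phi0); apply: eq_Rintegral => x _.
  by rewrite cosBpihalf mulrC.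
transitivity (Rintegral mu I (fun x => phi x * cos_transform gr a b 0 x) -
    Rintegral mu I (fun x => phi x * cos_transform gi a b (- (pi / 2)) x)).
  rewrite -(RintegralB mI i1 i2); apply: eq_Rintegral => x _.
  by rewrite (partial_inverseE x ir ii) mulrC mulrBr.
rewrite [X in X - _]f1 [X in _ - X]f2 -(RintegralB mE j1 j2).
by apply: eq_Rintegral => z _; rewrite crE ciE.
Qed.

Lemma admissible_displacement alpha (Gam : R -> R -> R) : admissible alpha Gam ->
  exists2 C3 : R, 0 < C3 &
    forall x t, 0 <= t <= 1 -> `|Gam x t - x| <= C3 * t `^ alpha.
Proof.
move=> [_ [G0 [C1 [C2 [C3 [_ [_ [C30 [_ HG]]]]]]]]]; exists C3 => // x t /andP[t0 t1].
rewrite -{2}(G0 x) -[in t `^ alpha](ger0_norm t0) -[in `|t| `^ alpha](subr0 t).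
by apply: HG; apply/andP; split; lra.
Qed.

(** Almost everywhere [S] is the limit along the curve and the limit of the [T n]. The latter are
    dominated by [C DD], so they may be tested term by term against [phi]; the truncated frequency
    integrals converge to that of the hypothesis, and [fr - S / (2 pi)] annihilates all test
    functions. The hypothesis is one half of [fourier_pair], so that the lemma also applies to the
    imaginary part. *)
Lemma ae_convergence_re gamma alpha s (Gam : R -> R -> R) fr gr gi :
  0 < gamma -> 0 < alpha -> alpha <= 1 ->
  2^-1 * Num.max 0 (1 - alpha / gamma) < s -> admissible alpha Gam ->
  Hs_hat s gr gi -> loc_integrable fr ->
  (forall phi, test_function phi ->
     integ setT (fun z => gr z * check_re phi z - gi z * check_im phi z) /\
     Rintegral mu setT (fun x => fr x * phi x) =
       (2 * pi)^-1 * Rintegral mu setT (fun z => gr z * check_re phi z - gi z * check_im phi z)) ->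
  {ae mu, forall x, P_re 1 gamma gr gi (Gam x t) t @[t --> 0^'+] --> fr x}.
Proof.
move=> g0 a0 a1 s0s aG H lfr Hfr.
have [tau [tau0 tau1 tauq taus]] := exists_tau g0 a0 s0s.
have s0 : 0 <= s by lra.
pose b := (1 - tau)^-1; have bE : b = (1 - tau)^-1 by [].
have t1 : 0 < 1 - tau by lra.
have b0 : 0 < b by rewrite invr_gt0.
have b1 : 1 <= b by rewrite invf_ge1//; lra.
have p1 : 1 < b * (2 * s) by rewrite /b mulrC ltr_pdivlMr// mul1r.
have [C3 C30 HC3] := admissible_displacement aG.
have [ir2 ii2] := sobolev_sqr_integrable s0 H.
have [mr [mi _]] := H.
have ir u v : integ `[u, v] gr.
  apply: (integrable_sqr (measurable_itv _) (mu_itv_lty u v) (measurable_funTS mr)).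
  by apply: integrableS ir2 => //; exact: measurable_itv.
have ii u v : integ `[u, v] gi.
  apply: (integrable_sqr (measurable_itv _) (mu_itv_lty u v) (measurable_funTS mi)).
  by apply: integrableS ii2 => //; exact: measurable_itv.
pose C := 1 + (C3 + 2) * (2 * b) * (expR 1 * (1 + 2 `^ b)).
have C0 : 0 <= C.
  apply: addr_ge0 => //; apply: mulr_ge0.
    by apply: mulr_ge0; [apply: addr_ge0 => //; exact: ltW|apply: mulr_ge0 => //; exact: ltW].
  by apply: mulr_ge0; [exact: expR_ge0|apply: addr_ge0 => //; exact: powR_ge0].
pose T n x := Rintegral mu `[- node b n, node b n] (osc gr gi 0 x 0).
(* A limit superior is defined and measurable without knowing where the sequence converges; at
   points of convergence it is the limit. *)
pose S x := fine (limn_esup (fun n => (T n x)%:E)).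
pose M (k : nat) : R := k.+1%:R.
have M0 k : 0 < M k by rewrite ltr0n.
have FF := ae_filter_ringOfSetsType mu.
(* The Bessel constant grows with the interval, so summability is local; the line is exhausted by
   countably many intervals. *)
have step (k : nat) : exists2 DD : RT -> R, integ `[- M k, M k] DD &
    {ae mu, forall x, x \in `[- M k, M k] -> [/\ (forall n, `|T n x| <= C * DD x),
      T n x @[n --> \oo] --> S x &
      Rintegral mu setT (osc gr gi (t `^ gamma) (Gam x t) t) @[t --> 0^'+] --> S x]}.
  have [iD [K HK]] := pair_majorant_summable (M0 k) s0 b0 p1 H.
  have D0 j (x : RT) : 0 <= pair_majorant gr gi b j x.
    rewrite /pair_majorant addr_ge0// piece_majorant_ge0// ?node_lt//.
    by rewrite ltrN2 node_lt.
  have [DD iDD HDD] := ae_summable (measurable_itv _) iD D0 HK.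
  exists DD => //; apply: (@filterS _ _ FF _ _ _ HDD) => x Hx xI.
  have [cD sD] := Hx xI.
  have [TD [l Tl ul]] := @tannery_at_point R gr gi gamma alpha tau b C3 (Gam x) x g0 tau0 tau1
    tauq a1 a0 bE C30 mr mi ir2 ii2 (HC3 x) cD.
  have Sl : S x = l by exact: cvg_fine_limn_esup.
  rewrite Sl; split => // n; apply: le_trans (TD n) _.
  exact: (ler_wpM2l C0 (sD n)).
have mT n : measurable_fun setT (T n : RT -> R).
  rewrite (_ : T n = fun x => cos_transform gr (- node b n) (node b n) 0 x -
      cos_transform gi (- node b n) (node b n) (- (pi / 2)) x).
    by apply: measurable_funB; apply: measurable_cos_transform.
  by apply/funext => x; exact: partial_inverseE.
have mS : measurable_fun setT (S : RT -> R).
  apply: measurableT_comp; first exact: fine_measurable.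
  by apply: measurable_fun_limn_esup => n; apply/measurable_EFinP; exact: mT.
have dom (phi : R -> R) (k : nat) : continuous phi -> integ `[- M k, M k] (fun x => S x * phi x) /\
    Rintegral mu `[- M k, M k] (fun x => T n x * phi x) @[n --> \oo] -->
      Rintegral mu `[- M k, M k] (fun x => S x * phi x).
  move=> cphi; have [DD iDD HDD] := step k.
  pose I := `[- M k, M k]%classic : set RT.
  have mI : measurable I by exact: measurable_itv.
  have mphi : measurable_fun I (phi : RT -> R).
    by apply: measurable_funTS; exact: continuous_measurable_fun.
  have iB : integ I (fun x => `|C * DD x * phi x|).
    apply: integrable_normr; apply: integrable_mul_continuous cphi.
    exact: integrable_scale.
  have [] := @dominated_convergence _ _ _ mu I mI (fun n => EFin \o (fun x => T n x * phi x))
    (EFin \o (fun x => S x * phi x)) (EFin \o (fun x => `|C * DD x * phi x|)).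
  - move=> n; apply/measurable_EFinP; apply: measurable_funM => //.
    exact: measurable_funTS (mT n).
  - apply/measurable_EFinP; apply: measurable_funM => //; exact: measurable_funTS mS.
  - apply: (@filterS _ _ FF _ _ _ HDD) => x Hx Ix; have [_ TS _] := Hx Ix.
    apply: cvg_EFin; first exact: nearW.
    by apply: cvgM => //; exact: cvg_cst.
  - exact: iB.
  - apply: (@filterS _ _ FF _ _ _ HDD) => x Hx n Ix; have [TD _ _] := Hx Ix.
    rewrite /= lee_fin !normrM; apply: ler_wpM2r => //; apply: le_trans (TD n) _.
    by rewrite -normrM ler_norm.
  move=> iS _ cv; split; first exact: iS.
  have fE : Rintegral mu I (fun x => S x * phi x) =
    fine (\int[mu]_(x in I) (EFin \o (fun x => (S x * phi x)%R)) x)%E by [].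
  rewrite [X in _ --> X]fE; apply: fine_cvg; rewrite fineK; first exact: cv.
  exact: (integrable_fin_num mI iS).
have lS : loc_integrable S.
  split; first exact: mS.
  move=> r; pose k := Num.bound `|r|.
  have rk : `|r| < M k.
    by apply: lt_trans (archi_boundP (normr_ge0 r)) _; rewrite ltr_nat.
  have [iS _] := dom (fun=> 1) k (@continuous_const R 1).
  have {}iS : integ `[- M k, M k] S.
    by apply: (eq_integrable_real (measurable_itv _) _ iS) => x _; rewrite mulr1.
  apply: (integrableS _ _ _ iS); try exact: measurable_itv.
  move=> x /=; rewrite !in_itv/= => /andP[h1 h2]; have := ler_norm r.
  by move=> h3; apply/andP; split; lra.
pose h x := fr x - (2 * pi)^-1 * S x.
have lh : loc_integrable h.
  split; first by apply: measurable_funB; [exact: lfr.1|apply: measurable_funM => //; exact: mS].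
  move=> r; apply: integrable_sub; first exact: measurable_itv.
    exact: lfr.2.
  by apply: integrable_scale; [exact: measurable_itv|exact: lS.2].
have h0 : {ae mu, forall x, h x = 0}.
  apply: (ae_eq0_of_test_functions lh) => phi tphi.
  have cphi := test_function_continuous tphi.
  have [ic Hc] := Hfr _ tphi; have [_ [N HN]] := tphi.
  pose k := Num.bound `|N|.
  have Nk : N < M k.
    by apply: le_lt_trans (ler_norm N) _; apply: lt_trans (archi_boundP (normr_ge0 N)) _; rewrite ltr_nat.
  have HM x : M k < `|x| -> phi x = 0 by move=> hx; apply: HN; exact: lt_trans hx.
  pose I := `[- M k, M k]%classic : set RT.
  have mI : measurable I by exact: measurable_itv.
  have [iS cS] := dom phi k cphi.
  have ifr : integ I (fun x => fr x * phi x).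
    by apply: integrable_mul_continuous => //; exact: lfr.2.
  have SE : Rintegral mu I (fun x => S x * phi x) =
      Rintegral mu setT (fun z => gr z * check_re phi z - gi z * check_im phi z).
    apply: (cvg_unique _ cS) => //.
    rewrite (_ : (fun n => _) = (fun n => Rintegral mu `[- node b n, node b n]
      (fun z => gr z * check_re phi z - gi z * check_im phi z))).
      by apply: cvg_Rintegral_sym; [exact: ic|exact: node_cvgy].
    by apply/funext => n; apply: pairing_partial_inverse.
  rewrite (check_supported _ HM).
  have -> : Rintegral mu I (fun x => h x * phi x) = Rintegral mu I (fun x => fr x * phi x) -
      (2 * pi)^-1 * Rintegral mu I (fun x => S x * phi x).
    rewrite -(RintegralZl _ mI iS) -(RintegralB mI ifr (integrable_scale _ mI iS)).
    by apply: eq_Rintegral => x _; rewrite /h mulrBl mulrA.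
  by rewrite -(check_supported _ HM) Hc SE subrr.
have all : {ae mu, forall x, forall k : nat, x \in `[- M k, M k] ->
    Rintegral mu setT (osc gr gi (t `^ gamma) (Gam x t) t) @[t --> 0^'+] --> S x}.
  apply: ae_foralln => k; have [DD _ HDD] := step k.
  by apply: (@filterS _ _ FF _ _ _ HDD) => x Hx /Hx[].
apply: (@filterS2 _ _ FF _ _ _ _ h0 all) => x hx Hx.
have xk : x \in `[- M (Num.bound `|x|), M (Num.bound `|x|)].
  rewrite in_itv/= -ler_norml ltW//.
  by apply: lt_trans (archi_boundP (normr_ge0 x)) _; rewrite ltr_nat.
have {}Hx := Hx _ xk.
have -> : fr x = (2 * pi)^-1 * S x by apply/eqP; rewrite -subr_eq0; apply/eqP.
rewrite (_ : (fun t => _) = (fun t => (2 * pi)^-1 *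
  Rintegral mu setT (osc gr gi (t `^ gamma) (Gam x t) t))).
  by apply: cvgM => //; exact: cvg_cst.
apply/funext => t; rewrite /P_re; congr (_ * _); apply: eq_Rintegral => z _.
by rewrite /osc powRr1.
Qed.

Lemma ae_convergence gamma alpha s (Gam : R -> R -> R) fr fi gr gi :
  0 < gamma -> 0 < alpha -> alpha <= 1 ->
  2^-1 * Num.max 0 (1 - alpha / gamma) < s -> admissible alpha Gam ->
  Hs_hat s gr gi -> fourier_pair fr fi gr gi -> ae_conv 1 gamma Gam fr fi gr gi.
Proof.
move=> g0 a0 a1 s0s aG H [lfr [lfi Hf]].
have FF := ae_filter_ringOfSetsType mu.
have cre : {ae mu, forall x, P_re 1 gamma gr gi (Gam x t) t @[t --> 0^'+] --> fr x}.
  apply: (ae_convergence_re g0 a0 a1 s0s aG H lfr) => phi tphi.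
  by have [h1 [_ [h2 _]]] := Hf _ tphi.
have H' : Hs_hat s gi (fun z => - gr z).
  have [mr [mi fin]] := H; split => //; split; first exact: measurableT_comp.
  by under eq_integral do rewrite sqrrN (addrC (gi _ ^+ 2)).
have cim : {ae mu, forall x, P_re 1 gamma gi (fun z => - gr z) (Gam x t) t @[t --> 0^'+] --> fi x}.
  apply: (ae_convergence_re g0 a0 a1 s0s aG H' lfi) => phi tphi.
  have [_ [h1 [_ h2]]] := Hf _ tphi.
  have E : (fun z => gi z * check_re phi z - - gr z * check_im phi z) =
      (fun z => gr z * check_im phi z + gi z * check_re phi z).
    by apply/funext => z; rewrite mulNr opprK addrC.
  by rewrite E.
apply: (@filterS2 _ _ FF _ _ _ _ cre cim) => x h1 h2; split => //.
rewrite (_ : (fun t => _) = (fun t => P_re 1 gamma gi (fun z => - gr z) (Gam x t) t))//.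
apply/funext => t; rewrite /P_im /P_re; congr (_ * _); apply: eq_Rintegral => z _.
by congr (_ * _); rewrite mulNr opprK addrC.
Qed.

End Identification.

(** * Lacunary sums of combs *)

Section Counterexample.
Variable R : realType.
Local Notation RT := (measurableTypeR R).
Local Notation mu := (@lebesgue_measure R).
Local Notation integ A f := (mu.-integrable A (EFin \o f)).

Section FiniteSums.
Variable G : nat -> RT -> R.
Hypothesis G0 : forall i x, 0 <= G i x.
Hypothesis mG : forall i, measurable_fun setT (G i).
Hypothesis Gfar : forall i (x : RT), `|x| < i%:R -> G i x = 0.

(** As [G i] vanishes for [|x| < i], all later terms are zero: the infinite sum is pointwise finite
    and raises no convergence question. *)
Definition locally_finite_sum (x : RT) : R :=
  \sum_(0 <= i < (Num.bound `|x|).+1) G i x.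

Lemma locally_finite_sumE (x : RT) n : (Num.bound `|x| < n)%N ->
  locally_finite_sum x = \sum_(0 <= i < n) G i x.
Proof.
move=> xn; rewrite /locally_finite_sum [RHS](big_cat_nat _ (n := (Num.bound `|x|).+1))//=.
rewrite -[LHS]addr0; congr (_ + _); apply/esym; rewrite big_nat_cond big1// => i.
move=> /andP[/andP[h _] _]; apply: Gfar; apply: lt_le_trans (archi_boundP (normr_ge0 x)) _.
by rewrite ler_nat; exact: ltnW.
Qed.

Lemma locally_finite_sum_series (x : RT) :
  (locally_finite_sum x)%:E = (\sum_(0 <= i <oo) (G i x)%:E)%E.
Proof.
apply/esym/cvg_lim => //; apply: cvg_near_cst; near=> n.
by rewrite sumEFin -locally_finite_sumE//; near: n; exact: nbhs_infty_gt.
Unshelve. all: by end_near. Qed.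

Lemma locally_finite_sum_ge0 x : 0 <= locally_finite_sum x.
Proof. exact: sumr_ge0. Qed.

Lemma locally_finite_sum_ge x j : G j x <= locally_finite_sum x.
Proof.
rewrite (@locally_finite_sumE x (maxn (Num.bound `|x|) j).+1); last by rewrite ltnS leq_maxl.
rewrite (bigD1_seq j); [|by rewrite mem_index_iota ltnS leq_maxr|exact: iota_uniq].
by rewrite lerDl; exact: sumr_ge0.
Qed.

Lemma measurable_locally_finite_sum : measurable_fun setT locally_finite_sum.
Proof.
apply/measurable_EFinP.
rewrite (_ : EFin \o _ = fun x => \sum_(0 <= i <oo) (G i x)%:E)%E.
  apply: ge0_emeasurable_sum; first by move=> i x _ _; rewrite lee_fin.
  by move=> i _; exact/measurable_EFinP.
by apply/funext => x /=; rewrite locally_finite_sum_series.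
Qed.

(** Peel off the first term with [(x + y)^2 <= 2 x^2 + 2 y^2] and iterate. The geometric weights are
    harmless for lacunary sums and dispense with the disjointness of different combs. *)
Lemma sqr_sum_le (u : nat -> R) n :
  (\sum_(0 <= i < n) u i) ^+ 2 <= \sum_(0 <= i < n) 2 ^+ i.+1 * u i ^+ 2.
Proof.
elim: n u => [|n IH] u; first by rewrite !big_geq// expr0n.
rewrite !big_nat_recl//; have {}IH := IH (fun i => u i.+1).
apply: (@le_trans _ _ (2 * u 0%N ^+ 2 + 2 * (\sum_(0 <= i < n) u i.+1) ^+ 2)).
  move: (u 0%N) (\sum_(_ <= _ < _) _) => x y; have := sqr_ge0 (x - y).
  by rewrite sqrrB sqrrD; lra.
rewrite expr1 lerD2l; apply: le_trans (ler_wpM2l _ IH) _ => //.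
by rewrite mulr_sumr; apply: ler_sum => i _; rewrite mulrA -exprS.
Qed.

(** Monotone convergence, where the number of terms needed to dominate [f] may depend on the point.
    It is used with [f] the sum of combs and with [f] its square. *)
Lemma integral_locally_finite_sum (h : RT -> R) (F : nat -> RT -> R) (f : RT -> R) (K : R) :
  measurable_fun setT h -> (forall x, 0 <= h x) ->
  (forall i, measurable_fun setT (F i)) -> (forall i x, 0 <= F i x) ->
  (forall x, 0 <= f x) ->
  (forall x, exists n, f x <= \sum_(0 <= i < n) F i x) ->
  (forall n, \sum_(0 <= i < n) (\int[mu]_x (h x * F i x)%:E)%E <= K%:E)%E ->
  measurable_fun setT f -> (\int[mu]_x (h x * f x)%:E <= K%:E)%E.
Proof.
move=> mh h0 mF F0 f0 fF FK mf.
have mhF i : measurable_fun setT (fun x => (h x * F i x)%:E).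
  by apply/measurable_EFinP; exact: measurable_funM.
apply: (@le_trans _ _ (\int[mu]_x (\sum_(0 <= i <oo) (h x * F i x)%:E))%E).
  apply: ge0_le_integral => //.
  - by move=> x _; rewrite lee_fin mulr_ge0.
  - by apply/measurable_EFinP; exact: measurable_funM.
  - by apply: ge0_emeasurable_sum => // i x _ _; rewrite lee_fin mulr_ge0.
  - move=> x _; have [n fn] := fF x.
    apply: (@le_trans _ _ (\sum_(0 <= i < n) (h x * F i x)%:E)%E).
      by rewrite sumEFin lee_fin -mulr_sumr; apply: ler_wpM2l.
    by apply: nneseries_lim_ge => i _ _; rewrite lee_fin mulr_ge0.
rewrite integral_nneseries//; last by move=> i x _; rewrite lee_fin mulr_ge0.
apply: lime_le; last exact: nearW.
by apply: is_cvg_nneseries => i _ _; apply: integral_ge0 => x _; rewrite lee_fin mulr_ge0.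
Qed.

End FiniteSums.

Definition comb (c : R) (H K : nat) (x : RT) : R :=
  c * \sum_(0 <= n < K) \1_(`[(H * (K.+1 + n))%:R, (H * (K.+1 + n))%:R + 1[%classic) x.

Lemma comb_ge0 c H K x : 0 <= c -> 0 <= comb c H K x.
Proof. by move=> c0; rewrite mulr_ge0//; apply: sumr_ge0. Qed.

Lemma measurable_comb c H K : measurable_fun setT (comb c H K).
Proof.
apply: measurable_funM => //; apply: measurable_sum => n.
by apply: measurable_indic; exact: measurable_itv.
Qed.

Lemma comb_support c H K x : comb c H K x != 0 ->
  exists n, [/\ (n < K)%N, (H * (K.+1 + n))%:R <= x & x < (H * (K.+1 + n))%:R + 1].
Proof.
apply: contraNP => Hn; rewrite /comb big_nat_cond big1 ?mulr0// => n /andP[/andP[_ nK] _].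
rewrite indicE; case: (boolP (_ \in _)) => //; rewrite inE /= in_itv/= => /andP[h1 h2].
by exfalso; apply: Hn; exists n.
Qed.

Lemma comb_le c H K x : (0 < H)%N -> 0 <= c -> comb c H K x <= c.
Proof.
move=> H0 c0; rewrite /comb -[leRHS]mulr1; apply: ler_wpM2l => //.
case: (pselect (exists2 n, (n < K)%N & x \in `[(H * (K.+1 + n))%:R, (H * (K.+1 + n))%:R + 1[)).
  move=> [n nK xn]; rewrite (bigD1_seq n) /=; [|by rewrite mem_index_iota|exact: iota_uniq].
  rewrite big1 ?addr0; first by rewrite indicE lern1 leq_b1.
  move=> m mn; rewrite indicE; case: (boolP (_ \in _)) => //; rewrite inE /= => xm.
  exfalso; move: xn xm; rewrite !in_itv/= => /andP[h1 h2] /andP[h3 h4].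
  have g1 : (H * (K.+1 + n) < H * (K.+1 + m) + 1)%N.
    by rewrite -(ltr_nat R) natrD; exact: le_lt_trans h1 h4.
  have g2 : (H * (K.+1 + m) < H * (K.+1 + n) + 1)%N.
    by rewrite -(ltr_nat R) natrD; exact: le_lt_trans h3 h2.
  move: g1 g2; rewrite !addn1 !ltnS !leq_pmul2l// !leq_add2l => g1 g2.
  by move/eqP: mn; apply; apply/eqP; rewrite eqn_leq g1 g2.
move=> Hn; rewrite big_nat_cond big1 ?ler01// => n /andP[/andP[_ nK] _].
rewrite indicE; case: (boolP (_ \in _)) => //; rewrite inE /= => xn.
by exfalso; apply: Hn; exists n.
Qed.

Lemma integral_comb c H K : 0 <= c ->
  (\int[mu]_x (comb c H K x)%:E = (c * K%:R)%:E)%E.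
Proof.
move=> c0; under eq_integral do rewrite /comb EFinM.
rewrite ge0_integralZl//; last 2 first.
- apply/measurable_EFinP; apply: measurable_sum => n.
  by apply: measurable_indic; exact: measurable_itv.
- by move=> x _; rewrite lee_fin sumr_ge0.
rewrite EFinM; congr (_ * _)%E.
under eq_integral do rewrite -sumEFin.
rewrite ge0_integral_sum//; last first.
  by move=> n; apply/measurable_EFinP; apply: measurable_indic; exact: measurable_itv.
rewrite (eq_bigr (fun=> 1%E)); last first.
  move=> n _; rewrite integral_indic//.
  rewrite setIT; have := @lebesgue_measure_itv R `[(H * (K.+1 + n))%:R, (H * (K.+1 + n))%:R + 1[.
  rewrite /= lte_fin ltrDl ltr01 -EFinB => E; rewrite [LHS]E; congr EFin; ring.
by rewrite big_mkord sumEFin sumr_const card_ord.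
Qed.

Lemma integral_comb_bounds c H K (h : RT -> R) (l u : R) : 0 <= c -> 0 <= l ->
  measurable_fun setT h -> (forall x, 0 <= h x) ->
  (forall x, comb c H K x != 0 -> l <= h x <= u) ->
  ((l * (c * K%:R))%:E <= \int[mu]_x (h x * comb c H K x)%:E)%E /\
  (\int[mu]_x (h x * comb c H K x)%:E <= (u * (c * K%:R))%:E)%E.
Proof.
move=> c0 l0 mh h0 hlu; have mc := measurable_comb c H K.
have cg x := comb_ge0 H K x c0.
(* The bounds force [0 <= u] only if the comb is nonzero somewhere; otherwise both sides of the
   upper bound vanish. *)
have u0 : 0 <= u \/ forall x, comb c H K x = 0.
  case: (pselect (exists x, comb c H K x != 0)) => [[x /hlu/andP[h1 h2]]|Hn].
    by left; exact: le_trans (le_trans l0 h1) h2.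
  by right => x; apply/eqP; apply: contra_notT Hn => ?; exists x.
have mE : measurable_fun setT (fun x => (comb c H K x)%:E) by exact/measurable_EFinP.
have mhE : measurable_fun setT (fun x => (h x * comb c H K x)%:E).
  by apply/measurable_EFinP; exact: measurable_funM.
split.
  rewrite EFinM -(integral_comb H K c0) -ge0_integralZl//; last by move=> x _; rewrite lee_fin.
  apply: ge0_le_integral => //.
  - by move=> x _; rewrite lee_fin mulr_ge0.
  - exact: measurable_funeM.
  - move=> x _; rewrite -EFinM lee_fin.
    have [->|/hlu/andP[h1 _]] := eqVneq (comb c H K x) 0; first by rewrite !mulr0.
    exact: ler_wpM2r.
case: u0 => [u0|z].
  rewrite EFinM -(integral_comb H K c0) -ge0_integralZl//; last by move=> x _; rewrite lee_fin.
  apply: ge0_le_integral => //.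
  - by move=> x _; rewrite lee_fin mulr_ge0.
  - exact: measurable_funeM.
  - move=> x _; rewrite -EFinM lee_fin.
    have [->|/hlu/andP[_ h1]] := eqVneq (comb c H K x) 0; first by rewrite !mulr0.
    exact: ler_wpM2r.
have := integral_comb H K c0; under eq_integral do rewrite z.
rewrite integral0 => -[<-]; rewrite mulr0.
by under eq_integral do rewrite z mulr0; rewrite integral0.
Qed.

End Counterexample.

(** * The diverging curve *)

Section Divergence.
Variable R : realType.
Local Notation RT := (measurableTypeR R).
Local Notation mu := (@lebesgue_measure R).
Local Notation integ A f := (mu.-integrable A (EFin \o f)).
Implicit Types (s gamma alpha : R).

Definition diverging_curve (alpha : R) (x t : R) : R := x + `|t| `^ alpha - t.

(** Dividing by [u] reduces this to [z <= z^a] on the unit interval, applied to the two fractions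
    [v / u] and [(u - v) / u] of sum 1. *)
Lemma powR_sub_le (a u v : R) : 0 < a -> a <= 1 -> 0 <= v -> v <= u ->
  u `^ a - v `^ a <= (u - v) `^ a.
Proof.
move=> a0 a1 v0 vu; have u0 : 0 <= u by exact: le_trans vu.
have [->|un] := eqVneq u 0.
  by rewrite powR0 ?gt_eqF// add0r (le_trans _ (powR_ge0 _ _))// oppr_le0 powR_ge0.
have up : 0 < u by rewrite lt_neqAle eq_sym un.
have low (z : R) : 0 <= z -> z <= 1 -> z <= z `^ a.
  move=> z0 z1; have [->|zn] := eqVneq z 0; first by rewrite powR0 ?gt_eqF.
  by apply: ger1_powR => //; rewrite z1 lt_neqAle eq_sym zn z0.
have h1 : v / u <= (v / u) `^ a by apply: low; rewrite ?divr_ge0// ler_pdivrMr// mul1r.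
have h2 : (u - v) / u <= ((u - v) / u) `^ a.
  by apply: low; rewrite ?divr_ge0 ?subr_ge0// ler_pdivrMr// mul1r lerBlDr lerDl.
have e1 : v `^ a = u `^ a * (v / u) `^ a.
  by rewrite -powRM ?divr_ge0// mulrC divfK.
have e2 : (u - v) `^ a = u `^ a * ((u - v) / u) `^ a.
  by rewrite -powRM ?divr_ge0 ?subr_ge0// mulrC divfK.
rewrite e1 e2 -[X in X - _]mulr1 -mulrBr; apply: ler_wpM2l; first exact: powR_ge0.
have : v / u + (u - v) / u = 1 by rewrite -mulrDl addrC subrK divff.
move: h1 h2; move: (v / u) (_ / u) (_ `^ a) (_ `^ a) => p q p' q'; lra.
Qed.

Lemma holder_powR_norm (a t t' : R) : 0 < a -> a <= 1 ->
  `| `|t| `^ a - `|t'| `^ a | <= `|t - t'| `^ a.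
Proof.
move=> a0 a1.
have gen (u v : R) : `|v| <= `|u| -> `| `|u| `^ a - `|v| `^ a | <= `|u - v| `^ a.
  move=> vu; rewrite ger0_norm; last first.
    by rewrite subr_ge0; apply: ge0_ler_powR; rewrite ?nnegrE// ltW.
  apply: le_trans (powR_sub_le a0 a1 (normr_ge0 v) vu) _.
  by apply: ge0_ler_powR; rewrite ?nnegrE ?subr_ge0 ?(ltW a0)//; exact: lerB_dist.
have [h|/ltW h] := leP `|t'| `|t|; first exact: gen.
by rewrite distrC (distrC t); exact: gen.
Qed.

Lemma diverging_curve_holder (a x t t' : R) : 0 < a -> a <= 1 -> -1 <= t <= 1 -> -1 <= t' <= 1 ->
  `|diverging_curve a x t - diverging_curve a x t'| <= 3 * `|t - t'| `^ a.
Proof.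
move=> a0 a1 /andP[t0 t1] /andP[t0' t1'].
rewrite (_ : _ - _ = (`|t| `^ a - `|t'| `^ a) - (t - t')); last by rewrite /diverging_curve; ring.
apply: le_trans (ler_normB _ _) _.
have d2 : `|t - t'| <= 2 by rewrite ler_norml; apply/andP; split; lra.
(* The distance may reach 2: up to 1 it is at most its power [a], beyond 1 that power is at least 1.
   Hence the factor 2, and 3 in all. *)
have d : `|t - t'| <= 2 * `|t - t'| `^ a.
  have := normr_ge0 (t - t'); move: d2; move: (`|t - t'|) => d d2 d0.
  have [->|dn] := eqVneq d 0; first by rewrite mulr_ge0 ?powR_ge0.
  have dp : 0 < d by rewrite lt_neqAle eq_sym dn.
  have [d1|d1] := leP d 1.
    have : d <= d `^ a by apply: ger1_powR => //; rewrite dp.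
    by have := powR_ge0 d a; lra.
  have : 1 <= d `^ a by have := ler_powR (ltW d1) (ltW a0); rewrite powRr0.
  lra.
have := holder_powR_norm t t' a0 a1; lra.
Qed.

Lemma admissible_diverging_curve (a : R) : 0 < a -> a <= 1 -> admissible a (diverging_curve a).
Proof.
move=> a0 a1; split; last split.
- have cp : continuous (fun t : R => `|t| `^ a).
    move=> t; apply/cvgrPdist_le => e e0.
    have Hr (r : R) : 0 < r -> \forall z \near t, `|t - z| <= r.
      by move=> r0; move/cvgrPdist_le : (@cvg_id _ (nbhs t)); exact.
    have : `|t - z| `^ a @[z --> t] --> (0 : R).
      apply/cvgrPdist_le => d d0; pose r := d `^ a^-1.
      have r0 : 0 < r by exact: powR_gt0.
      apply: filterS (Hr r r0) => z hz; rewrite sub0r normrN ger0_norm ?powR_ge0//.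
      apply: (@le_trans _ _ (r `^ a)); last first.
        by rewrite /r -powRrM mulVf ?powRr1 ?gt_eqF// ltW.
      by apply: ge0_ler_powR; rewrite ?nnegrE ?(ltW a0) ?(ltW r0).
    move/cvgr0Pnorm_le => /(_ _ e0) H; near=> z.
    apply: le_trans (holder_powR_norm _ _ a0 a1) _.
    by apply: le_trans (ler_norm _) _; near: z.
  apply: continuous_subspaceT => p; rewrite /diverging_curve.
  apply: cvgB; last exact: cvg_snd.
  apply: cvgD; first exact: cvg_fst.
  have h : {for p, continuous ((fun t : R => `|t| `^ a) \o (@snd R R))}.
    by apply: continuous_comp; [exact: cvg_snd|exact: cp].
  exact: h.
- by move=> x; rewrite /diverging_curve normr0 powR0 ?gt_eqF// addr0 subr0.
- exists 1, 1, 3; split => //; split => //; split => //; split.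
    move=> t x x' _; rewrite /diverging_curve mul1r.
    by rewrite (_ : _ - _ = x - x') ?lexx//; ring.
  by move=> x t t' h h'; exact: diverging_curve_holder.
Unshelve. all: by end_near. Qed.

Lemma cos_ge_half (z : R) : `|z| <= 1 -> 2^-1 <= cos z.
Proof.
move=> z1; have -> : z = z / 2 + z / 2 by field.
rewrite cosD -!expr2; have := cos2Dsin2 (z / 2).
have s1 : `|sin (z / 2)| <= `|z / 2|.
  by have := sin_lipschitz (z / 2) 0; rewrite sin0 !subr0.
have : sin (z / 2) ^+ 2 <= 4^-1.
  rewrite -(real_normK (num_real (sin _))).
  have : `|z / 2| <= 2^-1 by rewrite normrM (ger0_norm (_ : 0 <= 2^-1)) ?invr_ge0//; lra.
  by move: (`|sin _|) (`|z / 2|) (normr_ge0 (sin (z / 2))) s1 => u v u0 uv v2; nra.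
move: (sin _) (cos _) => u v; lra.
Qed.

Lemma cos_addn2pi (z : R) (n : nat) : cos (z + n%:R * (2 * pi)) = cos z.
Proof.
elim: n => [|n IH]; first by rewrite mul0r addr0.
rewrite -natr1 mulrDl mul1r addrA -[RHS]IH.
by move: (z + _) => w; rewrite cosD mulr_natl cos2pi sin2pi mulr1 mulr0 subr0.
Qed.

(* [t], [y], [X], [w]: time, height, abscissa and rotation at which block [j] is in phase. *)
Definition in_phase (H K : nat -> nat) (B : nat) (c2 : R) (j : nat) (y X w : R) :=
  [/\ 0 < y, y * (H j * K j)%:R <= c2,
      forall i, (j < i)%N -> B%:R ^+ (i - j) <= y * (H i * K i)%:R &
      forall n z, (n < K j)%N -> (H j * ((K j).+1 + n))%:R <= z -> z < (H j * ((K j).+1 + n))%:R + 1 ->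
        2^-1 <= cos (X * z - w)].

(** The terms below [j] sum to at most [2 A^j / A], those above to at most as much. The error is
    thus [4 / A] relative to [A^j], so for large [A] the term of index [j] dominates. *)
Lemma sum_geometric_split (m : nat -> R) (A : nat) (j : nat) : (2 <= A)%N ->
  (forall i, m i <= A%:R ^+ i) ->
  (forall i, (j < i)%N -> m i <= A%:R ^+ j / A%:R ^+ (i - j)) -> 0 <= m j ->
  forall n, \sum_(0 <= i < n) m i <= m j + A%:R ^+ j * (4 / A%:R).
Proof.
move=> A2 m1 m2 mj0.
have A2' : (2 : R) <= A%:R by rewrite ler_nat.
have A0 : 0 < (A%:R : R) by lra.
have P i : 0 < (A%:R : R) ^+ i by exact: exprn_gt0.
have low n : \sum_(0 <= i < n) m i <= 2 * A%:R ^+ n / A%:R.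
  elim: n => [|n IH]; first by rewrite big_geq// divr_ge0 ?mulr_ge0 ?exprn_ge0// ltW.
  rewrite big_nat_recr//=; apply: le_trans (lerD IH (m1 n)) _.
  rewrite ler_pdivlMr// mulrDl divfK ?gt_eqF// exprS.
  have := ltW (P n); move: (A%:R ^+ n) => p p0; nra.
(* The subtracted [2 / A^(k+1)] is the geometric remainder that keeps the induction going. *)
have high k : \sum_(0 <= i < j.+1 + k) m i <= m j + A%:R ^+ j * (4 / A%:R - 2 / A%:R ^+ k.+1).
  elim: k => [|k IH].
    rewrite addn0 big_nat_recr//= addrC lerD2l expr1.
    have -> : (A%:R ^+ j * (4 / A%:R - 2 / A%:R) : R) = 2 * A%:R ^+ j / A%:R.
      by field; rewrite gt_eqF.
    exact: low.
  rewrite addnS big_nat_recr ?leq_addr//=.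
  have h : (j < j.+1 + k)%N by rewrite addSn ltnS leq_addr.
  apply: le_trans (lerD IH (m2 _ h)) _.
  rewrite -addrA lerD2l (_ : j.+1 + k - j = k.+1)%N; last by rewrite addSnnS addKn.
  rewrite -mulrDr; apply: ler_wpM2l; first exact: ltW.
  have Pk := P k.+1; rewrite [A%:R ^+ k.+2]exprS invfM.
  have : (A%:R : R)^-1 <= 2^-1 by rewrite lef_pV2 ?posrE.
  have : 0 < (A%:R ^+ k.+1 : R)^-1 by rewrite invr_gt0.
  move: (A%:R ^+ k.+1)^-1 (A%:R)^-1 => p q p0 q2; nra.
move=> n; have [nj|jn] := leqP n j.
  apply: le_trans (low n) _; apply: (@le_trans _ _ (A%:R ^+ j * (4 / A%:R))); last by rewrite lerDr.
  rewrite mulrA; apply: ler_wpM2r; first by rewrite invr_ge0 ltW.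
  have : (A%:R : R) ^+ n <= A%:R ^+ j by apply: ler_weXn2l => //; lra.
  by have := P j; lra.
have -> : n = (j.+1 + (n - j.+1))%N by rewrite subnKC.
apply: le_trans (high _) _; rewrite lerD2l; apply: ler_wpM2l; first exact: ltW.
by rewrite gerBl divr_ge0// exprn_ge0// ltW.
Qed.

End Divergence.

(** * Sobolev norm and lower bounds for sums of combs *)

Section CombSum.
Variable R : realType.
Local Notation RT := (measurableTypeR R).
Local Notation mu := (@lebesgue_measure R).
Local Notation integ A f := (mu.-integrable A (EFin \o f)).

(** [s] may be negative, in which case the power decreases and [a^s] itself is the bound; the
    constant [1 + c^s] covers both signs. *)
Lemma powR_between (a z c s : R) : 0 < a -> a <= z -> z <= c * a -> 1 <= c ->
  z `^ s <= (1 + c `^ s) * a `^ s.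
Proof.
move=> a0 az zc c1; have c0 : 0 <= c by lra.
have pa := powR_ge0 a s; have pc := powR_ge0 c s.
have [s0|s0] := leP 0 s.
  apply: (@le_trans _ _ ((c * a) `^ s)).
    by apply: ge0_ler_powR => //; rewrite nnegrE; lra.
  rewrite powRM//; last exact: ltW.
  by rewrite mulrDl mul1r lerDr.
apply: (@le_trans _ _ (a `^ s)); last by rewrite mulrDl mul1r lerDl mulr_ge0.
rewrite -[s]opprK powRN [leRHS]powRN; rewrite lef_pV2 ?posrE ?powR_gt0//; last by lra.
by apply: ge0_ler_powR; rewrite ?nnegrE; lra.
Qed.

Lemma comb_far (c : R) (H K i : nat) (x : RT) : (i <= H)%N -> `|x| < i%:R -> comb c H K x = 0.
Proof.
move=> iH xi; apply/eqP; apply: contraT => /comb_support[n [_ h _]].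
have : `|x| < x.
  apply: lt_le_trans xi _; apply: le_trans h; rewrite ler_nat.
  by apply: leq_trans iH _; rewrite leq_pmulr// addSn.
by rewrite ltNge ler_norm.
Qed.

Definition comb_sum (c : nat -> R) (H K : nat -> nat) : RT -> R :=
  locally_finite_sum (fun i => comb (c i) (H i) (K i)).

(** A comb is at most [c i], so its square has integral at most [c i ^ 2 K i]; [u i] bounds the
    weight on its support, and [2^(i+1)] comes from [sqr_sum_le]. *)
Lemma Hs_hat_comb_sum s c H K (u : nat -> R) C :
  (forall i, 0 <= c i) -> (forall i, 0 < H i)%N -> (forall i, i <= H i)%N ->
  (forall i x, comb (c i) (H i) (K i) x != 0 -> (1 + x ^+ 2) `^ s <= u i) ->
  (forall n, \sum_(0 <= i < n) u i * (2 ^+ i.+1 * c i ^+ 2 * (K i)%:R) <= C) ->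
  Hs_hat s (comb_sum c H K) (fun=> 0).
Proof.
move=> c0 H0 iH hu hC.
have G0 i x := comb_ge0 (H i) (K i) x (c0 i).
have mG i := measurable_comb (c i) (H i) (K i).
have Gfar i x : `|x| < i%:R -> comb (c i) (H i) (K i) x = 0 by exact: comb_far.
have mg := measurable_locally_finite_sum G0 mG Gfar.
split; [exact: mg|split; [exact: measurable_cst|]].
apply: (@le_lt_trans _ _ C%:E); last exact: ltry.
under eq_integral do rewrite expr0n/= addr0.
have d0 i : 0 <= 2 ^+ i.+1 * c i ^+ 2 by rewrite mulr_ge0 ?exprn_ge0.
have E i x : comb (2 ^+ i.+1 * c i ^+ 2) (H i) (K i) x =
    2 ^+ i.+1 * (c i * comb (c i) (H i) (K i) x) by rewrite /comb; ring.
have mw : measurable_fun setT (fun x : RT => (1 + x ^+ 2) `^ s).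
  apply: (measurableT_comp (measurable_powR s)).
  by apply: measurable_funD => //; exact: exprn_measurable.
apply: (integral_locally_finite_sum
  (F := fun i => comb (2 ^+ i.+1 * c i ^+ 2) (H i) (K i))).
- exact: mw.
- by move=> x; exact: powR_ge0.
- by move=> i; exact: measurable_comb.
- by move=> i x; exact: comb_ge0.
- by move=> x; exact: sqr_ge0.
- move=> x; exists (Num.bound `|x|).+1; rewrite /comb_sum /locally_finite_sum.
  apply: le_trans (sqr_sum_le _ _) _; apply: ler_sum => i _; rewrite E expr2.
  apply: ler_wpM2l; first exact: exprn_ge0.
  by apply: ler_wpM2r; [exact: G0|exact: comb_le].
- move=> n; apply: le_trans (_ : (\sum_(0 <= i < n) (u i * (2 ^+ i.+1 * c i ^+ 2 * (K i)%:R))%:E <= _)%E).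
    apply: lee_sum => i _.
    apply: (integral_comb_bounds (l := 0) (d0 i) (lexx 0) mw _ _).2 => x; first exact: powR_ge0.
    move=> hx; rewrite powR_ge0/=; apply: (hu i x).
    by move: hx; rewrite E; apply: contraNneq => ->; rewrite !mulr0.
  by rewrite sumEFin lee_fin.
- by apply: measurable_funX; exact: mg.
Qed.

Lemma expRN_le_inv (u : R) : 0 < u -> expR (- u) <= u^-1.
Proof.
move=> u0; rewrite expRN lef_pV2 ?posrE ?expR_gt0//.
by apply: le_trans (expR_ge1Dx u); rewrite lerDr.
Qed.

(** The cosine is at least 1/2 on the resonant comb [gj] and at least -1 elsewhere; the bound is
    valid in both cases, also where other combs overlap [gj]. *)
Lemma main_term_le (g gj cs : R) : 0 <= gj -> gj <= g -> (gj != 0 -> 2^-1 <= cs) -> -1 <= cs ->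
  3 / 2 * gj - g <= g * cs.
Proof.
move=> g0 gg; have [->|gn] := eqVneq gj 0; first by move=> _ h; nra.
by move=> /(_ isT) h _; nra.
Qed.

Lemma block_balance (k a m I q : R) : k * a <= m -> I <= m + a * q ->
  a * (k / 2 - q) <= 3 / 2 * m - I.
Proof. by lra. Qed.

Lemma comb_support_bounds (c : R) H K (x : RT) : comb c H K x != 0 ->
  (H * K)%:R <= x /\ x <= 2 * (H * K)%:R + 1.
Proof.
move=> /comb_support[n [nK h1 h2]]; split.
  by apply: le_trans h1; rewrite ler_nat leq_mul2l addSn -addnS leq_addr orbT.
apply: le_trans (ltW h2) _; rewrite lerD2r -natrM ler_nat mulnCA leq_mul2l.
by rewrite mul2n -addnn addSn -addnS leq_add2l nK orbT.
Qed.

(** Let [m i] be the damped mass of comb [i]. The integral with the cosine is at least [3/2 m j]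
    minus the total mass, and the total is at most [m j + 4 A^j / A]; since
    [m j >= expR (- 3 c2) A^j], the comb [j] wins as soon as [A] is large compared with
    [expR (3 c2)]. *)
Lemma in_phase_lower (A B : nat) H K (c2 : R) j y X w : (2 <= A)%N -> (A ^ 2 <= B)%N ->
  (forall i, 0 < H i)%N -> (forall i, 0 < K i)%N -> (forall i, i <= H i)%N ->
  in_phase H K B c2 j y X w ->
  let g := comb_sum (fun i => A%:R ^+ i / (K i)%:R) H K in
  integ setT (fun z => expR (- (y * `|z|)) * g z) /\
  A%:R ^+ j * (expR (- (3 * c2)) / 2 - 4 / A%:R) <=
    Rintegral mu setT (fun z => expR (- (y * `|z|)) * (g z * cos (X * z - w))).
Proof.
move=> A2 AB H0 K0 iH [y0 yc yi ph] g.
have A2' : (2 : R) <= A%:R by rewrite ler_nat.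
have A0 : 0 < (A%:R : R) by lra.
have AP i : 0 < (A%:R : R) ^+ i by exact: exprn_gt0.
pose c i : R := A%:R ^+ i / (K i)%:R.
have KR i : 0 < ((K i)%:R : R) by rewrite ltr0n.
have c0 i : 0 <= c i by rewrite divr_ge0// ltW.
have cK i : c i * (K i)%:R = A%:R ^+ i by rewrite divfK// gt_eqF.
have G0 i x := comb_ge0 (H i) (K i) x (c0 i).
have mG i := measurable_comb (c i) (H i) (K i).
have Gfar i x : `|x| < i%:R -> comb (c i) (H i) (K i) x = 0 by exact: comb_far.
have mg : measurable_fun setT g := measurable_locally_finite_sum G0 mG Gfar.
have g0 x : 0 <= g x by exact: locally_finite_sum_ge0.
have gj x : comb (c j) (H j) (K j) x <= g x := locally_finite_sum_ge G0 Gfar x j.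
pose psi (z : RT) := expR (- (y * `|z|)).
have psi0 x : 0 <= psi x by exact: expR_ge0.
have mpsi : measurable_fun setT psi.
  apply: measurableT_comp => //; apply: measurableT_comp => //.
  by apply: measurable_funM => //; exact: measurableT_comp.
pose L i : R := (H i * K i)%:R.
have L1 i : 1 <= L i by rewrite /L ler1n muln_gt0 H0 K0.
have bd i x : comb (c i) (H i) (K i) x != 0 ->
    expR (- (y * (2 * L i + 1))) <= psi x <= expR (- (y * L i)).
  move=> /comb_support_bounds[h1 h2]; have x0 : 0 <= x by exact: le_trans h1.
  by rewrite /psi !ler_expR !lerN2 !ler_pM2l// ger0_norm// h1 h2.
have hb i := integral_comb_bounds (c0 i) (expR_ge0 _) mpsi psi0 (bd i).
pose m i := fine (\int[mu]_x (psi x * comb (c i) (H i) (K i) x)%:E)%E.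
have mE i : (\int[mu]_x (psi x * comb (c i) (H i) (K i) x)%:E = (m i)%:E)%E.
  rewrite fineK// ge0_fin_numE; first by apply: le_lt_trans (hb i).2 _; exact: ltry.
  by apply: integral_ge0 => x _; rewrite lee_fin mulr_ge0.
have mlo i : expR (- (y * (2 * L i + 1))) * A%:R ^+ i <= m i.
  by rewrite -lee_fin -mE -cK; exact: (hb i).1.
have mup i : m i <= expR (- (y * L i)) * A%:R ^+ i.
  by rewrite -lee_fin -mE -cK; exact: (hb i).2.
have m0 i : 0 <= m i.
  by apply: le_trans (mlo i); rewrite mulr_ge0 ?expR_ge0// ltW.
have m1 i : m i <= A%:R ^+ i.
  apply: le_trans (mup i) _; rewrite ler_piMl ?(ltW (AP i))//.
  by rewrite -[leRHS]expR0 ler_expR oppr_le0 mulr_ge0 ?(ltW y0)// (le_trans _ (L1 i)).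
(* From [expR (- u) <= 1 / u] and [u >= B^(i-j) >= A^(2(i-j))]: the damping removes the growth
   [A^(i-j)] and leaves as much decay. This is the reason for [A^2 <= B]. *)
have m2 i : (j < i)%N -> m i <= A%:R ^+ j / A%:R ^+ (i - j).
  move=> ji; apply: le_trans (mup i) _.
  have u0 : 0 < y * L i by rewrite mulr_gt0// (lt_le_trans _ (L1 i)).
  have Ek : (A%:R : R) ^+ i = A%:R ^+ j * A%:R ^+ (i - j) by rewrite -exprD subnKC// ltnW.
  have h1 : expR (- (y * L i)) <= (A%:R ^+ (i - j) * A%:R ^+ (i - j))^-1.
    apply: le_trans (expRN_le_inv u0) _; rewrite lef_pV2 ?posrE ?u0 ?mulr_gt0//.
    apply: le_trans (yi i ji); rewrite -exprMn; apply: lerXn2r; rewrite ?nnegrE ?mulr_ge0 ?(ltW A0)//.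
    by rewrite -natrM ler_nat mulnn.
  rewrite mulrC; apply: le_trans (ler_wpM2l (ltW (AP i)) h1) _.
  by rewrite Ek invfM !mulrA mulfK// gt_eqF.
have sm := sum_geometric_split A2 m1 m2 (m0 j).
pose q : R := 4 / A%:R.
have tot : (\int[mu]_x (psi x * g x)%:E <= (m j + A%:R ^+ j * q)%:E)%E.
  apply: (integral_locally_finite_sum (F := fun i => comb (c i) (H i) (K i))).
  - exact: mpsi.
  - exact: psi0.
  - exact: mG.
  - exact: G0.
  - exact: g0.
  - by move=> x; exists (Num.bound `|x|).+1.
  - by move=> n; under eq_bigr do rewrite mE; rewrite sumEFin lee_fin; exact: sm.
  - exact: mg.
have ig : integ setT (fun x => psi x * g x).
  apply/integrableP; split; first by apply/measurable_EFinP; exact: measurable_funM.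
  under eq_integral do rewrite /= ger0_norm ?mulr_ge0//.
  by apply: le_lt_trans tot _; exact: ltry.
have ij : integ setT (fun x => psi x * comb (c j) (H j) (K j) x).
  apply/integrableP; split; first by apply/measurable_EFinP; exact: measurable_funM.
  under eq_integral do rewrite /= (ger0_norm (mulr_ge0 (psi0 _) (G0 j _))).
  by rewrite mE; exact: ltry.
have tot' : Rintegral mu setT (fun x => psi x * g x) <= m j + A%:R ^+ j * q.
  by rewrite -lee_fin /Rintegral fineK; [exact: tot|exact: integrable_fin_num].
split; first exact: ig.
have mcos : measurable_fun setT (fun z : RT => cos (X * z - w)).
  apply: continuous_measurable_fun => z.
  by have := @continuous_comp _ _ _ (fun z : R => X * z - w) (@cos R); apply;
    [apply: cvgB; [apply: cvgM; [exact: cvg_cst|exact: cvg_id]|exact: cvg_cst]|exact: continuous_cos].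
have icos : integ setT (fun z => psi z * (g z * cos (X * z - w))).
  have := integrable_mul_bounded measurableT ig mcos (fun x _ => cos_max (X * x - w)).
  by apply: eq_integrable_real => // x _; rewrite mulrA.
apply: (@le_trans _ _ (3 / 2 * m j - Rintegral mu setT (fun x => psi x * g x))).
  (* On comb [j] the frequency is at most [2 L j + 1 <= 3 L j], and [y L j <= c2]. *)
  have kj : expR (- (3 * c2)) * A%:R ^+ j <= m j.
    apply: le_trans (mlo j); apply: ler_wpM2r; first exact: ltW.
    rewrite ler_expR lerN2; apply: le_trans (_ : y * (3 * L j) <= _).
      by apply: ler_wpM2l; [exact: ltW|rewrite -lerBrDl; apply: le_trans (L1 j) _; rewrite -mulrBl; lra].
    by rewrite mulrCA ler_pM2l.
  exact: block_balance kj tot'.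
have -> : 3 / 2 * m j - Rintegral mu setT (fun x => psi x * g x) =
    Rintegral mu setT (fun x => 3 / 2 * (psi x * comb (c j) (H j) (K j) x) - psi x * g x).
  by rewrite RintegralB//; [rewrite RintegralZl|exact: integrable_scale].
apply: le_Rintegral => //.
  by apply: integrable_sub => //; exact: integrable_scale.
move=> x _; rewrite mulrCA -mulrBr; apply: ler_wpM2l => //.
apply: main_term_le => //; last exact: cos_geN1.
by move=> /comb_support[n [nK h1 h2]]; exact: (ph n).
Qed.

End CombSum.

(** * Resonant times and the diverging data *)

Section DivergenceTheorem.
Variable R : realType.
Local Notation RT := (measurableTypeR R).
Local Notation mu := (@lebesgue_measure R).
Local Notation integ A f := (mu.-integrable A (EFin \o f)).

Lemma measurable_cos_linear (X : R) : measurable_fun setT (fun z : RT => cos (X * z)).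
Proof.
apply: continuous_measurable_fun => z.
by have := @continuous_comp _ _ _ (fun z : R => X * z) (@cos R); apply;
  [apply: cvgM; [exact: cvg_cst|exact: cvg_id]|exact: continuous_cos].
Qed.

Lemma measurable_sin_linear (X : R) : measurable_fun setT (fun z : RT => sin (X * z)).
Proof.
apply: continuous_measurable_fun => z.
by have := @continuous_comp _ _ _ (fun z : R => X * z) (@sin R); apply;
  [apply: cvgM; [exact: cvg_cst|exact: cvg_id]|exact: continuous_sin].
Qed.

(* On the frequencies [z >= 0] the drift [- t] of the curve cancels the dispersion [t |z|]. *)
Lemma rotated_diverging_curve (gamma alpha : R) (g : RT -> R) x t w : 0 < t ->
  (forall z, z < 0 -> g z = 0) -> integ setT (fun z => expR (- (t `^ gamma * `|z|)) * g z) ->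
  cos w * P_re 1 gamma g (fun=> 0) (diverging_curve alpha x t) t +
  sin w * P_im 1 gamma g (fun=> 0) (diverging_curve alpha x t) t =
  (2 * pi)^-1 * Rintegral mu setT (fun z =>
    expR (- (t `^ gamma * `|z|)) * (g z * cos ((x + t `^ alpha) * z - w))).
Proof.
move=> t0 gn ig; pose X := x + t `^ alpha; pose psi (z : RT) := expR (- (t `^ gamma * `|z|)).
have E (F : R -> R) z : g z * F (diverging_curve alpha x t * z + t * `|z| `^ 1) = g z * F (X * z).
  have [z0|z0] := ltP z 0; first by rewrite gn// !mul0r.
  rewrite powRr1// ger0_norm//; congr (_ * F _).
  by rewrite /X /diverging_curve (gtr0_norm t0); ring.
have -> : P_re 1 gamma g (fun=> 0) (diverging_curve alpha x t) t =
    (2 * pi)^-1 * Rintegral mu setT (fun z => psi z * (g z * cos (X * z))).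
  rewrite /P_re; congr (_ * _); apply: eq_Rintegral => z _.
  by rewrite mul0r subr0 (E (@cos R)) (powRr1 (normr_ge0 z)).
have -> : P_im 1 gamma g (fun=> 0) (diverging_curve alpha x t) t =
    (2 * pi)^-1 * Rintegral mu setT (fun z => psi z * (g z * sin (X * z))).
  rewrite /P_im; congr (_ * _); apply: eq_Rintegral => z _.
  by rewrite mul0r addr0 (E (@sin R)) (powRr1 (normr_ge0 z)).
have ic : integ setT (fun z => psi z * (g z * cos (X * z))).
  have := integrable_mul_bounded measurableT ig (measurable_cos_linear X) (fun x _ => cos_max (X * x)).
  by apply: eq_integrable_real => // z _; rewrite mulrA.
have isin : integ setT (fun z => psi z * (g z * sin (X * z))).
  have := integrable_mul_bounded measurableT ig (measurable_sin_linear X) (fun x _ => sin_max (X * x)).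
  by apply: eq_integrable_real => // z _; rewrite mulrA.
rewrite mulrCA (mulrCA (sin w)) -mulrDr; congr (_ * _).
rewrite -(RintegralZl _ measurableT ic) -(RintegralZl _ measurableT isin).
rewrite -(RintegralD measurableT (integrable_scale _ measurableT ic) (integrable_scale _ measurableT isin)).
by apply: eq_Rintegral => z _; rewrite cosB -/X -/(psi z); ring.
Qed.

Lemma ltr_nat_exp (A N j : nat) (r : R) : (2 <= A)%N -> (Num.bound `|r| <= N)%N -> (N <= j)%N ->
  r < A%:R ^+ j.
Proof.
move=> A2 rN Nj; apply: le_lt_trans (ler_norm r) _.
apply: lt_trans (archi_boundP (normr_ge0 r)) _; rewrite -natrX ltr_nat.
by apply: leq_ltn_trans (leq_trans rN Nj) _; exact: ltn_expl.
Qed.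

Definition resonant H K B (c2 gamma alpha x : R) := forall (delta : R) (N : nat), 0 < delta ->
  exists j t w, [/\ (N <= j)%N, 0 < t, t < delta & in_phase H K B c2 j (t `^ gamma) (x + t `^ alpha) w].

Lemma cvg_at_right_bounded (f : R -> R) (a : R) : f t @[t --> 0^'+] --> a ->
  exists2 d, 0 < d & forall t, 0 < t -> t < d -> `|f t| <= `|a| + 1.
Proof.
move=> /cvgrPdist_le /(_ 1 ltr01); rewrite near_withinE => /nbhs_ballP[d /= d0 Hd].
exists d => // t t0 td; have := Hd t; rewrite /ball /= sub0r normrN gtr0_norm// => /(_ td t0) h.
by rewrite -[f t](subKr a); apply: le_trans (ler_normB _ _) _; rewrite lerD2l.
Qed.

Lemma bounded_contradiction (p k a b cw sw u v I Aj q : R) :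
  0 < p -> 0 < k -> -1 <= cw <= 1 -> -1 <= sw <= 1 ->
  `|u| <= a -> `|v| <= b -> cw * u + sw * v = (2 * p)^-1 * I ->
  Aj * (k / 2 - q) <= I -> q <= k / 4 -> 0 < Aj -> (a + b) * (2 * p) * (4 / k) < Aj -> False.
Proof.
move=> p0 k0 /andP[c1 c2] /andP[s1 s2] ua vb E hI qk A0 hA.
have p2 : 0 < 2 * p by lra.
have cu : cw * u <= a.
  apply: le_trans (ler_norm _) _; rewrite normrM; apply: le_trans ua.
  by apply: ler_piMl => //; rewrite ler_norml c1.
have sv : sw * v <= b.
  apply: le_trans (ler_norm _) _; rewrite normrM; apply: le_trans vb.
  by apply: ler_piMl => //; rewrite ler_norml s1.
have hI2 : I <= (a + b) * (2 * p).
  rewrite -ler_pdivrMr// mulrC -E; lra.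
have h3 : (a + b) * (2 * p) < Aj * (k / 4).
  by move: hA; rewrite -ltr_pdivlMr ?divr_gt0// invf_div.
have h4 : Aj * (k / 4) <= Aj * (k / 2 - q) by rewrite ler_pM2l//; lra.
by move: h3; rewrite ltNge => /negP; apply; apply: le_trans h4 (le_trans hI hI2).
Qed.

Lemma quarter_le (k a : R) : 16 <= k * a -> 4 <= k / 4 * a.
Proof. by lra. Qed.

(** Convergence of both parts would bound them for small [t], whereas at resonant times a rotation
    of the pair is at least a constant times [A^j] with [j] as large as desired. The condition on
    [A] is [4 / A <= k / 4], which leaves half of the main term [k / 2]. Only boundedness is
    contradicted, so no limit whatever is possible. *)
Lemma resonant_diverges (A B : nat) H K (c2 gamma alpha x a b : R) :
  (2 <= A)%N -> (A ^ 2 <= B)%N -> 16 / expR (- (3 * c2)) <= A%:R ->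
  (forall i, 0 < H i)%N -> (forall i, 0 < K i)%N -> (forall i, i <= H i)%N ->
  resonant H K B c2 gamma alpha x ->
  let g := comb_sum (fun i => A%:R ^+ i / (K i)%:R) H K in
  P_re 1 gamma g (fun=> 0) (diverging_curve alpha x t) t @[t --> 0^'+] --> a ->
  P_im 1 gamma g (fun=> 0) (diverging_curve alpha x t) t @[t --> 0^'+] --> b -> False.
Proof.
move=> A2 AB Ak H0 K0 iH res g /cvg_at_right_bounded[d1 d10 H1] /cvg_at_right_bounded[d2 d20 H2].
pose k : R := expR (- (3 * c2)); have k0 : 0 < k by exact: expR_gt0.
pose r : R := (`|a| + 1 + (`|b| + 1)) * (2 * pi) * (4 / k).
have dm0 : 0 < Num.min d1 d2 by rewrite lt_min d10 d20.
have [j [t [w [Nj t0 td ph]]]] := res _ (Num.bound `|r|) dm0.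
have [td1 td2] : t < d1 /\ t < d2 by move: td; rewrite lt_min => /andP[].
have [ig low] := in_phase_lower A2 AB H0 K0 iH ph.
have g0 z : z < 0 -> g z = 0.
  move=> z0; rewrite /g /comb_sum /locally_finite_sum big1// => i _.
  apply/eqP; apply: contraT => /comb_support_bounds[h _].
  by move: z0; rewrite ltNge (le_trans _ h).
have E := @rotated_diverging_curve gamma alpha g x t w t0 g0 ig.
have A0 : 0 < (A%:R : R) by rewrite ltr0n; exact: leq_trans A2.
apply: (bounded_contradiction (pi_gt0 R) k0 _ _ (H1 t t0 td1) (H2 t t0 td2) E low).
- by rewrite cos_geN1 cos_le1.
- by rewrite sin_geN1 sin_le1.
- rewrite ler_pdivrMr//; move: Ak; rewrite ler_pdivrMr// -/k mulrC => h.
  exact: quarter_le h.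
- exact: exprn_gt0.
- exact: (ltr_nat_exp A2 (leqnn _) Nj).
Qed.

Lemma block_size (h k q : R) : 0 < h -> h `^ (q - 1) <= k <= 2 * h `^ (q - 1) ->
  h `^ q <= h * k <= 2 * h `^ q.
Proof.
move=> h0 /andP[k1 k2].
have -> : h `^ q = h * h `^ (q - 1).
  rewrite -{2}(powRr1 (ltW h0)) -powRD; last by rewrite (gt_eqF h0) implybT.
  by congr (_ `^ _); ring.
by rewrite mulrCA !ler_pM2l// k1 k2.
Qed.

Lemma half_ge16 (h : R) : 32 <= h -> 16 <= 2^-1 * h.
Proof. by lra. Qed.

(** With [h = B^j], choose [v = t^alpha] so that [(x + v) h] is a multiple of [2 pi]: all teeth of
    comb [j] start in phase, and as [x + v <= 1] the phase moves by at most 1 across a tooth. Since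
    [t^gamma = v^p], the product with [L_j] is comparable to [(v h)^p], which gives the constant
    [2 (4 pi)^p]; the extra 1 serves the other regime. *)
Lemma in_phase_gt1 (gamma alpha : R) (B : nat) K x j :
  0 < alpha -> 1 <= gamma / alpha -> (32 <= B)%N -> (1 <= j)%N -> 0 < x -> x < 2^-1 ->
  (forall i, (B%:R ^+ i) `^ (gamma / alpha - 1) <= ((K i)%:R : R)
     <= 2 * (B%:R ^+ i) `^ (gamma / alpha - 1)) ->
  exists t, [/\ 0 < t, t `^ alpha <= 16 / B%:R ^+ j &
    in_phase (fun i => B ^ i)%N K B (1 + 2 * (4 * pi) `^ (gamma / alpha)) j
      (t `^ gamma) (x + t `^ alpha) 0].
Proof.
move=> a0 p1 B32 j1 x0 x1 hK; set p := gamma / alpha in p1 hK *.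
have pi0 := pi_gt0 R; have pi4 : (pi : R) < 4.
  by have := pihalf_lt2 R; rewrite ltr_pdivrMr//; move: (pi : R) => y; clear; lra.
have pi1 : 1 <= (pi : R).
  by have := pihalf_ge1 R; rewrite ler_pdivlMr//; move: (pi : R) => y; clear; lra.
have B0 : 0 < (B%:R : R) by rewrite ltr0n; exact: leq_trans B32.
have B1 : 1 <= (B%:R : R) by rewrite ler1n; exact: leq_trans B32.
have P i : 0 < (B%:R : R) ^+ i by exact: exprn_gt0.
have hL i : (B%:R ^+ i) `^ p <= ((B ^ i * K i)%:R : R) <= 2 * (B%:R ^+ i) `^ p.
  by rewrite natrM natrX; exact: block_size.
pose h : R := B%:R ^+ j; have h0 : 0 < h by exact: exprn_gt0.
have h32 : 32 <= h.
  rewrite /h -natrX ler_nat; apply: (leq_trans B32).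
  by rewrite -{1}(expn1 B) leq_exp2l// (leq_trans _ B32).
pose T := Num.Def.trunc (h * x / (2 * pi)).
have /andP[T1 T2] : T%:R <= h * x / (2 * pi) < T.+1%:R.
  by apply: truncn_itv; rewrite divr_ge0 ?mulr_ge0// ltW.
(* Adding 2 and not 1 to the integer part puts [v h] between [2 pi] and [4 pi]: the lower bound is
   needed to damp the combs above [j], and the next multiple of [2 pi] alone would not provide
   it. *)
pose v := 2 * pi * (T + 2)%:R / h - x.
have vh : v * h = 2 * pi * (T + 2)%:R - h * x by rewrite /v mulrBl divfK ?gt_eqF// (mulrC x).
have vh1 : 2 * pi <= v * h.
  move: T2; rewrite vh ltr_pdivrMr ?mulr_gt0// -natr1 natrD.
  by move: (h * x) (T%:R : R) pi0 => y u; move: (pi : R) => z; clear; nra.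
have vh2 : v * h <= 4 * pi.
  move: T1; rewrite vh ler_pdivlMr ?mulr_gt0// natrD.
  by move: (h * x) (T%:R : R) pi0 => y u; move: (pi : R) => z; clear; nra.
have v0 : 0 < v.
  by rewrite -(pmulr_lgt0 _ h0); apply: lt_le_trans vh1; rewrite mulr_gt0.
have v16 : v <= 16 / h.
  rewrite ler_pdivlMr//; apply: le_trans vh2 _.
  by move: (pi : R) pi4 => y; clear; lra.
pose t := v `^ alpha^-1; have t0 : 0 < t by exact: powR_gt0.
have ta : t `^ alpha = v by rewrite /t -powRrM mulVf ?gt_eqF// powRr1// ltW.
have tg : t `^ gamma = v `^ p by rewrite /t -powRrM mulrC.
exists t; rewrite ta tg; split=> //; split.
- exact: powR_gt0.
- apply: (@le_trans _ _ (v `^ p * (2 * h `^ p))).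
    by apply: ler_wpM2l; [exact: powR_ge0|case/andP: (hL j)].
  rewrite mulrCA -powRM ?(ltW v0) ?(ltW h0)//.
  apply: (@le_trans _ _ (2 * (4 * pi) `^ p)); last by rewrite lerDr.
  rewrite ler_pM2l//; apply: ge0_ler_powR => //.
  + by apply: le_trans p1.
  + by rewrite nnegrE mulr_ge0// ltW.
  + by rewrite nnegrE mulr_ge0// ltW.
- move=> i ji; have b1 : 1 <= (B%:R : R) ^+ (i - j) by exact: exprn_ege1.
  apply: (@le_trans _ _ ((B%:R ^+ (i - j)) `^ p)).
    by rewrite -[leLHS](powRr1 (ltW (P _))); exact: ler_powR.
  apply: (@le_trans _ _ (v `^ p * (B%:R ^+ i) `^ p)); last first.
    by apply: ler_wpM2l; [exact: powR_ge0|case/andP: (hL i)].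
  rewrite -powRM ?(ltW v0) ?(ltW (P i))//; apply: ge0_ler_powR; rewrite ?nnegrE ?(le_trans ler01 p1) ?mulr_ge0 ?(ltW v0) ?(ltW (P _))//.
  have -> : (B%:R : R) ^+ i = h * B%:R ^+ (i - j) by rewrite -exprD subnKC// ltnW.
  rewrite mulrA; apply: ler_peMl; first exact: ltW.
  apply: le_trans vh1; move: (pi : R) pi1 => y; clear; lra.
- move=> n z nK; set N := ((K j).+1 + n)%N; rewrite subr0 natrM natrX -/h => z1 z2.
  pose r := z - h * N%:R.
  have -> : (x + v) * z = (x + v) * r + ((T + 2) * N)%:R * (2 * pi).
    rewrite /r mulrBr natrM.
    have -> : (x + v) * (h * N%:R) = (T + 2)%:R * N%:R * (2 * pi).
      have E : (x + v) * h = (T + 2)%:R * (2 * pi).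
        by rewrite mulrDl vh (mulrC x) addrC subrK mulrC.
      by rewrite (mulrA (x + v)) E mulrAC.
    by rewrite subrK.
  rewrite cos_addn2pi; apply: cos_ge_half.
  have r0 : 0 <= r by rewrite subr_ge0.
  have r1 : r <= 1 by rewrite lerBlDl ltW.
  have X1 : x + v <= 1.
    have : 16 / h <= 2^-1 by rewrite ler_pdivrMr//; exact: half_ge16.
    by move: v16 x1; move: (16 / h) => y; clear; lra.
  have X0 : 0 <= x + v by rewrite addr_ge0 ?ltW.
  by rewrite ger0_norm ?mulr_ge0// mulr_ile1.
Qed.

Lemma in_phase_le1 (B j : nat) (c2 X : R) : (0 < B)%N -> 1 <= c2 -> 0 <= X <= 1 ->
  in_phase (fun i => B ^ i)%N (fun=> 1%N) B c2 j (B%:R ^+ j)^-1 X (X * (2 * B%:R ^+ j)).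
Proof.
move=> B0 c1 /andP[X0 X1]; have BR : 0 < (B%:R : R) by rewrite ltr0n.
have P i : 0 < (B%:R : R) ^+ i by exact: exprn_gt0.
split.
- by rewrite invr_gt0.
- by rewrite muln1 natrX mulVf ?gt_eqF.
- move=> i ji; rewrite muln1 natrX -[in leRHS](subnKC (ltnW ji)) exprD mulKf ?gt_eqF//.
- move=> n z; rewrite ltnS leqn0 => /eqP ->; rewrite addn0 natrM natrX mulrC -mulrBr => z1 z2.
  apply: cos_ge_half; have r0 : 0 <= z - 2 * B%:R ^+ j by rewrite subr_ge0.
  have r1 : z - 2 * B%:R ^+ j <= 1 by rewrite lerBlDl ltW.
  by rewrite ger0_norm ?mulr_ge0// mulr_ile1.
Qed.

Lemma powR_lt_inv (t d a : R) : 0 < a -> 0 <= t -> 0 <= d -> t `^ a < d `^ a -> t < d.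
Proof.
move=> a0 t0 d0; rewrite !ltNge; apply: contra => dt.
by apply: ge0_ler_powR; rewrite ?nnegrE// ltW.
Qed.

(* The two regimes: combs of [K i ~ H i ^ (p - 1)] teeth when [p = gamma / alpha > 1],
   single teeth otherwise. *)
Lemma resonant_blocks (gamma alpha s : R) : 0 < gamma -> 0 < alpha ->
  s < 2^-1 * Num.max 0 (1 - alpha / gamma) ->
  exists q : R, [/\ 1 <= q, 0 < q - 1 - q * 2 * s & forall B : nat, (32 <= B)%N ->
    exists K : nat -> nat, [/\ forall i, (0 < K i)%N,
      forall i, (B%:R ^+ i) `^ (q - 1) <= ((K i)%:R : R) <= 2 * (B%:R ^+ i) `^ (q - 1) &
      forall x, 0 < x -> x < 2^-1 -> resonant (fun i => B ^ i)%N K B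
        (1 + 2 * (4 * pi) `^ (gamma / alpha)) gamma alpha x]].
Proof.
move=> g0 a0 hs; pose p := gamma / alpha.
have p0 : 0 < p by rewrite divr_gt0.
have [p1|p1] := leP 1 p.
  (* [q] is the exponent in [L_i] of order [H_i^q]. The inequality to check is [2s < 1 - 1/p]
     multiplied by [p]. *)
  exists p; split => //.
    move: hs; rewrite (_ : alpha / gamma = p^-1); last by rewrite invf_div.
    have pV : p^-1 * p = 1 by rewrite mulVf// gt_eqF.
    have pV1 : p^-1 <= 1 by rewrite invf_le1.
    rewrite max_r ?subr_ge0//; move: p1 pV; move: p^-1 => u p1' pV hs.
    have : s * p < 2^-1 * (1 - u) * p by rewrite ltr_pM2r.
    by rewrite -mulrA mulrBl mul1r pV; move: p0 {pV hs}; clear; nra.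
  move=> B B32; have B1 : 1 <= (B%:R : R) by rewrite ler1n; exact: leq_trans B32.
  pose K i := (Num.Def.trunc ((B%:R ^+ i : R) `^ (p - 1))).+1.
  have hK i : (B%:R ^+ i) `^ (p - 1) <= ((K i)%:R : R) <= 2 * (B%:R ^+ i) `^ (p - 1).
    have /andP[T1 T2] := truncn_itv (powR_ge0 (B%:R ^+ i : R) (p - 1)).
    have b1 : 1 <= (B%:R ^+ i : R) `^ (p - 1).
      rewrite -[leLHS](powRr0 (B%:R ^+ i : R)); apply: ler_powR; last by rewrite subr_ge0.
      exact: exprn_ege1.
    by rewrite (ltW T2)/= /K -natr1 mulr2n mulrDl mul1r lerD.
  exists K; split => // x x0 x1 d N d0.
  pose j := maxn 1 (maxn N (Num.bound `|16 / d `^ alpha|)).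
  have j1 : (1 <= j)%N by rewrite leq_maxl.
  have [t [t0 ta ph]] := in_phase_gt1 a0 p1 B32 j1 x0 x1 hK.
  exists j, t, 0; split => //.
  - by rewrite /j maxnCA leq_maxl.
  - apply: (powR_lt_inv a0); rewrite ?ltW//; apply: le_lt_trans ta _.
    have dp : 0 < d `^ alpha by exact: powR_gt0.
    rewrite ltr_pdivrMr ?exprn_gt0 ?(lt_le_trans _ B1)// mulrC -ltr_pdivrMr//.
    apply: (@ltr_nat_exp _ (Num.bound `|16 / d `^ alpha|)) => //; first exact: leq_trans B32.
    by rewrite /j maxnA leq_maxr.
(* The threshold is 0 here, so [s] is negative and the exponent is [- 2s]: single teeth are
   enough. *)
exists 1; split => //.
  move: hs; rewrite max_l; first by rewrite mulr0 => hs; rewrite subrr mul1r; lra.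
  rewrite subr_le0; have -> : alpha / gamma = p^-1 by rewrite invf_div.
  by rewrite invf_ge1// ltW.
move=> B B32; have B0 : (0 < B)%N by exact: leq_trans B32.
have BR : 0 < (B%:R : R) by rewrite ltr0n.
exists (fun=> 1%N); split => //.
  by move=> i; rewrite subrr powRr0 mulr1 lexx/= ler_nat.
(* Below [e] one has both [t < d] and [t^alpha <= 1/2]; the latter keeps [x + t^alpha] at most 1. *)
move=> x x0 x1 d N d0; pose e := Num.min d (2^-1 `^ alpha^-1).
have e0 : 0 < e by rewrite lt_min d0 powR_gt0.
pose j := maxn N (Num.bound `|(e `^ gamma)^-1|).
have h0 : 0 < (B%:R : R) ^+ j by exact: exprn_gt0.
pose t := ((B%:R ^+ j)^-1 : R) `^ gamma^-1.
have t0 : 0 < t by rewrite powR_gt0 ?invr_gt0.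
have tg : t `^ gamma = (B%:R ^+ j)^-1.
  by rewrite /t -powRrM mulVf ?gt_eqF// powRr1// invr_ge0 ltW.
have te : t < e.
  apply: (powR_lt_inv g0); rewrite ?ltW// tg.
  rewrite -[ltRHS]invrK ltf_pV2 ?posrE ?invr_gt0 ?powR_gt0//.
  apply: (@ltr_nat_exp _ (Num.bound `|(e `^ gamma)^-1|)) => //; first exact: leq_trans B32.
  exact: leq_maxr.
have [td th] : t < d /\ t < 2^-1 `^ alpha^-1 by move: te; rewrite lt_min => /andP[].
have ta : t `^ alpha <= 2^-1.
  have : t `^ alpha <= (2^-1 `^ alpha^-1) `^ alpha.
    by apply: ge0_ler_powR; rewrite ?nnegrE ?powR_ge0 ?ltW.
  by rewrite -powRrM mulVf ?gt_eqF// powRr1.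
exists j, t, ((x + t `^ alpha) * (2 * B%:R ^+ j)); split => //; first exact: leq_maxl.
rewrite tg; apply: in_phase_le1 => //.
  by rewrite lerDl mulr_ge0 ?powR_ge0.
apply/andP; split; first by rewrite addr_ge0 ?powR_ge0// ltW.
by move: ta x1; move: (t `^ alpha) => y; clear; lra.
Qed.

Lemma sum_half_le (n : nat) : \sum_(0 <= i < n) (2^-1 : R) ^+ i <= 2.
Proof.
have -> : \sum_(0 <= i < n) (2^-1 : R) ^+ i = 2 - 2 * 2^-1 ^+ n.
  elim: n => [|n IH]; first by rewrite big_geq// expr0; ring.
  by rewrite big_nat_recr//= IH exprS; field.
by rewrite gerBl mulr_ge0 ?exprn_ge0.
Qed.

Lemma weight_between (L x : R) : 1 <= L -> L <= x -> x <= 2 * L + 1 ->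
  [/\ 0 < L ^+ 2, L ^+ 2 <= 1 + x ^+ 2 & 1 + x ^+ 2 <= 10 * L ^+ 2].
Proof. by move=> *; split; nra. Qed.

Lemma sqr_between (h L : R) : 0 < h -> h <= L -> L <= 2 * h ->
  [/\ 0 < h ^+ 2, h ^+ 2 <= L ^+ 2 & L ^+ 2 <= 4 * h ^+ 2].
Proof. by move=> *; split; nra. Qed.

Lemma sqr_div_mul (a k : R) : k != 0 -> (a / k) ^+ 2 * k = a ^+ 2 / k.
Proof. by move=> k0; field. Qed.

Lemma block_term_le (w t a b k v : R) : 0 <= w -> 0 <= t -> 0 <= a -> 0 <= b -> k <= v ->
  w * b * (2 * t * (a * k)) <= 2 * w * (t * a * (b * v)).
Proof.
move=> w0 t0 a0 b0 kv; rewrite [leLHS](_ : _ = 2 * w * (t * a) * b * k); last by ring.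
by rewrite !mulrA; apply: ler_wpM2l => //; rewrite !mulr_ge0.
Qed.

(** With [L_i] of order [H_i^q] and [K_i] of order [H_i^(q-1)], comb [i] contributes at most a
    constant times [(2 A^2 / B^e)^i], where [e = q - 1 - 2qs]; the 2 stems from [sqr_sum_le]. The
    condition on [B] makes the ratio at most 1/2. *)
Lemma Hs_hat_blocks (s q : R) (A B : nat) K : 1 <= q -> (2 <= A)%N -> (32 <= B)%N ->
  4 * A%:R ^+ 2 <= B%:R `^ (q - 1 - q * 2 * s) -> (forall i, 0 < K i)%N ->
  (forall i, (B%:R ^+ i) `^ (q - 1) <= ((K i)%:R : R) <= 2 * (B%:R ^+ i) `^ (q - 1)) ->
  Hs_hat s (comb_sum (fun i => A%:R ^+ i / (K i)%:R) (fun i => B ^ i)%N K) (fun=> 0).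
Proof.
move=> q1 A2 B32 AB K0 hK; set e := q - 1 - q * 2 * s in AB.
have B0 : (0 < B)%N by exact: leq_trans B32.
have BR : 0 < (B%:R : R) by rewrite ltr0n.
have B1 : 1 <= (B%:R : R) by rewrite ler1n.
have AR : 0 < (A%:R : R) by rewrite ltr0n; exact: leq_trans A2.
have P i : 0 < (B%:R : R) ^+ i by exact: exprn_gt0.
have KR i : 0 < ((K i)%:R : R) by rewrite ltr0n.
have hL i : (B%:R ^+ i) `^ q <= ((B ^ i * K i)%:R : R) <= 2 * (B%:R ^+ i) `^ q.
  by rewrite natrM natrX; exact: block_size.
have L1 i : 1 <= ((B ^ i * K i)%:R : R) by rewrite ler1n muln_gt0 expn_gt0 B0 K0.
pose W : R := (1 + 10 `^ s) * (1 + 4 `^ s).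
have W0 : 0 <= W by rewrite mulr_ge0// addr_ge0 ?powR_ge0.
apply: (@Hs_hat_comb_sum _ s _ _ _ (fun i => W * (B%:R ^+ i) `^ (q * 2 * s)) (4 * W)).
- by move=> i; rewrite divr_ge0// exprn_ge0// ltW.
- by move=> i; rewrite expn_gt0 B0.
- by move=> i; apply: ltnW; apply: ltn_expl; exact: leq_trans B32.
- move=> i x /comb_support_bounds; move: (L1 i) (hL i).
  move: ((B ^ i * K i)%:R : R) => L L1' /andP[hl1 hl2] [x1 x2].
  have hq := powR_gt0 q (P i); set hh := (B%:R ^+ i) `^ q in hq hl1 hl2.
  have -> : (B%:R ^+ i) `^ (q * 2 * s) = (hh ^+ 2) `^ s.
    by rewrite /hh -(powR_mulrn 2 (powR_ge0 _ _)) -!powRrM mulrA.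
  rewrite /W -mulrA; apply: (@le_trans _ _ ((1 + 10 `^ s) * (L ^+ 2) `^ s)).
    by have [? ? ?] := weight_between L1' x1 x2; apply: powR_between; rewrite ?ler1n.
  apply: ler_wpM2l; first by rewrite addr_ge0 ?powR_ge0.
  by have [? ? ?] := sqr_between hq hl1 hl2; apply: powR_between; rewrite ?ler1n.
- move=> n; apply: (@le_trans _ _ (\sum_(0 <= i < n) 2 * W * 2^-1 ^+ i)); last first.
    rewrite -mulr_sumr; apply: le_trans (ler_wpM2l _ (sum_half_le n)) _; first by rewrite mulr_ge0.
    by move: W {W0} => w; clear; lra.
  apply: ler_sum => i _.
  have bq := powR_gt0 (q - 1) (P i).
  have Kle : ((K i)%:R : R)^-1 <= ((B%:R ^+ i) `^ (q - 1))^-1.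
    by rewrite lef_pV2 ?posrE//; case/andP: (hK i).
  have E1 : (A%:R ^+ i / (K i)%:R) ^+ 2 * (K i)%:R = (A%:R ^+ 2) ^+ i * (K i)%:R^-1 :> R.
    by rewrite sqr_div_mul ?gt_eqF// exprAC.
  have E2 : (B%:R ^+ i : R) `^ (q * 2 * s) * ((B%:R ^+ i) `^ (q - 1))^-1 = (B%:R `^ e)^-1 ^+ i.
    rewrite -!powRN -powRD; last by rewrite (gt_eqF (P i)) implybT.
    rewrite -(powR_mulrn i (powR_ge0 B%:R (- e))) -(powR_mulrn i (ltW BR)) -!powRrM.
    congr (_ `^ _).
    by rewrite /e; ring.
  have hB : (B%:R `^ e)^-1 <= (4 * A%:R ^+ 2)^-1 by rewrite lef_pV2 ?posrE ?powR_gt0// mulr_gt0 ?exprn_gt0.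
  have E3 : (2 * A%:R ^+ 2) ^+ i = 2 ^+ i * (A%:R ^+ 2) ^+ i :> R by exact: exprMn.
  apply: (@le_trans _ _ (2 * W * ((2 * A%:R ^+ 2) ^+ i * (B%:R `^ e)^-1 ^+ i))).
    rewrite -E2 -(mulrA (2 ^+ i.+1)) E1 (exprS 2 i) E3.
    by apply: block_term_le; rewrite ?exprn_ge0 ?powR_ge0 ?(ltW AR).
  apply: ler_wpM2l; first by rewrite mulr_ge0.
  rewrite -exprMn; apply: lerXn2r; rewrite ?nnegrE ?mulr_ge0 ?invr_ge0 ?powR_ge0 ?exprn_ge0 ?(ltW AR)//.
  apply: le_trans (ler_wpM2l _ hB) _; first by rewrite mulr_ge0 ?exprn_ge0 ?(ltW AR).
  have : (A%:R ^+ 2 : R) != 0 by rewrite gt_eqF// exprn_gt0.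
  move: (A%:R ^+ 2 : R) => u u0; rewrite le_eqVlt; apply/orP; left; apply/eqP.
  by field.
Qed.

(** The order of choices matters: [c2] depends on [gamma / alpha] only, [A] on [c2], [B] on [A] and
    on the positive exponent [e], the teeth numbers [K] on [B]. Divergence holds at every point of
    []0, 1/2[], a set of positive measure, whatever the candidate limit. *)
Lemma diverging_data (gamma alpha s : R) : 0 < gamma -> 0 < alpha ->
  s < 2^-1 * Num.max 0 (1 - alpha / gamma) ->
  exists gr gi : R -> R, Hs_hat s gr gi /\
    forall fr fi, ~ ae_conv 1 gamma (diverging_curve alpha) fr fi gr gi.
Proof.
move=> g0 a0 hs; have [q [q1 e0 HB]] := resonant_blocks g0 a0 hs.
pose c2 : R := 1 + 2 * (4 * pi) `^ (gamma / alpha).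
pose k : R := expR (- (3 * c2)); have k0 : 0 < k by exact: expR_gt0.
pose A := (Num.Def.trunc (16 / k)).+2.
have Ak : 16 / k <= A%:R.
  have /andP[_ /ltW h] := truncn_itv (divr_ge0 (ler0n R 16) (ltW k0)).
  by apply: le_trans h _; rewrite ler_nat.
have A2 : (2 <= A)%N by [].
set e := q - 1 - q * 2 * s in e0.
pose r : R := (4 * A%:R ^+ 2) `^ e^-1.
pose B := ((Num.Def.trunc r).+1 + (A ^ 2 + 32))%N.
have B32 : (32 <= B)%N by rewrite /B addnA leq_addl.
have AB2 : (A ^ 2 <= B)%N by rewrite /B addnCA leq_addr.
have ABe : 4 * A%:R ^+ 2 <= B%:R `^ e.
  have rB : r <= B%:R.
    have /andP[_ /ltW h] := truncn_itv (powR_ge0 (4 * A%:R ^+ 2 : R) e^-1).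
    by apply: le_trans h _; rewrite ler_nat leq_addr.
  have : r `^ e <= B%:R `^ e by apply: ge0_ler_powR; rewrite ?nnegrE ?powR_ge0// ltW.
  by rewrite /r -powRrM mulVf ?gt_eqF// powRr1// mulr_ge0 ?exprn_ge0.
have [K [K0 hK res]] := HB B B32.
pose H i := (B ^ i)%N.
have H0 i : (0 < H i)%N by rewrite expn_gt0 (leq_trans _ B32).
have iH i : (i <= H i)%N by apply: ltnW; apply: ltn_expl; exact: leq_trans B32.
exists (comb_sum (fun i => A%:R ^+ i / (K i)%:R) H K), (fun=> 0); split.
  exact: Hs_hat_blocks q1 A2 B32 ABe K0 hK.
move=> fr fi hae.
have neg : mu.-negligible (`]0, 2^-1[%classic : set R).
  apply: negligibleS hae => x /=; rewrite in_itv/= => /andP[x0 x1] [h1 h2].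
  exact: (resonant_diverges A2 AB2 Ak H0 K0 iH (res x x0 x1) h1 h2).
have : mu (`]0, 2^-1[%classic : set R) = 0%E.
  by apply/negligibleP => //; exact: measurable_itv.
rewrite lebesgue_measure_itv/= lte_fin invr_gt0 ltr0n/= sube0 => /eqP.
by rewrite eqe invr_eq0 pnatr_eq0.
Qed.

End DivergenceTheorem.

Theorem theorem4p3 (R : realType) (gamma alpha : R) :
  0 < gamma -> 0 < alpha -> alpha <= 1 ->
  let s0 := 2^-1 * Num.max 0 (1 - alpha / gamma) in
  (forall Gam : R -> R -> R, admissible alpha Gam ->
     forall s : R, s0 < s ->
     forall fr fi gr gi : R -> R, Hs_hat s gr gi -> fourier_pair fr fi gr gi ->
       ae_conv 1 gamma Gam fr fi gr gi) /\
  (exists Gam : R -> R -> R, admissible alpha Gam /\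
     forall s : R, s < s0 ->
     exists gr gi : R -> R, Hs_hat s gr gi /\
       forall fr fi : R -> R, fourier_pair fr fi gr gi ->
         ~ ae_conv 1 gamma Gam fr fi gr gi).
Proof.
move=> g0 a0 a1 s0; split.
  by move=> Gam aG s hs fr fi gr gi H F; exact: ae_convergence g0 a0 a1 hs aG H F.
exists (diverging_curve alpha); split; first exact: admissible_diverging_curve.
move=> s hs; have [gr [gi [H Hd]]] := diverging_data g0 a0 hs.
by exists gr, gi; split => // fr fi _; exact: Hd.
Qed.
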